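(* Let $R\subset\mathbb R^N$ be a root system with multiplicity function $k\ge 0$, let $\lambda\in\mathbb R^N$ be a regular drift vector, and let $x\in\mathbb R^N$ be arbitrary. Let $(X_t^\lambda)_{t\ge0}$ be the Dunkl process of type $R$ with multiplicity $k$, drift $\lambda$, and starting point $x$. Then the random variables $(X_t^\lambda-t\lambda)/\sqrt t$ tend in distribution to the standard normal distribution $N(0,I_N)$ on $\mathbb R^N$ as $t\to\infty$.
   Context: Let $N\ge1$ and let $\mathbb R^N$ carry the usual scalar product $\langle\cdot,\cdot\rangle$ and norm $\|\cdot\|$. A root system $R$ is a finite set of vectors in $\mathbb R^N\setminus\{0\}$ such that the reflections $\sigma_\alpha$ on the hyperplanes $\alpha^\perp$ ($\alpha\in R$) generate a finite group $W$ of orthogonal transformations and $\sigma_\alpha(R)=R$ for all $\alpha\in R$. Fix a positive subsystem $R_+\subset R$. A multiplicity function is a $W$-invariant map $k:R\to[0,\infty)$. A vector $\lambda\in\mathbb R^N$ is regular if it does not lie in the boundary of a Weyl chamber, i.e. $\langle\alpha,\lambda\rangle\neq0$ for all $\alpha\in R$. The Dunkl operators are $T_\xi(k)f(x)=\partial_\xi f(x)+\sum_{\alpha\in R_+}k(\alpha)\langle\alpha,\xi\rangle\frac{f(x)-f(\sigma_\alpha(x))}{\langle\alpha,x\rangle}$. The Dunkl kernel $E_k:\mathbb C^N\times\mathbb C^N\to\mathbb C$ is characterized by the property that for each $w\in\mathbb C^N$ the function $f=E_k(\cdot,w)$ is the unique holomorphic solution of $T_\xi(k)f=\langle\xi,w\rangle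 f$ for all $\xi\in\mathbb C^N$ with $f(0)=1$ (here $\langle\cdot,\cdot\rangle$ is extended bilinearly); one has $E_k(x,y)>0$ for $x,y\in\mathbb R^N$. Put $w_k(x)=\prod_{\alpha\in R_+}|\langle\alpha,x\rangle|^{2k(\alpha)}$, $\gamma=\sum_{\alpha\in R_+}k(\alpha)$, and $c_k=\left(\int_{\mathbb R^N}e^{-\|y\|^2/2}w_k(y)\,dy\right)^{-1}$. The Dunkl process of type $R$ with multiplicity $k$ and drift $\lambda$ is the Feller process on $\mathbb R^N$ (with RCLL paths) having transition probabilities $$K_t^{\lambda,k,Dunkl}(x,A)=\frac{c_k e^{-\|\lambda\|^2t/2}}{t^{\gamma+N/2}}\int_A e^{-(\|x\|^2+\|y\|^2)/(2t)}\,\frac{E_k\left(\frac{x}{\sqrt t},\frac{y}{\sqrt t}\right)E_k(y,\lambda)}{E_k(x,\lambda)}\,w_k(y)\,dy$$ for $t>0$, $x\in\mathbb R^N$ and Borel sets $A\subset\mathbb R^N$. *)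

(* Defs.v *)
From HB Require Import structures.
From mathcomp Require Import all_boot all_order all_algebra finmap.
From mathcomp Require Import all_classical all_reals all_analysis.
From mathcomp Require Import measurable_realfun complex.

Set Implicit Arguments.
Unset Strict Implicit.
Unset Printing Implicit Defensive.

Import Order.TTheory GRing.Theory Num.Theory.
Import numFieldNormedType.Exports.

Local Open Scope classical_set_scope.
Local Open Scope ring_scope.

Fact rV_display : measure_display. Proof. exact: default_measure_display. Qed.

Section borel_rV.
Context {R : realType} {n : nat}.

Let borel0 : <<s @open 'rV[R]_n >> set0.
Proof. exact: sigma_algebra0. Qed.

Let borelC A : <<s @open 'rV[R]_n >> A -> <<s @open 'rV[R]_n >> (~` A).
Proof. exact: sigma_algebraC. Qed.

Let borel_bigcup (F : (set 'rV[R]_n)^nat) :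
  (forall i, <<s @open 'rV[R]_n >> (F i)) ->
  <<s @open 'rV[R]_n >> (\bigcup_i F i).
Proof. exact: sigma_algebra_bigcup. Qed.

HB.instance Definition _ := @isMeasurable.Build rV_display
  'rV[R]_n <<s @open 'rV[R]_n >> borel0 borelC borel_bigcup.

End borel_rV.

Section measurable_rV.
Context {R : realType}.

Lemma open_measurable_rV n (A : set 'rV[R]_n) : open A -> measurable A.
Proof. by move=> oA; apply: sub_sigma_algebra. Qed.

Lemma measurable_coord n (j : 'I_n) :
  measurable_fun [set: 'rV[R]_n] (fun v : 'rV[R]_n => v 0 j).
Proof.
apply: (measurability _ (RGenOInfty.measurableE R)) => // _ [_ [x ->] <-].
rewrite setTI; apply: open_measurable_rV.
apply: open_comp => [v _|]; last exact: interval_open.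
exact: coord_continuous.
Qed.

Lemma measurable_fun_rV d (T : measurableType d) n (f : T -> 'rV[R]_n) :
  (forall j, measurable_fun [set: T] (fun t => f t 0 j)) ->
  measurable_fun [set: T] f.
Proof.
move=> mf; apply: (@measurability _ _ _ _ _ _ (@open 'rV[R]_n)) => //.
move=> _ [A oA <-]; rewrite setTI.
pose box (q : 'rV[rat]_n * nat) : set 'rV[R]_n :=
  [set v | forall j, `|v 0 j - ratr (q.1 0 j)| < q.2.+1%:R^-1].
pose D := [set q | box q `<=` A].
have -> : A = \bigcup_(q in D) box q.
  apply/seteqP; split=> [v Av|v [q qA]]; last exact: qA.
  have := open_nbhsE v A; rewrite propeqE => -[] /(_ (conj oA Av)) [_].
  move=> /nbhs_ballP[e /= e0 eA] _.
  have [k ke] : exists k, k.+1%:R^-1 < e / 2.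
    have := @near_infty_natSinv_lt R (PosNum (divr_gt0 e0 (ltr0n _ 2))).
    by move=> [k _ /(_ k (leqnn k))]; exists k.
  have k0 : 0 < k.+1%:R^-1 :> R by rewrite invr_gt0.
  have /choice[q qv] : forall j, exists q : rat,
      `|v 0 j - ratr q| < k.+1%:R^-1.
    move=> j; have vlt : v 0 j - k.+1%:R^-1 < v 0 j + k.+1%:R^-1.
      by rewrite ltrD2l gtrN.
    have [q] := rat_in_itvoo vlt.
    rewrite in_itv /= => /andP[q1 q2]; exists q.
    by rewrite ltr_distlC q1 q2.
  exists (\row_j q j, k); last by move=> j /=; rewrite mxE.
  move=> w wq; apply: eA; split=> // i j; rewrite ord1 /ball /=.
  have := wq j; rewrite /= mxE => wqj.
  rewrite -(subrK (ratr (q j)) (v 0 j)) -addrA (le_lt_trans (ler_normD _ _))//.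
  rewrite [ltRHS](splitr e) ltrD// (lt_trans _ ke)//.
  by rewrite distrC.
rewrite preimage_bigcup bigcup_mkcond.
apply: countable_bigcupT_measurable => // q; case: ifPn => // _.
have -> : f @^-1` box q =
    \bigcap_(j in [set: 'I_n])
      ((fun t => f t 0 j) @^-1` ball (ratr (q.1 0 j) : R) q.2.+1%:R^-1).
  apply/seteqP; split=> t ft j.
    by move=> _; rewrite /= /ball/= distrC; exact: ft.
  by have := ft j I; rewrite /= /ball/= distrC.
apply: fin_bigcap_measurable => // j _.
by rewrite -[X in measurable X]setTI; apply: mf => //; exact: measurable_ball.
Qed.

End measurable_rV.

(* The n-fold product of a sigma-finite measure on the line. *)
Section power_measure.
Context {R : realType}.

Definition cons_rV n (p : measurableTypeR R * 'rV[R]_n) :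
    'rV[R]_n.+1 :=
  row_mx ((p.1 : R)%:M : 'rV_1) p.2.

Lemma measurable_cons_rV n : measurable_fun setT (@cons_rV n).
Proof.
apply: measurable_fun_rV => j; under eq_fun do rewrite mxE.
case: (fintype.split _) => i; last first.
  exact: (measurableT_comp (measurable_coord i) measurable_snd).
under eq_fun do rewrite !mxE ord1 eqxx mulr1n.
exact: measurable_fst.
Qed.

Lemma measurable_uncons_rV n :
  measurable_fun setT (fun v : 'rV[R]_n.+1 =>
    (v 0 0 : measurableTypeR R, rsubmx (v : 'rV_(1 + n)))).
Proof.
apply: measurable_fun_pair; first exact: measurable_coord.
apply: measurable_fun_rV => j; under eq_fun do rewrite mxE.
exact: measurable_coord.
Qed.

Section cons.
Variable mu : {sigma_finite_measure set (measurableTypeR R) -> \bar R}.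
Variable n : nat.
Variable m : {sigma_finite_measure set 'rV[R]_n -> \bar R}.

Definition cons_measure : set 'rV[R]_n.+1 -> \bar R :=
  pushforward (mu \x m)%E (@cons_rV n).

HB.instance Definition _ := Measure.copy cons_measure
  (measure_function_pushforward__canonical__measure_function_Measure
     (mu \x m)%E (@measurable_cons_rV n)).

Let cons_measure_sigma_finite : sigma_finite setT cons_measure.
Proof.
have /sigma_finiteP[F [FT ndF Foo]] := sigma_finiteT mu.
have /sigma_finiteP[G [GT ndG Goo]] := sigma_finiteT m.
pose u (v : 'rV[R]_n.+1) :=
  (v 0 0 : measurableTypeR R, rsubmx (v : 'rV_(1 + n))).
have consK p : u (cons_rV p) = p.
  case: p => x v; rewrite /u /cons_rV /= row_mxKr; congr pair.
  by rewrite mxE; case: splitP => // i _; rewrite mxE ord1 eqxx.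
exists (fun k => u @^-1` (F k `*` G k)).
  apply/seteqP; split=> // v _.
  have [i _ Fi] : (\bigcup_i F i) (u v).1 by rewrite -FT.
  have [j _ Gj] : (\bigcup_i G i) (u v).2 by rewrite -GT.
  exists (maxn i j) => //; split.
    by move: Fi; exact/subsetPset/ndF/leq_maxl.
  by move: Gj; exact/subsetPset/ndG/leq_maxr.
move=> k; have [mF muF] := Foo k; have [mG mG_] := Goo k; split.
  rewrite -[X in measurable X]setTI; apply: measurable_uncons_rV => //.
  exact: measurableX.
rewrite /cons_measure /pushforward -comp_preimage.
rewrite (_ : u \o _ = id); last by apply/funext => p; exact: consK.
by rewrite preimage_id product_measure1E// lte_mul_pinfty// ge0_fin_numE.
Qed.

HB.instance Definition _ := Measure_isSigmaFinite.Build _ _ _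
  cons_measure cons_measure_sigma_finite.

End cons.

Fixpoint power_measure
    (mu : {sigma_finite_measure set (measurableTypeR R) -> \bar R}) (n : nat) :
    {sigma_finite_measure set 'rV[R]_n -> \bar R} :=
  match n with
  | 0 => \d_(0 : 'rV[R]_0)
  | n.+1 => cons_measure mu (power_measure mu n)
  end.

End power_measure.

Definition lebesgue_rV (R : realType) n :
    {sigma_finite_measure set 'rV[R]_n -> \bar R} :=
  power_measure (@lebesgue_measure R) n.

Definition std_normal_rV (R : realType) n :
    {sigma_finite_measure set 'rV[R]_n -> \bar R} :=
  power_measure (@normal_prob R 0 1) n.

(* The norm that the library puts on row vectors is the sup norm; the Euclidean
   norm enters only through [sqnorm].  On complex vectors [dot] is the bilinear
   extension, with no conjugation. *)
Definition dot (F : fieldType) N (u v : 'rV[F]_N) : F :=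
  \sum_(j < N) u 0 j * v 0 j.

Definition sqnorm (R : realType) N (x : 'rV[R]_N) : R := dot x x.

Definition reflection (F : fieldType) N (a x : 'rV[F]_N) : 'rV[F]_N :=
  x - (2 * dot a x / dot a a) *: a.

Section root_systems.
Context {R : realType} {N : nat}.
Local Notation V := 'rV[R]_N.
Implicit Types (Rt Rp : {fset V}) (k : V -> R).

(* Reflections are involutions, so the monoid they generate is a group. *)
Inductive weyl_group Rt : set (V -> V) :=
| weyl_id : weyl_group Rt id
| weyl_mul a w : a \in Rt -> weyl_group Rt w ->
    weyl_group Rt (reflection a \o w).

Record root_system Rt : Prop := {
  root_neq0 : 0 \notin Rt;
  root_stable : forall a, a \in Rt -> [fset reflection a b | b in Rt]%fset = Rt;
  weyl_finite : finite_set (weyl_group Rt) }.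

Definition positive_subsystem Rt Rp : Prop :=
  exists b : V, (forall a, a \in Rt -> dot a b != 0) /\
    Rp = [fset a in Rt | 0 < dot a b]%fset.

Definition multiplicity_function Rt k : Prop :=
  (forall a, a \in Rt -> 0 <= k a) /\
  (forall w a, weyl_group Rt w -> a \in Rt -> k (w a) = k a).

Definition regular Rt (lam : V) : Prop :=
  forall a, a \in Rt -> dot a lam != 0.

End root_systems.

Section dunkl_kernel.
Context {R : realType} {N : nat}.
Local Notation V := 'rV[R]_N.
Local Notation VC := 'rV[R[i]]_N.
Implicit Types (Rp : {fset V}) (k : V -> R) (f : VC -> R[i]^o).

Definition complexify (x : V) : VC := map_mx (real_complex R) x.

(* The singularity on the hyperplane [dot a z = 0] is removable, and there the
   quotient takes its limit: for z = z0 + h a with [dot a z0 = 0] it equals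
   (f (z0 + h a) - f (z0 - h a)) / (h [dot a a]). *)
Definition dunkl_quotient (a : V) f (z : VC) : R[i] :=
  let ac := complexify a in
  if dot ac z == 0 then 2 / dot ac ac * 'D_ac f z
  else (f z - f (reflection ac z)) / dot ac z.

Definition dunkl_operator Rp k (xi : VC) f (z : VC) : R[i] :=
  'D_xi f z +
  \sum_(a <- Rp) real_complex R (k a) * dot (complexify a) xi *
    dunkl_quotient a f z.

(* Frechet differentiability over the complex field is holomorphy. *)
Record dunkl_eigenfunction Rp k (w : VC) f : Prop := {
  dunkl_holomorphic : forall z, differentiable f z;
  dunkl_eigen : forall xi z, dunkl_operator Rp k xi f z = dot xi w * f z;
  dunkl_at0 : f 0 = 1 }.

Definition is_dunkl_kernel Rp k (E : VC -> VC -> R[i]^o) : Prop :=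
  forall w f, dunkl_eigenfunction Rp k w f <-> f = (fun z => E z w).

End dunkl_kernel.

Section dunkl_transition.
Context {R : realType} {N : nat}.
Local Notation V := 'rV[R]_N.
Local Notation VC := 'rV[R[i]]_N.
Local Notation mu := (lebesgue_rV R N).
Variables (Rp : {fset V}) (k : V -> R) (E : VC -> VC -> R[i]^o) (lam : V).

(* The Dunkl kernel is real at real arguments. *)
Definition real_kernel (x y : V) : R :=
  complex.Re (E (complexify x) (complexify y)).

Definition dunkl_weight (x : V) : R :=
  \prod_(a <- Rp) `|dot a x| `^ (2 * k a).

Definition dunkl_gamma : R := \sum_(a <- Rp) k a.

Definition dunkl_const : R :=
  (\int[mu]_y (expR (- sqnorm y / 2) * dunkl_weight y))^-1.

Definition dunkl_density (t : R) (x y : V) : R :=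
  dunkl_const * expR (- (sqnorm lam * t) / 2) / t `^ (dunkl_gamma + N%:R / 2) *
  expR (- (sqnorm x + sqnorm y) / (2 * t)) *
  (real_kernel ((Num.sqrt t)^-1 *: x) ((Num.sqrt t)^-1 *: y) *
     real_kernel y lam / real_kernel x lam) *
  dunkl_weight y.

Definition dunkl_transition (t : R) (x : V) (A : set V) : \bar R :=
  (\int[mu]_(y in A) (dunkl_density t x y)%:E)%E.

Definition dunkl_semigroup (t : R) (f : V -> R) (x : V) : R :=
  if t == 0 then f x else \int[mu]_y (f y * dunkl_density t x y).

End dunkl_transition.

Section processes.
Context {R : realType} {N : nat}.
Local Notation V := 'rV[R]_N.

Definition vanishing_at_infinity (f : V -> R) : Prop :=
  continuous f /\
  forall e : R, 0 < e -> exists M : R, forall x, M < sqnorm x -> `|f x| < e.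

Record feller_semigroup (Q : R -> (V -> R) -> V -> R) : Prop := {
  feller_stable : forall (t : R) f, 0 <= t ->
    vanishing_at_infinity f -> vanishing_at_infinity (Q t f);
  feller_linear : forall (t a : R) f g, 0 <= t ->
    vanishing_at_infinity f -> vanishing_at_infinity g ->
    Q t (fun x => a * f x + g x) = (fun x => a * Q t f x + Q t g x);
  feller_sub_markov : forall (t : R) f, 0 <= t -> vanishing_at_infinity f ->
    (forall x, 0 <= f x <= 1) -> forall x, 0 <= Q t f x <= 1;
  feller_at0 : forall f, vanishing_at_infinity f -> Q 0 f = f;
  feller_comp : forall (s t : R) f, 0 <= s -> 0 <= t ->
    vanishing_at_infinity f -> Q (s + t) f = Q s (Q t f);
  feller_cvg : forall f, vanishing_at_infinity f -> forall e : R, 0 < e ->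
    \forall t \near (0 : R)^'+, forall x, `|Q t f x - f x| < e }.

Context {d : measure_display} {T : measurableType d}.

(* Times are reals, and only the values of [X] at nonnegative times matter. *)
Definition natural_filtration (X : R -> T -> V) (s : R) : set (set T) :=
  <<s [set B | exists (u : R) (A : set V),
        [/\ 0 <= u <= s, measurable A & B = X u @^-1` A]] >>.

Record dunkl_process (Rp : {fset V}) (k : V -> R)
    (E : 'rV[R[i]]_N -> 'rV[R[i]]_N -> R[i]^o) (lam x : V)
    (P : probability T R) (X : R -> T -> V) : Prop := {
  dunkl_feller : feller_semigroup (dunkl_semigroup Rp k E lam);
  dunkl_measurable : forall t : R, 0 <= t -> measurable_fun setT (X t);
  dunkl_start : {ae P, forall w, X 0 w = x};
  dunkl_right_continuous : forall w (t : R), 0 <= t ->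
    X u w @[u --> t^'+] --> X t w;
  dunkl_left_limits : forall w (t : R), 0 < t -> cvg (X u w @[u --> t^'-]);
  dunkl_markov : forall (s t : R) (A : set V) (B : set T),
    0 <= s -> 0 < t -> measurable A -> natural_filtration X s B ->
    P (B `&` X (s + t) @^-1` A) =
    (\int[P]_(w in B) dunkl_transition Rp k E lam t (X s w) A)%E }.

Definition cvg_in_distribution (P : probability T R) (Y : R -> T -> V)
    (nu : {measure set V -> \bar R}) : Prop :=
  forall g : V -> R, continuous g -> (exists M : R, forall y, `|g y| <= M) ->
    (\int[P]_w g (Y t w)) @[t --> +oo] --> \int[nu]_y g y.

End processes.

(* Main.v *)
Require Import Defs.
From mathcomp Require Import all_boot all_order all_algebra finmap.
From mathcomp Require Import all_classical all_reals all_analysis.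
From mathcomp Require Import measurable_realfun complex.
From mathcomp Require Import ring lra.

Set Implicit Arguments.
Unset Strict Implicit.
Unset Printing Implicit Defensive.

Import Order.TTheory GRing.Theory Num.Theory.
Import numFieldNormedType.Exports.
Local Open Scope classical_set_scope.
Local Open Scope ring_scope.

(* Along a ray s eta the functions u_i(s) = E(s eta, i), for i in the orbit O of
   lam, solve u_i' = <eta, i> u_i - (1/s) sum_a k(a) (u_i - u_(sigma_a i)), a
   system whose singular part is dissipative.  Energy estimates give
   |E(s eta, i)| <= C exp(s max_j <eta, j>) and the continuity of E in its second
   argument.  When <eta, o - i> >= delta for every i <> o in O, the functions
   q_i = s^gamma exp(-s <eta, o>) u_i solve q_i' = -<eta, o - i> q_i +
   (1/s) sum_a k(a) q_(sigma_a i); since sigma_a o <> o by regularity, q_i = O(1/s)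
   for i <> o, hence q_o' = O(1/s^2) and q_o converges, uniformly in eta.

   In the chart y = t mu + sqrt t z, mu in O, the density of X_t is
   exp(-|z|^2/2) times q_lam (with o = mu) times factors that converge, and on the
   cone where mu maximises <y, .> over O it is dominated by C exp(-|z|^2/8).  These
   cones cover the space; by dominated convergence those of mu <> lam carry no
   mass in the limit and that of lam gives a multiple of the Gaussian.  The total
   mass 1 identifies the multiple, so the limit of q_lam is never computed. *)

(** * Differential inequalities *)

(** The kernel is given only as the unique normalised joint eigenfunction, so every fact about it
    comes from uniqueness or from an ordinary differential equation. Uniqueness yields
    [E (sigma z) w = E z (sigma w)]. On a ray this turns a reflected argument into a reflected
    spectral parameter, which is why the system closes on a finite orbit; the singular coefficient
    is [1 / s] because [<a, eta> / <a, s eta>] does not depend on [a]. Its sign is what allows a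
    start at [s = 0]: each reflection permutes the orbit, so [sum_i u_i (u_i - u_(sigma_a i))] is
    nonnegative.

    A single chart around [t lam] is not enough, since the available bound on [E y lam] is the
    exponential of [<y, mu>] with [mu] the orbit point dominant at [y]. As [|mu| = |lam|],
    completing the square with [mu] produces [expR (- |y - t mu|^2 / (2 t))], so each cone gets its
    own centre. *)

Section real_functions.
Context {R : realType}.
Implicit Types (f g h df dg : R -> R) (a b c s t x C K : R).

(** The formula and the sign of the derivative are asked only inside the interval: the radial
    systems start at [s = 0], where the coefficient [1 / s] is singular and only derivability is
    known. *)
Lemma is_derive_nincr f g a b : a <= b ->
  (forall s, a <= s <= b -> derivable f s 1) ->
  (forall s, a < s < b -> is_derive s 1 f (g s)) ->
  (forall s, a < s < b -> g s <= 0) -> f b <= f a.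
Proof.
move=> ab df dfg g0.
have itv s : s \in `]a, b[%R -> a < s < b by rewrite in_itv.
apply: (@ler0_derive1_le_cc _ f a b) => //.
- by move=> s /itv/dfg[].
- by move=> s /itv asb; rewrite derive1E; have [_ ->] := dfg _ asb; exact: g0.
- apply: derivable_within_continuous => s; rewrite in_itv /=; exact: df.
- by rewrite in_itv /= lexx ab.
- by rewrite in_itv /= lexx ab.
Qed.

Lemma is_derive_mul f g x (df dg : R) : is_derive x 1 f df -> is_derive x 1 g dg ->
  is_derive x 1 (fun s => f s * g s) (f x * dg + g x * df).
Proof. by move=> hf hg; exact: is_deriveM. Qed.

Lemma is_derive_add f g x (df dg : R) : is_derive x 1 f df -> is_derive x 1 g dg ->
  is_derive x 1 (fun s => f s + g s) (df + dg).
Proof. by move=> hf hg; exact: is_deriveD. Qed.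

Lemma is_derive_sqr f x (df : R) : is_derive x 1 f df ->
  is_derive x 1 (fun s => f s ^+ 2) (2 * f x * df).
Proof.
move=> hf; rewrite (_ : (fun _ => _) = (fun s => f s * f s)); last first.
  by apply/funext => s; rewrite expr2.
by apply: is_derive_eq (is_derive_mul hf hf) _; ring.
Qed.

Lemma is_derive_bigsum (I : Type) (r : seq I) (P : pred I) (h dh : I -> R -> R)
    x : (forall i, P i -> is_derive x 1 (h i) (dh i x)) ->
  is_derive x 1 (fun s => \sum_(i <- r | P i) h i s)
                (\sum_(i <- r | P i) dh i x).
Proof.
move=> dhx; elim: r => [|i r IH].
  under eq_fun do rewrite big_nil; rewrite big_nil; exact: is_derive_cst.
under eq_fun do rewrite big_cons; rewrite big_cons.
case: ifPn => // Pi; apply: is_derive_add IH; exact: dhx.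
Qed.

Lemma is_derive_comp f g x (df dg : R) : is_derive (g x) 1 f df ->
  is_derive x 1 g dg -> is_derive x 1 (fun s => f (g s)) (df * dg).
Proof. by move=> hf hg; exact: is_derive1_comp. Qed.

Lemma is_derive_scale c x : is_derive x 1 (fun s => c * s) c.
Proof.
apply: is_derive_eq (is_derive_mul (is_derive_cst c x 1) (is_derive_id x 1)) _.
by rewrite mulr1 mulr0 addr0.
Qed.

Lemma is_derive_expR_scale c x :
  is_derive x 1 (fun s => expR (c * s)) (c * expR (c * x)).
Proof.
apply: is_derive_eq (is_derive_comp (is_derive_expR _) (is_derive_scale c x)) _.
exact: mulrC.
Qed.

Lemma is_derive_inv x : 0 < x -> is_derive x 1 (fun s => s^-1) (- x ^- 2).
Proof.
move=> x0; have xn0 : x != 0 by rewrite gt_eqF.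
apply: DeriveDef; first exact: (@derivableV _ _ id).
by rewrite (@deriveV _ _ id)// derive_id /GRing.scale /= mulr1.
Qed.

Lemma is_derive_powR c x : 0 < x ->
  is_derive x 1 (fun s => s `^ c) (c / x * x `^ c).
Proof.
move=> x0; apply: is_derive_eq (is_derive1_powR c x0) _.
rewrite powRB; last by rewrite (gt_eqF x0) implybT.
by rewrite powRr1 ?(ltW x0)//; field; rewrite gt_eqF.
Qed.

Lemma derivable_mul f g x : derivable f x 1 -> derivable g x 1 ->
  derivable (fun s => f s * g s) x 1.
Proof. by move=> /derivableP hf /derivableP hg; have [] := is_derive_mul hf hg. Qed.

Lemma derivable_expR_scale c x : derivable (fun s => expR (c * s)) x 1.
Proof. by have [] := is_derive_expR_scale c x. Qed.

Lemma gronwall0 f df c a b : a <= b ->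
  (forall s, a <= s <= b -> derivable f s 1) ->
  (forall s, a < s < b -> is_derive s 1 f (df s)) ->
  (forall s, a < s < b -> df s <= c * f s) ->
  f b <= expR (c * (b - a)) * f a.
Proof.
move=> ab df1 dfP dfle.
suff : expR (- c * b) * f b <= expR (- c * a) * f a.
  rewrite -(ler_pM2l (expR_gt0 (c * b))) !mulrA -!expRD.
  by rewrite mulNr subrr expR0 mul1r mulrBr mulNr.
have h1 s : a <= s <= b -> derivable (fun s => expR (- c * s) * f s) s 1.
  by move=> /df1; apply: derivable_mul; exact: derivable_expR_scale.
have h2 s : a < s < b -> is_derive s 1 (fun s => expR (- c * s) * f s)
    (expR (- c * s) * df s + f s * (- c * expR (- c * s))).
  by move=> /dfP; apply: is_derive_mul; exact: is_derive_expR_scale.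
apply: is_derive_nincr ab h1 h2 _ => s sab.
rewrite (_ : _ + _ = expR (- c * s) * (df s - c * f s)); last by ring.
by rewrite mulr_ge0_le0 ?expR_ge0// subr_le0 dfle.
Qed.

Lemma gronwall f df c K b : 0 <= b -> 0 <= c -> 0 <= K ->
  (forall s, 0 <= s <= b -> derivable f s 1) ->
  (forall s, 0 < s < b -> is_derive s 1 f (df s)) ->
  (forall s, 0 < s < b -> df s <= c * f s + K) ->
  f b <= expR (c * b) * (f 0 + K * b).
Proof.
move=> b0 c0 K0 df1 dfP dfle.
(* After multiplication by the integrating factor, which is at most 1, the forcing costs at most [K]
   per unit of time; the linear term pays for it. *)
pose g s := expR (- c * s) * f s + (- K) * s.
suff : g b <= g 0.
  rewrite /g !mulr0 expR0 mul1r addr0 (mulNr K) lerBlDr.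
  rewrite -(ler_pM2l (expR_gt0 (c * b))) mulrA -!expRD.
  by rewrite mulNr subrr expR0 mul1r.
have h1 s : 0 <= s <= b -> derivable g s 1.
  move=> /df1 d1; have [d2 _] := is_derive_scale (- K) s.
  apply: derivableD d2; apply: derivable_mul d1; exact: derivable_expR_scale.
have h2 s : 0 < s < b -> is_derive s 1 g
    (expR (- c * s) * df s + f s * (- c * expR (- c * s)) + - K).
  move=> /dfP d1; apply: is_derive_add (is_derive_scale _ _).
  by apply: is_derive_mul => //; exact: is_derive_expR_scale.
apply: is_derive_nincr b0 h1 h2 _ => s sab.
have e1 : expR (- c * s) <= 1.
  by rewrite -[leRHS]expR0 ler_expR mulNr oppr_le0 mulr_ge0//; lra.
have e0 := expR_gt0 (- c * s).
rewrite (_ : _ + _ = expR (- c * s) * (df s - c * f s) - K); last by ring.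
rewrite subr_le0 (@le_trans _ _ (expR (- c * s) * K))//; last first.
  by rewrite ler_piMl.
by rewrite ler_pM2l// lerBlDl dfle.
Qed.

(* The constant solution is [C / c]. *)
Lemma damped_bound f df c C a b : a <= b -> 0 < c -> 0 <= C ->
  (forall s, a <= s <= b -> is_derive s 1 f (df s)) ->
  (forall s, a <= s <= b -> df s <= - c * f s + C) ->
  0 <= f a -> f b <= f a + C / c.
Proof.
move=> ab c0 C0 dfP dfle fa.
have cC : c * (C / c) = C by field; rewrite gt_eqF.
have Cc0 : 0 <= C / c by rewrite divr_ge0// ltW.
have h s : a <= s <= b -> is_derive s 1 (fun u => f u - C / c) (df s + 0).
  move=> sab; exact: is_derive_add (dfP _ sab) _.
have wk s : a < s < b -> a <= s <= b by lra.
have h1 s : a <= s <= b -> derivable (fun u => f u - C / c) s 1 by case/h.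
have h2 s : a < s < b -> df s + 0 <= - c * (f s - C / c).
  by move=> sab; have := dfle s (wk _ sab); rewrite mulrBr (mulNr c (C / c)) cC; lra.
have := gronwall0 ab h1 (fun s sab => h s (wk s sab)) h2.
have e1 : expR (- c * (b - a)) <= 1.
  by rewrite -[leRHS]expR0 ler_expR mulNr oppr_le0 mulr_ge0//; lra.
have e0 := expR_gt0 (- c * (b - a)).
set e := expR _ in e1 e0 *; set D := C / c in Cc0 *.
have : e * D >= 0 by rewrite mulr_ge0// ltW.
have : e * f a <= f a by rewrite ler_piMl.
lra.
Qed.

End real_functions.
(** * Radial systems *)

Section radial_system.
Context {R : realType} {I : finType} {B : eqType}.
Variables (r : seq B) (kap : B -> R) (tau : B -> I -> I).
Hypothesis kap0 : forall b, b \in r -> 0 <= kap b.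
Hypothesis tau_inj : forall b, b \in r -> injective (tau b).
Implicit Types (u v q : I -> R -> R) (a d : I -> R) (s t : R).

Lemma sum_tau (w : I -> R) b : b \in r ->
  \sum_i w (tau b i) = \sum_i w i.
Proof. by move=> /tau_inj tb; rewrite [RHS](reindex_inj tb). Qed.

(** Each [v i * (v i - v (tau b i))] is at least [(v i ^+ 2 - v (tau b i) ^+ 2) / 2], and these
    lower bounds add up to 0 because [tau b] is a permutation. *)
Lemma reflection_dissipative (v : I -> R) :
  0 <= \sum_i v i * \sum_(b <- r) kap b * (v i - v (tau b i)).
Proof.
under eq_bigr do rewrite mulr_sumr; rewrite exchange_big /=.
rewrite big_seq; apply: sumr_ge0 => b br.
under eq_bigr => i _ do rewrite mulrCA; rewrite -mulr_sumr.
apply: mulr_ge0; first exact: kap0.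
rewrite (@le_trans _ _ (\sum_i (v i ^+ 2 - v (tau b i) ^+ 2) / 2))//.
  rewrite -mulr_suml sumrB (sum_tau (fun i => v i ^+ 2) br).
  by rewrite subrr mul0r.
apply: ler_sum => i _; have := sqr_ge0 (v i - v (tau b i)); lra.
Qed.

Let energy_derive u du s :
  (forall i, is_derive s 1 (u i) (du i)) ->
  is_derive s 1 (fun s => \sum_i u i s ^+ 2) (\sum_i 2 * u i s * du i).
Proof.
move=> hu; apply: (@is_derive_bigsum _ _ _ _ (fun i s => u i s ^+ 2)
  (fun i s => 2 * u i s * du i)) => i _.
exact: is_derive_sqr.
Qed.

Lemma radial_energy u a m t : 0 <= t ->
  (forall i s, derivable (u i) s 1) ->
  (forall i s, 0 < s -> is_derive s 1 (u i)
    (a i * u i s - s^-1 * \sum_(b <- r) kap b * (u i s - u (tau b i) s))) ->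
  (forall i, a i <= m) ->
  \sum_i u i t ^+ 2 <= expR (2 * m * t) * \sum_i u i 0 ^+ 2.
Proof.
move=> t0 u1 du am.
have h1 s : 0 <= s <= t -> derivable (fun s => \sum_i u i s ^+ 2) s 1.
  by move=> _; have [] := energy_derive (fun i => derivableP (u1 i s)).
have h2 s : 0 < s < t -> is_derive s 1 (fun s => \sum_i u i s ^+ 2)
    (\sum_i 2 * u i s * (a i * u i s -
       s^-1 * \sum_(b <- r) kap b * (u i s - u (tau b i) s))).
  by move=> /andP[s0 _]; apply: energy_derive => i; exact: du.
have := @gronwall0 _ _ _ (2 * m) _ _ t0 h1 h2; rewrite subr0; apply => s /andP[s0 _].
have D := reflection_dissipative (u ^~ s).
rewrite mulr_sumr.
rewrite (_ : \sum_i _ = \sum_i 2 * a i * u i s ^+ 2 - 2 / s *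
  \sum_i u i s * \sum_(b <- r) kap b * (u i s - u (tau b i) s)); last first.
  rewrite mulr_sumr -sumrB; apply: eq_bigr => i _; ring.
rewrite (@le_trans _ _ (\sum_i 2 * a i * u i s ^+ 2))//.
  by rewrite gerBl// mulr_ge0// divr_ge0// ltW.
apply: ler_sum => i _; rewrite ler_wpM2r ?sqr_ge0//.
by rewrite ler_wpM2l.
Qed.

(** Meant for the difference of two solutions, hence the zero initial values. Splitting
    [2 * u * g <= u ^+ 2 + g ^+ 2] is the origin of the [+ 1] in the rate. *)
Lemma radial_energy_forced u a (g : I -> R -> R) c K :
  0 <= c -> 0 <= K ->
  (forall i s, derivable (u i) s 1) ->
  (forall i s, 0 < s -> is_derive s 1 (u i)
    (a i * u i s + g i s
     - s^-1 * \sum_(b <- r) kap b * (u i s - u (tau b i) s))) ->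
  (forall i, a i <= c) -> (forall s, 0 < s < 1 -> \sum_i g i s ^+ 2 <= K) ->
  (forall i, u i 0 = 0) ->
  \sum_i u i 1 ^+ 2 <= expR (2 * c + 1) * K.
Proof.
move=> c0 K0 u1 du ac gK u0.
have h1 s : 0 <= s <= 1 -> derivable (fun s => \sum_i u i s ^+ 2) s 1.
  by move=> _; have [] := energy_derive (fun i => derivableP (u1 i s)).
have h2 s : 0 < s < 1 -> is_derive s 1 (fun s => \sum_i u i s ^+ 2)
    (\sum_i 2 * u i s * (a i * u i s + g i s -
       s^-1 * \sum_(b <- r) kap b * (u i s - u (tau b i) s))).
  by move=> /andP[s0 _]; apply: energy_derive => i; exact: du.
have c1 : 0 <= 2 * c + 1 by lra.
rewrite -[X in expR X]mulr1 -[X in _ * X]mulr1.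
have -> : K * 1 = \sum_i u i 0 ^+ 2 + K * 1.
  by rewrite big1 ?add0r// => i _; rewrite u0 expr0n.
apply: (gronwall ler01 c1 K0 h1 h2) => s s01.
have D := reflection_dissipative (u ^~ s).
have s0 : 0 < s by lra.
rewrite (_ : \sum_i _ = \sum_i (2 * a i * u i s ^+ 2 + 2 * u i s * g i s)
  - 2 / s *
  \sum_i u i s * \sum_(b <- r) kap b * (u i s - u (tau b i) s)); last first.
  rewrite mulr_sumr -sumrB; apply: eq_bigr => i _; ring.
rewrite (@le_trans _ _ (\sum_i (2 * a i * u i s ^+ 2 + 2 * u i s * g i s)))//.
  by rewrite gerBl// mulr_ge0// divr_ge0// ltW.
rewrite (le_trans _ (lerD (lexx _) (gK _ s01)))// mulr_sumr -big_split /=.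
apply: ler_sum => i _.
have := sqr_ge0 (u i s - g i s); have := ler_wpM2r (sqr_ge0 (u i s)) (ac i).
lra.
Qed.

End radial_system.

(** * Damped systems with one undamped component *)

Section damped_system.
Context {R : realType} {I : finType} {B : eqType}.
Variables (r : seq B) (kap : B -> R) (tau : B -> I -> I) (o : I).
Hypothesis kap0 : forall b, b \in r -> 0 <= kap b.
Hypothesis tau_inj : forall b, b \in r -> injective (tau b).
Hypothesis tau_o : forall b, b \in r -> tau b o != o.

Local Notation gam := (\sum_(b <- r) kap b).
Local Notation off v := (\sum_(i | i != o) v i ^+ 2).

Let gam0 : 0 <= gam.
Proof. by rewrite big_seq sumr_ge0// => b; exact: kap0. Qed.

Let off0 (v : I -> R) : 0 <= off v.
Proof. by apply: sumr_ge0 => i _; exact: sqr_ge0. Qed.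

Let off_ge (v : I -> R) i : i != o -> v i ^+ 2 <= off v.
Proof.
move=> io; rewrite (bigD1 i)//= lerDl sumr_ge0// => j _; exact: sqr_ge0.
Qed.

Let young (x y e s : R) : 0 < e -> 0 < s ->
  2 * x * y / s <= e * x ^+ 2 + y ^+ 2 / (e * s ^+ 2).
Proof.
move=> e0 s0; rewrite -subr_ge0.
rewrite (_ : _ - _ = (e * x - y / s) ^+ 2 / e); last first.
  by field; rewrite !gt_eqF.
by rewrite divr_ge0 ?sqr_ge0// ltW.
Qed.

(** The cost of a product depends on the partner [tau b i]. If it is not [o], the inequality of
    means costs [1 / s] on both squares, and injectivity of [tau b] keeps the total within the
    off-energy. If it is [o], the weighted inequality puts [1 / s ^+ 2] on [v o ^+ 2]: this rate is
    integrable at infinity, [1 / s] is not. *)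
Let off_cross (v : I -> R) b (e s : R) : b \in r -> 0 < e -> 0 < s ->
  \sum_(i | i != o) 2 * v i * v (tau b i) / s <=
  (2 / s + e) * off v + v o ^+ 2 / (e * s ^+ 2).
Proof.
move=> br e0 s0; have si0 : 0 <= s^-1 by rewrite invr_ge0 ltW.
pose w j := if j == o then v o ^+ 2 / (e * s ^+ 2) else v j ^+ 2 / s.
have w0 j : 0 <= w j.
  rewrite /w; case: ifP => _; rewrite divr_ge0 ?sqr_ge0// ?(ltW s0)//.
  by rewrite mulr_ge0 ?sqr_ge0// ltW.
have wE : \sum_i w i = v o ^+ 2 / (e * s ^+ 2) + off v / s.
  rewrite (bigD1 o)//= {1}/w eqxx mulr_suml; congr (_ + _).
  by apply: eq_bigr => i /negbTE io; rewrite /w io.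
have -> : (2 / s + e) * off v + v o ^+ 2 / (e * s ^+ 2) =
    (s^-1 + e) * off v + \sum_i w (tau b i).
  rewrite (sum_tau tau_inj _ br) wE; ring.
have le_w : \sum_(i | i != o) w (tau b i) <= \sum_i w (tau b i).
  by rewrite [leRHS](bigID (predC1 o))/= lerDl sumr_ge0.
apply: le_trans (lerD (lexx _) le_w).
rewrite mulr_sumr -big_split /=; apply: ler_sum => i io; rewrite /w.
case: eqVneq => [->|tio].
  apply: le_trans (young _ _ e0 s0) _; rewrite lerD2r.
  by rewrite mulrDl lerDr mulr_ge0// sqr_ge0.
have := ler_wpM2r si0 (sqr_ge0 (v i - v (tau b i))).
have : 0 <= e * v i ^+ 2 by rewrite mulr_ge0 ?sqr_ge0// ltW.
lra.
Qed.

Let off_rate (v d : I -> R) (del e s : R) : 0 < e -> 0 < s ->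
  (forall i, i != o -> del <= d i) ->
  \sum_(i | i != o) 2 * v i *
     (- d i * v i + s^-1 * \sum_(b <- r) kap b * v (tau b i)) <=
  - (2 * del) * off v +
    gam * ((2 / s + e) * off v + v o ^+ 2 / (e * s ^+ 2)).
Proof.
move=> e0 s0 dd.
rewrite (_ : \sum_(i | _) _ = \sum_(i | i != o) (- 2 * d i * v i ^+ 2) +
    \sum_(b <- r) kap b * \sum_(i | i != o) 2 * v i * v (tau b i) / s);
  last first.
  under [X in _ = _ + X]eq_bigr do rewrite mulr_sumr.
  rewrite exchange_big -big_split /=; apply: eq_bigr => i _.
  rewrite mulrDr; congr (_ + _); first by ring.
  by rewrite !mulr_sumr; apply: eq_bigr => b _; ring.
apply: lerD.
  rewrite mulr_sumr; apply: ler_sum => i io.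
  by rewrite ler_wpM2r ?sqr_ge0//; have := dd _ io; lra.
rewrite mulr_suml big_seq [leRHS]big_seq; apply: ler_sum => b br.
by rewrite ler_wpM2l ?kap0// off_cross.
Qed.

(** As no [tau b] fixes [o], only products of [v o] with other components occur; a self-coupling
    would add a term in [v o ^+ 2 / s], that is, growth by a power of [s]. *)
Let base_rate (v : I -> R) (e s : R) : 0 < e -> 0 < s ->
  2 * v o * (s^-1 * \sum_(b <- r) kap b * v (tau b o)) <=
  gam * (e * off v + v o ^+ 2 / (e * s ^+ 2)).
Proof.
move=> e0 s0; set G := (X in _ <= _ * X); rewrite !mulr_sumr mulr_suml big_seq [leRHS]big_seq.
apply: ler_sum => b br; rewrite {}/G.
rewrite (_ : _ * (_ * _) = kap b * (2 * v (tau b o) * v o / s)); last by ring.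
rewrite ler_wpM2l ?kap0//; apply: le_trans (young _ _ e0 s0) _.
by rewrite lerD2r ler_wpM2l ?(ltW e0)// off_ge// tau_o.
Qed.

(** The summand [4 * gam / del] makes [2 * gam / s] at most [del / 2], [4 / del] lets the damping
    absorb the derivative of the weight [s ^+ 2], and 1 keeps the starting time away from 0. *)
Let step0 del : R := 1 + 4 * gam / del + 4 / del.

(** Chosen for [gam * eps del <= del / 2], with [gam + 1] to allow [gam = 0]; [lyap] below is the
    resulting coefficient of [q o ^+ 2 / s ^+ 2]. *)
Let eps del : R := del / (2 * (gam + 1)).

Let lyap del : R := gam / eps del.

Section solution.
Variables (del : R) (q : I -> R -> R) (d : I -> R).
Hypothesis del0 : 0 < del.
Hypothesis d_off : forall i, i != o -> del <= d i.
Hypothesis d_o : d o = 0.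
Hypothesis dq : forall i (s : R), 0 < s -> is_derive s 1 (q i)
  (- d i * q i s + s^-1 * \sum_(b <- r) kap b * q (tau b i) s).

Let s0 := step0 del.
Let e := eps del.
Let K := lyap del.

Let e0 : 0 < e.
Proof. by rewrite divr_gt0// mulr_gt0//; have := gam0; lra. Qed.

Let s01 : 1 <= s0.
Proof.
have := gam0; have : 0 <= gam / del by rewrite divr_ge0// ltW.
have : 0 <= del^-1 by rewrite invr_ge0 ltW.
by rewrite /s0 /step0 -mulrA; lra.
Qed.

Let sgt0 (s : R) : s0 <= s -> 0 < s. Proof. by have := s01; lra. Qed.

Let K0 : 0 <= K. Proof. by rewrite divr_ge0// ltW. Qed.

Let Rr (s : R) := off (q ^~ s).

Let dRr (s : R) : 0 < s -> is_derive s 1 Rr (\sum_(i | i != o) 2 * q i s *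
  (- d i * q i s + s^-1 * \sum_(b <- r) kap b * q (tau b i) s)).
Proof.
move=> sp; apply: (@is_derive_bigsum _ _ _ _ (fun i s => q i s ^+ 2)
  (fun i s => 2 * q i s * (- d i * q i s +
     s^-1 * \sum_(b <- r) kap b * q (tau b i) s))) => i _.
by apply: is_derive_sqr; exact: dq.
Qed.

Let dp (s : R) : 0 < s ->
  is_derive s 1 (q o) (s^-1 * \sum_(b <- r) kap b * q (tau b o) s).
Proof.
by move=> sp; apply: is_derive_eq (dq o sp) _; rewrite d_o oppr0 mul0r add0r.
Qed.

Let game : gam * e <= del / 2.
Proof.
rewrite (_ : gam * e = gam / (gam + 1) * (del / 2)); last first.
  by rewrite /e /eps; field; rewrite gt_eqF//; have := gam0; lra.
rewrite ler_piMl ?divr_ge0 ?(ltW del0)//.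
by rewrite ler_pdivrMr ?mul1r; have := gam0; lra.
Qed.

Let gams (s : R) : s0 <= s -> 2 * gam / s <= del / 2.
Proof.
move=> ss; rewrite ler_pdivrMr ?sgt0//.
apply: le_trans (ler_wpM2l _ ss); last by rewrite divr_ge0// ltW.
rewrite /s0 /step0; have -> : del / 2 * (1 + 4 * gam / del + 4 / del) =
  del / 2 + 2 * gam + 2 by field; rewrite gt_eqF.
by have := del0; lra.
Qed.

(** Of the damping [2 * del], one [del / 2] is lost to [2 * gam / s] and another to [gam * e]; [del]
    is left. *)
Let Rr_rate (s : R) : s0 <= s -> \sum_(i | i != o) 2 * q i s *
  (- d i * q i s + s^-1 * \sum_(b <- r) kap b * q (tau b i) s) <=
  - del * Rr s + K / s ^+ 2 * q o s ^+ 2.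
Proof.
move=> ss; have sp := sgt0 ss.
apply: le_trans (off_rate (q ^~ s) e0 sp d_off) _; rewrite -/(Rr s).
have -> : - (2 * del) * Rr s +
    gam * ((2 / s + e) * Rr s + q o s ^+ 2 / (e * s ^+ 2)) =
    (- (2 * del) + 2 * gam / s + gam * e) * Rr s + K / s ^+ 2 * q o s ^+ 2.
  by rewrite /K /lyap -/e; field; rewrite !gt_eqF.
rewrite lerD2r ler_wpM2r ?off0//.
by have := gams ss; have := game; lra.
Qed.

Let p_rate (s : R) : s0 <= s ->
  2 * q o s * (s^-1 * \sum_(b <- r) kap b * q (tau b o) s) <=
  del / 2 * Rr s + K / s ^+ 2 * q o s ^+ 2.
Proof.
move=> ss; have sp := sgt0 ss.
apply: le_trans (base_rate (q ^~ s) e0 sp) _; rewrite -/(Rr s).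
have -> : gam * (e * Rr s + q o s ^+ 2 / (e * s ^+ 2)) =
    gam * e * Rr s + K / s ^+ 2 * q o s ^+ 2.
  by rewrite /K /lyap -/e; field; rewrite !gt_eqF.
by rewrite lerD2r ler_wpM2r ?off0// game.
Qed.

Let Phi (s : R) := q o s ^+ 2 + Rr s.

Let dPhi (s : R) : 0 < s -> is_derive s 1 Phi
  (2 * q o s * (s^-1 * \sum_(b <- r) kap b * q (tau b o) s) +
   \sum_(i | i != o) 2 * q i s *
     (- d i * q i s + s^-1 * \sum_(b <- r) kap b * q (tau b i) s)).
Proof.
move=> sp; apply: is_derive_add (dRr sp); apply: is_derive_sqr; exact: dp.
Qed.

(* [expR (- 2 K / s)] solves [y' = 2 K / s^2 y]. *)
Let Phi_bound (s : R) : s0 <= s -> Phi s <= expR (2 * K) * Phi s0.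
Proof.
move=> ss; pose f (s : R) := expR (2 * K * s^-1) * Phi s.
have Phi0 (t : R) : 0 <= Phi t by rewrite addr_ge0 ?sqr_ge0// off0.
have df (t : R) : 0 < t -> is_derive t 1 f (expR (2 * K * t^-1) *
  (2 * q o t * (t^-1 * \sum_(b <- r) kap b * q (tau b o) t) +
   \sum_(i | i != o) 2 * q i t *
     (- d i * q i t + t^-1 * \sum_(b <- r) kap b * q (tau b i) t)) +
   Phi t * (2 * K * expR (2 * K * t^-1) * - t ^- 2)).
  move=> tp; apply: is_derive_mul (dPhi tp).
  exact: is_derive_comp (is_derive_expR_scale _ _) (is_derive_inv tp).
have : f s <= f s0.
  have h1 (t : R) : s0 <= t <= s -> derivable f t 1.
    by move=> /andP[/sgt0 tp _]; have [] := df _ tp.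
  have h2 (t : R) (ht : s0 < t < s) := df t (lt_le_trans ltr01 (le_trans s01
    (ltW (proj1 (andP ht))))).
  apply: is_derive_nincr ss h1 h2 _ => t /andP[/ltW st _].
  have tp := sgt0 st.
  set A := (X in _ * X + _).
  rewrite (_ : _ + _ = expR (2 * K * t^-1) * (A - 2 * K / t ^+ 2 * Phi t));
    last by ring.
  rewrite mulr_ge0_le0 ?expR_ge0// subr_le0.
  apply: le_trans (lerD (p_rate st) (Rr_rate st)) _.
  have : 0 <= K / t ^+ 2 * Rr t.
    by rewrite mulr_ge0 ?off0// divr_ge0 ?sqr_ge0.
  have : 0 <= del * Rr t by rewrite mulr_ge0 ?off0// ltW.
  by rewrite /Phi; lra.
rewrite /f => fs.
have e1 : 1 <= expR (2 * K * s^-1).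
  by rewrite -[leLHS]expR0 ler_expR mulr_ge0 ?mulr_ge0// invr_ge0 ltW// sgt0.
have e2 : expR (2 * K * s0^-1) <= expR (2 * K).
  rewrite ler_expR ler_piMr//; first exact: mulr_ge0.
  by rewrite invf_le1// (lt_le_trans ltr01).
apply: le_trans (ler_wpM2r (Phi0 s0) e2).
by apply: le_trans fs; rewrite ler_peMl.
Qed.

Let M1 (D : R) := expR (2 * K) * D.
Let M2 (D : R) := s0 ^+ 2 * D + K * M1 D / (del / 2).

(** With the total energy bounded, [s ^+ 2 * Rr s] obeys a damped inequality with constant forcing
    [K * M1 D]: the derivative of the weight adds [2 * s * Rr s], for which half of the damping pays
    once [s >= 4 / del]. So the off components are of order [1 / s]. *)
Let Rr_bound (D s : R) : Phi s0 <= D -> s0 <= s -> s ^+ 2 * Rr s <= M2 D.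
Proof.
move=> PD ss; have D0 : 0 <= D.
  by apply: le_trans PD; rewrite addr_ge0 ?sqr_ge0// off0.
have M10 : 0 <= M1 D by rewrite mulr_ge0 ?expR_ge0.
pose f (t : R) := t ^+ 2 * Rr t.
pose df (t : R) := t ^+ 2 * (\sum_(i | i != o) 2 * q i t *
    (- d i * q i t + t^-1 * \sum_(b <- r) kap b * q (tau b i) t)) +
  Rr t * (2 * t * 1).
have h1 (t : R) : s0 <= t <= s -> is_derive t 1 f (df t).
  move=> /andP[/sgt0 tp _]; apply: is_derive_mul (dRr tp).
  by apply: is_derive_sqr; exact: is_derive_id.
have del20 : 0 < del / 2 by rewrite divr_gt0.
have f0 : 0 <= f s0 by rewrite mulr_ge0 ?sqr_ge0// off0.
have h2 (t : R) : s0 <= t <= s -> df t <= - (del / 2) * f t + K * M1 D.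
  move=> /andP[st _]; have tp := sgt0 st.
  have t2 : 0 <= t ^+ 2 by rewrite sqr_ge0.
  have := ler_wpM2l t2 (Rr_rate st).
  have -> : t ^+ 2 * (- del * Rr t + K / t ^+ 2 * q o t ^+ 2) =
      - del * f t + K * q o t ^+ 2 by rewrite /f; field; rewrite gt_eqF.
  have : K * q o t ^+ 2 <= K * M1 D.
    rewrite ler_wpM2l//; apply: le_trans (_ : Phi t <= _).
      by rewrite lerDl off0.
    apply: le_trans (Phi_bound st) _; by rewrite ler_wpM2l ?expR_ge0.
  have : 2 * t * Rr t <= del / 2 * f t.
    rewrite /f mulrA ler_wpM2r ?off0// expr2 mulrA ler_wpM2r ?(ltW tp)//.
    apply: le_trans (ler_wpM2l (ltW del20) st).
    rewrite /s0 /step0; have -> : del / 2 * (1 + 4 * gam / del + 4 / del) =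
      del / 2 + 2 * gam + 2 by field; rewrite gt_eqF.
    by have := gam0; lra.
  by rewrite /df mulr1; lra.
have KM : 0 <= K * M1 D by rewrite mulr_ge0.
apply: le_trans (damped_bound ss del20 KM h1 h2 f0) _.
rewrite lerD2r ler_wpM2l ?sqr_ge0//; apply: le_trans PD.
by rewrite /Phi lerDr sqr_ge0.
Qed.

Lemma damped_solution (D s : R) : \sum_i q i s0 ^+ 2 <= D -> s0 <= s ->
  let M := M1 D + 1 + (gam + 1) * (M2 D + 1) in
  [/\ forall i, `|q i s| <= M,
      forall i, i != o -> `|q i s| <= M / s
    & forall t, s <= t -> `|q o t - q o s| <= M / s].
Proof.
move=> qD ss M.
have PD : Phi s0 <= D by move: qD; rewrite (bigD1 o).
have D0 : 0 <= D by apply: le_trans PD; rewrite addr_ge0 ?sqr_ge0// off0.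
have M10 : 0 <= M1 D by rewrite mulr_ge0 ?expR_ge0.
have M20 : 0 <= M2 D.
  apply: addr_ge0; first by rewrite mulr_ge0 ?sqr_ge0.
  by apply: divr_ge0; [rewrite mulr_ge0|rewrite ltW// divr_gt0].
(* Using [c + 1] for the square root of [c] is the source of the [+ 1] in [M]. *)
have absle (x c : R) : 0 <= c -> x ^+ 2 <= c -> `|x| <= c + 1.
  move=> c0 xc; rewrite -(@ler_pXn2r _ 2) ?nnegrE ?addr_ge0//.
  by rewrite real_normK ?num_real//; nra.
have gM2 : 0 <= gam * (M2 D + 1) by rewrite mulr_ge0// addr_ge0.
have PhiM (t : R) : s0 <= t -> Phi t <= M1 D.
  by move=> /Phi_bound/le_trans; apply; rewrite ler_wpM2l ?expR_ge0.
have offb (t : R) i : s0 <= t -> i != o -> `|q i t| <= (M2 D + 1) / t.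
  move=> st io; have tp := sgt0 st; rewrite ler_pdivlMr// -[X in _ * X]gtr0_norm//.
  rewrite -normrM; apply: absle => //; rewrite exprMn mulrC.
  apply: le_trans (Rr_bound PD st); rewrite ler_wpM2l ?sqr_ge0//.
  exact: (off_ge (q ^~ t)).
have M0 : M1 D + 1 <= M by rewrite lerDl mulr_ge0// addr_ge0.
have MM : gam * (M2 D + 1) <= M by rewrite /M; lra.
split.
- move=> i; apply: le_trans M0; apply: absle => //.
  apply: le_trans (PhiM s ss); have [->|io] := eqVneq i o.
    by rewrite /Phi lerDl off0.
  by rewrite /Phi ler_wpDl ?sqr_ge0// (off_ge (q ^~ s)).
- move=> i io; apply: le_trans (offb _ _ ss io) _.
  by rewrite ler_pM2r ?invr_gt0 ?sgt0// /M; lra.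
- move=> t st; set c := gam * (M2 D + 1).
  have rate (u : R) : s0 <= u ->
      `|u^-1 * \sum_(b <- r) kap b * q (tau b o) u| <= c / u ^+ 2.
    move=> su; have up := sgt0 su.
    rewrite normrM gtr0_norm ?invr_gt0// expr2 invfM mulrCA.
    rewrite ler_pM2l ?invr_gt0// /c -mulrA; apply: le_trans (ler_norm_sum _ _ _) _.
    rewrite mulr_suml big_seq [leRHS]big_seq; apply: ler_sum => b br.
    by rewrite normrM ger0_norm ?kap0// ler_wpM2l ?kap0// offb// tau_o.
  have sp := sgt0 ss.
  have mono (g : R) : `|g| = 1 -> g * (q o t - q o s) <= c / s.
    move=> g1.
    (* The derivative of [c / u] is [- c / u ^+ 2], so adding it turns the bound on the derivative
       of [q o] into monotonicity; both signs of [g] are used. *)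
    pose f (u : R) := g * q o u + c * u^-1.
    have df (u : R) : 0 < u -> is_derive u 1 f (g * (u^-1 *
        \sum_(b <- r) kap b * q (tau b o) u) + c * - u ^- 2).
      move=> up; apply: is_derive_add.
        apply: is_derive_eq (is_derive_mul (is_derive_cst g u 1) (dp up)) _.
        by rewrite mulr0 addr0.
      apply: is_derive_eq (is_derive_mul (is_derive_cst c u 1) (is_derive_inv up)) _.
      by rewrite mulr0 addr0.
    suff : f t <= f s.
      have : 0 <= c / t by rewrite divr_ge0// (le_trans (ltW sp)).
      by rewrite /f; lra.
    have h1 (u : R) : s <= u <= t -> derivable f u 1.
      by move=> /andP[su _]; have [] := df u (lt_le_trans sp su).
    have h2 (u : R) (hu : s < u < t) := df u (lt_trans sp (proj1 (andP hu))).
    apply: is_derive_nincr st h1 h2 _ => u /andP[su _].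
    have su0 : s0 <= u by rewrite (le_trans ss)// ltW.
    rewrite mulrN subr_le0; apply: le_trans (rate u su0).
    by apply: le_trans (ler_norm _) _; rewrite normrM g1 mul1r.
  apply: le_trans (_ : c / s <= _); last by rewrite ler_pM2r ?invr_gt0.
  rewrite ler_norml; have := mono 1 (normr1 _).
  have := mono (-1) (normrN1 _); lra.
Qed.

End solution.

(** The order of the quantifiers matters: for the given coupling, [s0] depends on [del] only, and
    [M] on [del] and the energy bound [D] at time [s0]. Solutions attached to all directions with
    the same gap are thus controlled together. *)
Lemma damped_asymptotics (del : R) : 0 < del ->
  exists2 s0 : R, 1 <= s0 & forall D, exists2 M : R, 0 <= M &
  forall (q : I -> R -> R) (d : I -> R),
  (forall i, i != o -> del <= d i) -> d o = 0 ->
  (forall i (s : R), 0 < s -> is_derive s 1 (q i)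
     (- d i * q i s + s^-1 * \sum_(b <- r) kap b * q (tau b i) s)) ->
  \sum_i q i s0 ^+ 2 <= D ->
  forall s, s0 <= s ->
  [/\ forall i, `|q i s| <= M,
      forall i, i != o -> `|q i s| <= M / s
    & forall t, s <= t -> `|q o t - q o s| <= M / s].
Proof.
move=> del0; exists (step0 del) => [|D].
  have : 0 <= gam / del by rewrite divr_ge0// ltW.
  have : 0 <= del^-1 by rewrite invr_ge0 ltW.
  by rewrite /step0 -mulrA; lra.
pose M := expR (2 * lyap del) * D + 1 + (gam + 1) *
  (step0 del ^+ 2 * D + lyap del * (expR (2 * lyap del) * D) / (del / 2) + 1).
exists (Num.max M 0) => [|q d d_off d_o dq qD s s0s].
  by rewrite le_max lexx orbT.
have s0 : 0 < s^-1.
  rewrite invr_gt0 (lt_le_trans _ s0s)// /step0 -mulrA.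
  have : 0 <= gam / del by rewrite divr_ge0// ltW.
  have : 0 <= del^-1 by rewrite invr_ge0 ltW.
  by lra.
have [qM qMs qt] := damped_solution del0 d_off d_o dq qD s0s.
have MM : M <= Num.max M 0 by rewrite le_max lexx.
split=> [i|i io|t st].
- exact: le_trans (qM i) MM.
- by apply: le_trans (qMs i io) _; rewrite ler_pM2r.
- by apply: le_trans (qt t st) _; rewrite ler_pM2r.
Qed.

End damped_system.
(** * Reflections *)

Section dot_product.
Context {F : fieldType} {N : nat}.
Implicit Types (u v w a x : 'rV[F]_N) (c : F).

Lemma dotC u v : dot u v = dot v u.
Proof. by apply: eq_bigr => i _; rewrite mulrC. Qed.

Lemma dotDl u v w : dot (u + v) w = dot u w + dot v w.
Proof. by rewrite -big_split; apply: eq_bigr => i _; rewrite mxE mulrDl. Qed.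

Lemma dotZl c u w : dot (c *: u) w = c * dot u w.
Proof. by rewrite mulr_sumr; apply: eq_bigr => i _; rewrite mxE mulrA. Qed.

Lemma dotDr u v w : dot w (u + v) = dot w u + dot w v.
Proof. by rewrite dotC dotDl !(dotC w). Qed.

Lemma dotZr c u w : dot w (c *: u) = c * dot w u.
Proof. by rewrite dotC dotZl (dotC w). Qed.

Lemma dotNl u w : dot (- u) w = - dot u w.
Proof. by rewrite -scaleN1r dotZl mulN1r. Qed.

Lemma dotNr u w : dot w (- u) = - dot w u.
Proof. by rewrite dotC dotNl dotC. Qed.

Lemma dotBl u v w : dot (u - v) w = dot u w - dot v w.
Proof. by rewrite dotDl dotNl. Qed.

Lemma dotBr u v w : dot w (u - v) = dot w u - dot w v.
Proof. by rewrite dotDr dotNr. Qed.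

Lemma dot0l w : dot 0 w = 0.
Proof. by rewrite -(scale0r 0) dotZl mul0r. Qed.

Lemma dot0r w : dot w 0 = 0.
Proof. by rewrite dotC dot0l. Qed.

Lemma reflectionD a u v : reflection a (u + v) = reflection a u + reflection a v.
Proof.
by rewrite /reflection dotDr mulrDr mulrDl scalerDl opprD addrACA.
Qed.

Lemma reflectionZ a c u : reflection a (c *: u) = c *: reflection a u.
Proof.
by rewrite /reflection dotZr scalerBr scalerA; congr (_ - _ *: _); ring.
Qed.

Lemma reflection_id a u : dot a u = 0 -> reflection a u = u.
Proof. by move=> au; rewrite /reflection au mulr0 mul0r scale0r subr0. Qed.

Lemma reflection_self a : dot a a != 0 -> reflection a a = - a.
Proof.
move=> aa; rewrite /reflection mulfK// -[X in X - _]scale1r -scalerBl.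
by rewrite (_ : 1 - 2 = -1) ?scaleN1r//; ring.
Qed.

Lemma dot_reflection a u v : dot a a != 0 ->
  dot (reflection a u) (reflection a v) = dot u v.
Proof.
move=> aa; rewrite /reflection !(dotBl, dotBr, dotZl, dotZr) (dotC u a).
by field.
Qed.

Lemma reflectionK a : dot a a != 0 -> involutive (reflection a).
Proof.
move=> aa u; rewrite {2}/reflection -scaleN1r reflectionD !reflectionZ.
rewrite (reflection_self aa) /reflection !scalerN scaleN1r opprK -!addrA.
by rewrite addNr addr0.
Qed.

Lemma dot_reflectionC a u v : dot a a != 0 ->
  dot (reflection a u) v = dot u (reflection a v).
Proof. by move=> aa; rewrite -(dot_reflection _ _ aa) reflectionK. Qed.

Lemma reflectionN a u : reflection (- a) u = reflection a u.
Proof.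
rewrite /reflection !dotNl dotNr opprK scalerN -scaleNr.
by congr (_ - _ *: _); rewrite mulrN mulNr opprK.
Qed.

Lemma reflection_conj b a u : dot b b != 0 ->
  reflection (reflection b a) (reflection b u) = reflection b (reflection a u).
Proof.
move=> bb; rewrite [LHS]/reflection !dot_reflection//.
by rewrite -scaleNr -reflectionZ -reflectionD scaleNr.
Qed.

End dot_product.

Section euclidean.
Context {R : realType} {N : nat}.
Implicit Types (u v a x : 'rV[R]_N) (e : R).

Lemma sqnorm_ge0 u : 0 <= sqnorm u.
Proof. by apply: sumr_ge0 => i _; rewrite -expr2 sqr_ge0. Qed.

Lemma sqnorm_eq0 u : (sqnorm u == 0) = (u == 0).
Proof.
rewrite /sqnorm /dot psumr_eq0 => [|i _]; last by rewrite -expr2 sqr_ge0.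
apply/allP/eqP => [u0|-> i _]; last by rewrite !mxE mulr0 eqxx implybT.
apply/rowP => i; rewrite mxE; apply/eqP.
by have := u0 i; rewrite mem_index_enum -expr2 expf_eq0 => /(_ isT).
Qed.

Lemma sqnormD u v : sqnorm (u + v) = sqnorm u + 2 * dot u v + sqnorm v.
Proof. by rewrite /sqnorm dotDl !dotDr (dotC v u); ring. Qed.

Lemma sqnormB u v : sqnorm (u - v) = sqnorm u - 2 * dot u v + sqnorm v.
Proof. by rewrite sqnormD dotNr /sqnorm dotNl dotNr; ring. Qed.

Lemma sqnormZ e u : sqnorm (e *: u) = e ^+ 2 * sqnorm u.
Proof. by rewrite /sqnorm dotZl dotZr; ring. Qed.

Lemma dot_young e u v : 0 < e ->
  2 * dot u v <= e * sqnorm u + sqnorm v / e.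
Proof.
move=> e0; have := sqnorm_ge0 (e *: u - v).
rewrite sqnormB sqnormZ dotZl => h.
rewrite -(ler_pM2l e0) mulrDr mulrCA.
rewrite [X in _ <= _ + X](_ : _ = sqnorm v); last by field; rewrite gt_eqF.
lra.
Qed.

Lemma sqnormD_le u v : sqnorm (u + v) <= 2 * sqnorm u + 2 * sqnorm v.
Proof.
have := dot_young u v ltr01; rewrite mul1r divr1 sqnormD; lra.
Qed.

Lemma complexifyD u v : complexify (u + v) = complexify u + complexify v.
Proof. exact: map_mxD. Qed.

Lemma complexifyZ e u : complexify (e *: u) = real_complex R e *: complexify u.
Proof. exact: map_mxZ. Qed.

Lemma complexifyN u : complexify (- u) = - complexify u.
Proof. exact: map_mxN. Qed.

Lemma dot_complexify u v :
  dot (complexify u) (complexify v) = real_complex R (dot u v).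
Proof.
by rewrite /dot rmorph_sum; apply: eq_bigr => i _; rewrite !mxE rmorphM.
Qed.

Lemma complexify_reflection a u :
  complexify (reflection a u) = reflection (complexify a) (complexify u).
Proof.
rewrite /reflection -[in LHS]scaleNr complexifyD complexifyZ rmorphN scaleNr.
by rewrite !dot_complexify fmorph_div rmorphM rmorph_nat.
Qed.

Lemma complexify0 : complexify (0 : 'rV[R]_N) = 0.
Proof. exact: map_mx0. Qed.

End euclidean.
(** * Symmetries of the Dunkl kernel *)

Section roots.
Context {R : realType} {N : nat}.
Local Notation V := 'rV[R]_N.
Variables (Rt Rp : {fset V}) (k : V -> R).
Hypothesis rootR : root_system Rt.
Hypothesis posR : positive_subsystem Rt Rp.
Hypothesis multR : multiplicity_function Rt k.

Lemma posroot_root a : a \in Rp -> a \in Rt.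
Proof. by have [b [_ ->]] := posR; rewrite !inE => /andP[]. Qed.

Lemma root_dot_neq0 a : a \in Rt -> dot a a != 0.
Proof.
move=> aR; rewrite -/(sqnorm a) sqnorm_eq0; apply: contraTneq aR => ->.
exact: root_neq0 rootR.
Qed.

Lemma root_reflection a b : a \in Rt -> b \in Rt -> reflection a b \in Rt.
Proof. by move=> aR bR; rewrite -(root_stable rootR aR) in_imfset. Qed.

Lemma root_opp a : a \in Rt -> - a \in Rt.
Proof.
by move=> aR; rewrite -reflection_self ?root_dot_neq0// root_reflection.
Qed.

Lemma mult_reflection a b : a \in Rt -> b \in Rt -> k (reflection a b) = k b.
Proof.
move=> aR bR; have [_ /(_ (reflection a \o id) b) kw] := multR.
by apply: kw => //; apply: weyl_mul => //; exact: weyl_id.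
Qed.

Lemma multN a : a \in Rt -> k (- a) = k a.
Proof.
by move=> aR; rewrite -reflection_self ?root_dot_neq0// mult_reflection.
Qed.

Lemma mult_ge0 a : a \in Rp -> 0 <= k a.
Proof. by move=> /posroot_root aR; have [+ _] := multR; exact. Qed.

(** Opposite roots pair off, one of each pair being positive. [Rp] is in general not stable under
    reflections, so invariance of the sum of an even function is checked on [Rt] and brought back by
    this identity. *)
Lemma sum_posroots (M : numFieldType) (G : V -> M) :
  (forall a, a \in Rt -> G (- a) = G a) ->
  \sum_(a <- Rt) G a = 2 * \sum_(a <- Rp) G a.
Proof.
move=> Geven; have [b [b_neq0 RpE]] := posR.
have E1 : \sum_(a <- Rp) G a = \sum_(a <- Rt | 0 < dot a b) G a.
  rewrite -[RHS]big_filter; apply: perm_big; apply: uniq_perm.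
  - exact: fset_uniq.
  - by rewrite filter_uniq// fset_uniq.
  - by move=> a; rewrite mem_filter RpE !inE andbC.
have E2 : \sum_(a <- Rt) G a = \sum_(a <- Rt) G (- a).
  by rewrite !big_seq; apply: eq_bigr => a aR; rewrite Geven.
rewrite E1 (bigID (fun a => 0 < dot a b))/= mulrDl mul1r; congr (_ + _).
rewrite -[LHS]big_filter -[RHS]big_filter.
rewrite (perm_big [seq - a | a <- Rt & 0 < dot a b]); last first.
  apply: uniq_perm.
  - by rewrite filter_uniq// fset_uniq.
  - by rewrite map_inj_uniq ?filter_uniq ?fset_uniq//; exact: oppr_inj.
  - move=> a; rewrite mem_filter; apply/andP/mapP => [[ab aR]|[c + ->]].
      exists (- a); rewrite ?opprK// mem_filter dotNl root_opp// andbT.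
      by rewrite oppr_gt0 lt_neqAle b_neq0//= leNgt.
    rewrite mem_filter dotNl => /andP[cb cR]; split; last exact: root_opp.
    by rewrite -leNgt oppr_le0 ltW.
rewrite big_map big_seq [RHS]big_seq; apply: eq_bigr => a.
by rewrite mem_filter => /andP[_ aR]; rewrite Geven.
Qed.

Lemma sum_posroots_reflection (M : numFieldType) (G : V -> M) b : b \in Rt ->
  (forall a, a \in Rt -> G (- a) = G a) ->
  \sum_(a <- Rp) G (reflection b a) = \sum_(a <- Rp) G a.
Proof.
move=> bR Geven; apply: (@mulfI _ 2); first by rewrite pnatr_eq0.
rewrite -!sum_posroots// => [|a aR]; last first.
  by rewrite -scaleN1r reflectionZ scaleN1r Geven// root_reflection.
rewrite -(big_map (reflection b) predT); apply: perm_big; apply: uniq_perm.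
- rewrite map_inj_uniq ?fset_uniq//; apply: inv_inj.
  exact: reflectionK (root_dot_neq0 bR).
- exact: fset_uniq.
- move=> a; apply/mapP/idP => [[c cR ->]|aR]; first exact: root_reflection.
  exists (reflection b a); first exact: root_reflection.
  by rewrite reflectionK// root_dot_neq0.
Qed.

End roots.

Section kernel_symmetries.
Context {R : realType} {N : nat}.
Local Notation V := 'rV[R]_N.
Local Notation C := R[i].
Local Notation VC := 'rV[C]_N.
Variables (Rt Rp : {fset V}) (k : V -> R) (E : VC -> VC -> C^o).
Hypothesis rootR : root_system Rt.
Hypothesis posR : positive_subsystem Rt Rp.
Hypothesis multR : multiplicity_function Rt k.
Hypothesis kerE : is_dunkl_kernel Rp k E.

Lemma kernel_eigen w : dunkl_eigenfunction Rp k w (E ^~ w).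
Proof. by apply/(kerE w (E ^~ w)). Qed.

Lemma complex_root_neq0 a : a \in Rt ->
  dot (complexify a) (complexify a) != 0 :> C.
Proof.
move=> aR; rewrite dot_complexify.
by rewrite (inj_eq (@complexI _) _ 0) (root_dot_neq0 rootR).
Qed.

Lemma differentiable_reflection (a : VC) :
  forall z, differentiable (fun u : VC => reflection a u : VC) z.
Proof.
move=> z.
pose c : VC -> C^o :=
  \sum_(i < N) ((2 / dot a a * a 0 i) *: (fun z : VC => z 0 i : C^o)).
have cE u : c u = 2 * dot a u / dot a a.
  rewrite /c fct_sumE mulrAC mulr_sumr; apply: eq_bigr => i _.
  by rewrite /= mulrA.
rewrite (_ : (fun u => reflection a u) = id \- (fun z => c z *: a)); last first.
  by apply/funext => u; rewrite /= cE.
apply: differentiableB; first exact: ex_diff.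
apply: differentiableZl; apply: differentiable_sum => i.
by apply: differentiableZ; exact: differentiable_coord.
Qed.

Lemma derive_reflection (a xi z : VC) (f : VC -> C^o) :
  'D_xi (f \o reflection a) z = 'D_(reflection a xi) f (reflection a z).
Proof.
by rewrite /derive; under eq_fun do rewrite /= reflectionD reflectionZ.
Qed.

Lemma dunkl_quotient_reflection (a b : V) f (z : VC) : b \in Rt ->
  dunkl_quotient a (f \o reflection (complexify b)) z =
  dunkl_quotient (reflection b a) f (reflection (complexify b) z).
Proof.
move=> bR; have bb := complex_root_neq0 bR.
rewrite /dunkl_quotient complexify_reflection.
rewrite (dot_reflection _ z bb) (dot_reflection _ (complexify a) bb).
by rewrite derive_reflection /= (reflection_conj _ _ bb).
Qed.

(** The factor [dot (complexify a) xi] is odd in the root as well, so the summand of the Dunkl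
    operator is even. *)
Lemma dunkl_quotientN (a : V) f : (forall z, differentiable f z) ->
  forall z : VC,
  dunkl_quotient (- a) f z = - dunkl_quotient a f z.
Proof.
move=> df z; rewrite /dunkl_quotient.
rewrite complexifyN !dotNl dotNr opprK oppr_eq0 reflectionN; case: ifP => _.
  by rewrite deriveE// linearN -deriveE// mulrN.
by rewrite invrN mulrN.
Qed.

(** Dunkl operators are equivariant, [T_xi (f o sigma) = (T_(sigma xi) f) o sigma]. Hence
    [z => E (sigma z) w] is a normalised eigenfunction with spectral parameter [sigma w], and
    uniqueness identifies it. *)
Lemma kernel_reflection b z w : b \in Rt ->
  E (reflection (complexify b) z) w = E z (reflection (complexify b) w).
Proof.
move=> bR; have bb := complex_root_neq0 bR; have [df Ef f0] := kernel_eigen w.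
set S := reflection (complexify b).
suff : dunkl_eigenfunction Rp k (S w) ((E ^~ w) \o S).
  by move/(kerE _ _) => /(congr1 (fun h => h z)).
split=> [u|xi u|]; last first.
- by rewrite /= /S reflection_id ?dot0r.
- rewrite /= -dot_reflectionC// -Ef /dunkl_operator derive_reflection.
  congr (_ + _).
  pose G a := real_complex R (k a) * dot (complexify a) (S xi) *
    dunkl_quotient a (E ^~ w) (S u).
  rewrite -[RHS](sum_posroots_reflection rootR posR (G := G) bR) => [|a aR].
    rewrite big_seq [RHS]big_seq; apply: eq_bigr => a /(posroot_root posR) aR.
    rewrite /G (mult_reflection multR)// complexify_reflection.
    rewrite (dot_reflection (complexify a) xi bb).
    by rewrite (dunkl_quotient_reflection a _ u bR).
  rewrite /G (multN rootR multR aR) (dunkl_quotientN a df) complexifyN.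
  by rewrite dotNl mulrN mulrN mulNr opprK.
- by apply: differentiable_comp; [exact: differentiable_reflection|exact: df].
Qed.

(** Dunkl operators are homogeneous of degree -1, so dilating the argument by [c] multiplies the
    spectral parameter by [c]; uniqueness concludes. *)
Lemma kernel_scale (c : C) z w : c != 0 -> E (c *: z) w = E z (c *: w).
Proof.
move=> c0; have [df Ef f0] := kernel_eigen w.
pose f : VC -> C^o := E ^~ w.
suff : dunkl_eigenfunction Rp k (c *: w) (fun u => f (c *: u)).
  by move/(kerE _ _) => /(congr1 (fun h => h z)).
have Df xi u : 'D_xi (fun u => f (c *: u)) u = c * 'D_xi f (c *: u).
  transitivity ('D_(c *: xi) f (c *: u)).
    rewrite /derive; set g := (X in _ = lim (X @ _)).
    rewrite (_ : (fun h : C => _) = g)//; apply/funext => h.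
    by rewrite /g /= [c *: (_ + _)]scalerDr [c *: (h *: xi)]scalerA mulrC -scalerA.
  by rewrite !deriveE ?linearZ//; exact: df.
split=> [u|xi u|]; last by rewrite scaler0.
- apply: (@differentiable_comp _ _ _ _ ( *:%R c) f); last exact: df.
  exact: ex_diff.
- rewrite /dunkl_operator Df dotZr -mulrA -[in RHS]Ef /dunkl_operator mulrDr.
  congr (_ + _); rewrite mulr_sumr; apply: eq_bigr => a _.
  rewrite mulrCA; congr (_ * _); rewrite /dunkl_quotient Df.
  rewrite dotZr mulf_eq0 (negbTE c0)/= -/f; case: ifPn => az; first by ring.
  by rewrite reflectionZ invfM mulrCA (mulVKf c0).
Qed.

Lemma kernel0 w : E 0 w = 1.
Proof. by have [_ _] := kernel_eigen w. Qed.

End kernel_symmetries.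
(** * The radial system of the Dunkl kernel *)

Section real_restriction.
Context {R : realType} {N : nat}.
Local Notation C := R[i].
Local Notation VC := 'rV[C]_N.

Lemma cvg_Re (T : Type) (F : set_system T) (FF : Filter F) (f : T -> C^o)
    (l : C^o) :
  f x @[x --> F] --> l -> complex.Re (f x) @[x --> F] --> complex.Re l.
Proof.
move=> /cvgrPdist_lt fl; apply/cvgrPdist_lt => e e0.
have e0' : 0 < real_complex R e by rewrite ltcR.
near=> x; rewrite -ltcR; apply: le_lt_trans (_ : `|l - f x| < _).
  by rewrite -raddfB normc_ge_Re.
by near: x; exact: fl.
Unshelve. all: by end_near. Qed.

Lemma cvg_real_complex_dnbhs :
  real_complex R h @[h --> (0 : R)^'] --> (0 : C^o)^'.
Proof.
move=> A [[e ei] /= + eA]; rewrite ltcE/= => /andP[/eqP ei0 e0].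
exists e => //= h /= + h0; rewrite sub0r normrN => he.
apply: eA => /=; last by rewrite (inj_eq (@complexI _) _ 0).
rewrite sub0r normrN ei0 normc_def /= expr0n /= addr0 sqrtr_sqr.
by rewrite -[ltRHS]/(real_complex R e) ltcR.
Qed.

Lemma Re_realM (c : R) (z : C) : complex.Re (real_complex R c * z) = c * complex.Re z.
Proof. by case: z => a b /=; rewrite mul0r subr0. Qed.

Lemma Re_sum (I : Type) (r : seq I) (F : I -> C) :
  complex.Re (\sum_(i <- r) F i) = \sum_(i <- r) complex.Re (F i).
Proof. exact: raddf_sum. Qed.

(** The complex difference quotients converge over all complex increments; they are restricted to
    real ones, for which division commutes with the real part. *)
Lemma is_derive_Re (f : VC -> C^o) (eta : 'rV[R]_N) (s : R) :
  (forall z, differentiable f z) ->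
  is_derive s 1 (fun s => complex.Re (f (complexify (s *: eta))))
    (complex.Re ('D_(complexify eta) f (complexify (s *: eta)))).
Proof.
move=> df; set z := complexify (s *: eta); set D := 'D__ _ _.
have fz : derivable f z (complexify eta) by exact: diff_derivable.
have := cvg_Re _ (cvg_comp _ _ cvg_real_complex_dnbhs fz).
pose F (s : R) := complex.Re (f (complexify (s *: eta))).
set G := (X in X @ _ --> _).
have -> : G = (fun h : R => h^-1 *: ((F \o shift s) (h *: 1) - F s)).
  apply/funext => h; rewrite /G /F /= -fmorphV Re_realM raddfB.
  congr (_ * (complex.Re (f _) - _)).
  by rewrite /z -complexifyZ -complexifyD -scalerDl /GRing.scale /= mulr1.
rewrite -/F => hF; pose l : R := complex.Re D.
have hl : h^-1 *: ((F \o shift s) (h *: 1) - F s) @[h --> (0:R)^'] --> l by exact: hF.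
apply: DeriveDef; first exact: (cvgP l hl).
exact: (cvg_lim _ hl).
Qed.

End real_restriction.
Section real_kernel.
Context {R : realType} {N : nat}.
Local Notation V := 'rV[R]_N.
Local Notation C := R[i].
Local Notation VC := 'rV[C]_N.
Variables (Rt Rp : {fset V}) (k : V -> R) (E : VC -> VC -> C^o).
Hypothesis rootR : root_system Rt.
Hypothesis posR : positive_subsystem Rt Rp.
Hypothesis multR : multiplicity_function Rt k.
Hypothesis kerE : is_dunkl_kernel Rp k E.
Local Notation rk := (real_kernel E).

Lemma real_kernel_reflection b x y : b \in Rt ->
  rk (reflection b x) y = rk x (reflection b y).
Proof.
move=> bR; rewrite /real_kernel !complexify_reflection.
by rewrite (kernel_reflection rootR posR multR kerE).
Qed.

Lemma real_kernel_scale (c : R) x y : c != 0 -> rk (c *: x) y = rk x (c *: y).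
Proof.
move=> c0; rewrite /real_kernel !complexifyZ (kernel_scale kerE)//.
by rewrite (inj_eq (@complexI _) _ 0).
Qed.

Lemma real_kernel0 y : rk 0 y = 1.
Proof. by rewrite /real_kernel complexify0 (kernel0 kerE). Qed.

Lemma derivable_real_kernel (eta y : V) (s : R) :
  derivable (fun s : R => rk (s *: eta) y) s 1.
Proof.
have [df _ _] := kernel_eigen kerE (complexify y).
by have [] := is_derive_Re eta s df.
Qed.

(* On a radial line the reflection terms lose their poles: the factor
   [<a, eta> / <a, s eta>] is [1 / s]. *)
Lemma is_derive_real_kernel (eta y : V) (s : R) : 0 < s ->
  is_derive s 1 (fun s : R => rk (s *: eta) y)
    (dot eta y * rk (s *: eta) y - s^-1 *
      \sum_(a <- Rp) k a * (rk (s *: eta) y - rk (s *: eta) (reflection a y))).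
Proof.
move=> s0; have [df Ef _] := kernel_eigen kerE (complexify y).
apply: is_derive_eq (is_derive_Re eta s df) _.
set z := complexify (s *: eta).
have := Ef (complexify eta) z; rewrite /dunkl_operator => /(canRL (addrK _)) ->.
rewrite raddfB dot_complexify /= Re_realM; congr (_ - _).
rewrite Re_sum mulr_sumr big_seq [RHS]big_seq; apply: eq_bigr => a aRp.
have aR := posroot_root posR aRp.
rewrite dot_complexify -mulrA Re_realM mulrCA; congr (_ * _).
rewrite Re_realM /dunkl_quotient /z dot_complexify dotZr.
rewrite -(real_kernel_reflection _ _ aR) reflectionZ.
(* If the ray lies in the mirror of [a], both sides vanish: one by the factor [dot a eta], the other
   because the reflection fixes the ray. *)
have [ae0|ae0] := eqVneq (dot a eta) 0.
  by rewrite ae0 mul0r reflection_id// subrr mulr0.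
rewrite (inj_eq (@complexI _) _ 0) mulf_eq0 (negbTE ae0) gt_eqF//=.
rewrite -complexify_reflection reflectionZ -fmorphV [X in complex.Re X]mulrC.
rewrite Re_realM raddfB /= mulrA; congr (_ * _).
by field; rewrite ae0 gt_eqF.
Qed.

End real_kernel.

(** * Families of spectral parameters permuted by the reflections *)

Lemma cvg_rsum (R : realType) (T I : Type) (F : set_system T) (FF : Filter F)
    (r : seq I) (f : I -> T -> R) (l : I -> R) :
  (forall i, f i x @[x --> F] --> l i) ->
  \sum_(i <- r) f i x @[x --> F] --> \sum_(i <- r) l i.
Proof.
move=> fl; by apply: (@cvg_big _ _ _ _ xpredT _ _ F r f l) => //; exact: add_continuous.
Qed.

Lemma cvg_dot (R : realType) (N : nat) (T : Type) (F : set_system T)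
    (FF : Filter F) (f g : T -> 'rV[R]_N) (a b : 'rV[R]_N) :
  f x @[x --> F] --> a -> g x @[x --> F] --> b ->
  dot (f x) (g x) @[x --> F] --> dot a b.
Proof.
move=> fa gb; apply: cvg_rsum => i.
apply: cvgM.
- exact: (cvg_comp f (fun v : 'rV[R]_N => v 0 i) fa (@coord_continuous _ _ _ 0 i a)).
- exact: (cvg_comp g (fun v : 'rV[R]_N => v 0 i) gb (@coord_continuous _ _ _ 0 i b)).
Qed.

(** Cauchy-Schwarz, from the nonnegativity of [sqnorm (sqnorm u *: v - dot u v *: u)]; the squared
    form avoids square roots. *)
Lemma dot_sqr_le (R : realType) (N : nat) (u v : 'rV[R]_N) :
  dot u v ^+ 2 <= sqnorm u * sqnorm v.
Proof.
have [->|u0] := eqVneq u 0.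
  by rewrite /sqnorm !dot0l expr0n /= mul0r.
have up : 0 < sqnorm u by rewrite lt_neqAle eq_sym sqnorm_eq0 u0 sqnorm_ge0.
rewrite -subr_ge0 -(pmulr_rge0 _ up).
have := sqnorm_ge0 (sqnorm u *: v - dot u v *: u).
rewrite sqnormB !sqnormZ dotZl dotZr (dotC v u).
by congr (0 <= _); ring.
Qed.

Section families.
Context {R : realType} {N : nat}.
Local Notation V := 'rV[R]_N.
Local Notation C := R[i].
Local Notation VC := 'rV[C]_N.
Variables (Rt Rp : {fset V}) (k : V -> R) (E : VC -> VC -> C^o).
Hypothesis rootR : root_system Rt.
Hypothesis posR : positive_subsystem Rt Rp.
Hypothesis multR : multiplicity_function Rt k.
Hypothesis kerE : is_dunkl_kernel Rp k E.
Local Notation rk := (real_kernel E).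
Variables (I : finType) (tau : V -> I -> I).
Hypothesis tau_inj : forall b, b \in Rp -> injective (tau b).

(** Parameters are indexed rather than collected in a set, so that families over the same index can
    be subtracted even when their points have different stabilisers. *)
Definition reflection_family (m : I -> V) :=
  forall b i, b \in Rp -> m (tau b i) = reflection b (m i).

Let dfam m eta i (s : R) : reflection_family m -> 0 < s ->
  is_derive s 1 (fun s : R => rk (s *: eta) (m i))
    (dot eta (m i) * rk (s *: eta) (m i) - s^-1 *
      \sum_(a <- Rp) k a * (rk (s *: eta) (m i) - rk (s *: eta) (m (tau a i)))).
Proof.
move=> mF s0.
apply: is_derive_eq (is_derive_real_kernel rootR posR multR kerE _ _ s0) _.
congr (_ - _ * _); rewrite big_seq [RHS]big_seq.
by apply: eq_bigr => a aR; rewrite mF.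
Qed.

(** The kernel is 1 at the origin, so the initial energy is the number of indices; the energy
    estimate is read at time 1 of the ray through [eta]. *)
Lemma family_bound (m : I -> V) (eta : V) (c : R) : reflection_family m ->
  (forall i, dot eta (m i) <= c) ->
  \sum_i rk eta (m i) ^+ 2 <= #|I|%:R * expR (2 * c).
Proof.
move=> mF mc.
have := @radial_energy _ _ _ Rp k tau (mult_ge0 posR multR) tau_inj
  (fun i s => rk (s *: eta) (m i)) (fun i => dot eta (m i)) c 1 ler01
  (fun i s => @derivable_real_kernel _ _ _ _ _ kerE eta (m i) s)
  (fun i s => @dfam m eta i s mF) mc.
rewrite scale1r scale0r mulr1 mulrC.
under [X in _ <= X * _ -> _]eq_bigr do rewrite (real_kernel0 kerE) expr1n.
by rewrite sumr_const.
Qed.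

(** Subtracting the two systems leaves the system of [m], driven by [dot eta (m i - m' i)] times the
    kernel at [m' i], with zero initial values. *)
Lemma family_diff (m m' : I -> V) (eta : V) (c K : R) :
  reflection_family m -> reflection_family m' -> 0 <= c -> 0 <= K ->
  (forall i, dot eta (m i) <= c) ->
  (forall s : R, 0 < s < 1 ->
    \sum_i (dot eta (m i - m' i) * rk (s *: eta) (m' i)) ^+ 2 <= K) ->
  \sum_i (rk eta (m i) - rk eta (m' i)) ^+ 2 <= expR (2 * c + 1) * K.
Proof.
move=> mF m'F c0 K0 mc m'K.
pose u i (s : R) := rk (s *: eta) (m i) - rk (s *: eta) (m' i).
have u1 i (s : R) : derivable (u i) s 1.
  by apply: derivableB; exact: (derivable_real_kernel kerE).
have du i (s : R) : 0 < s -> is_derive s 1 (u i) (dot eta (m i) * u i s +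
    dot eta (m i - m' i) * rk (s *: eta) (m' i) - s^-1 *
      \sum_(a <- Rp) k a * (u i s - u (tau a i) s)).
  move=> s0; apply: is_derive_eq
    (is_deriveB (dfam eta i mF s0) (dfam eta i m'F s0)) _.
  rewrite (_ : \sum_(a <- Rp) k a * (u i s - _) =
      \sum_(a <- Rp) k a * (rk (s *: eta) (m i) - rk (s *: eta) (m (tau a i)))
    - \sum_(a <- Rp) k a * (rk (s *: eta) (m' i) - rk (s *: eta) (m' (tau a i)))).
    by rewrite /u dotBr; ring.
  by rewrite -sumrB; apply: eq_bigr => a _; rewrite /u; ring.
have := @radial_energy_forced _ _ _ Rp k tau (mult_ge0 posR multR) tau_inj
  u (fun i => dot eta (m i))
  (fun i s => dot eta (m i - m' i) * rk (s *: eta) (m' i)) c K c0 K0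
  u1 du mc m'K.
rewrite /u; under eq_bigr do rewrite !scale1r; apply => i.
by rewrite scale0r !(real_kernel0 kerE) subrr.
Qed.

End families.

(** * The Weyl group as a finite index set *)

Section weyl_orbits.
Context {R : realType} {N : nat}.
Local Notation V := 'rV[R]_N.
Variables (Rt Rp : {fset V}) (k : V -> R).
Hypothesis rootR : root_system Rt.
Hypothesis posR : positive_subsystem Rt Rp.

Lemma weyl_isometry w x y : weyl_group Rt w -> dot (w x) (w y) = dot x y.
Proof.
by elim=> // a v aR _ IH; rewrite /= dot_reflection// (root_dot_neq0 rootR).
Qed.

Lemma weylB w x y : weyl_group Rt w -> w (x - y) = w x - w y.
Proof.
elim=> // a v aR _ /= ->.
by rewrite -(scaleN1r (v y)) reflectionD reflectionZ scaleN1r.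
Qed.

Lemma weyl_regular lam w : regular Rt lam -> weyl_group Rt w ->
  regular Rt (w lam).
Proof.
move=> reg; elim=> // a v aR _ IH b bR /=.
rewrite -dot_reflectionC ?(root_dot_neq0 rootR)//.
by apply: IH; exact: (root_reflection rootR).
Qed.

(** Left multiplication by a reflection permutes the group, so [i => e i y] is a reflection family
    for every [y], including points with nontrivial stabiliser. *)
Lemma weyl_enum : exists (n : nat) (e : 'I_n -> V -> V) (tau : V -> 'I_n -> 'I_n),
  [/\ forall i, weyl_group Rt (e i),
      exists i, e i = id,
      forall a i, a \in Rp -> e (tau a i) = reflection a \o e i
    & forall a, a \in Rp -> injective (tau a)].
Proof.
have [s sE] : exists s : seq (V -> V), weyl_group Rt = [set` s].
  by apply/finite_seqP; exact: weyl_finite rootR.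
pose s' := undup s.
have s'E w : weyl_group Rt w <-> w \in s' by rewrite mem_undup sE.
pose e (i : 'I_(size s')) := nth id s' i.
have eW i : weyl_group Rt (e i) by apply/s'E; exact: mem_nth.
have surj w : weyl_group Rt w -> exists i, e i = w.
  move=> /s'E ws; have := ws; rewrite -index_mem => iw.
  by exists (Ordinal iw); rewrite /e /= nth_index.
have inj : injective e.
  move=> i j /eqP; rewrite nth_uniq ?undup_uniq// => /eqP; exact: val_inj.
have step (a : V) i : exists j, a \in Rp -> e j = reflection a \o e i.
  have [aR|_] := boolP (a \in Rp); last by exists i.
  have [|j <-] := surj (reflection a \o e i); last by exists j.
  by apply: weyl_mul => //; exact: posroot_root posR _ aR.
have /choice[tau0 tauE] : forall p : V * 'I_(size s'),
    exists j, p.1 \in Rp -> e j = reflection p.1 \o e p.2.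
  by move=> p; exact: step.
exists (size s'), e, (fun a i => tau0 (a, i)); split=> //.
- by have [i <-] := surj _ (weyl_id Rt); exists i.
- by move=> a i; exact: (tauE (a, i)).
- move=> a aR i j tij; apply: inj; apply/funext => x.
  have aa : dot a a != 0 by rewrite (root_dot_neq0 rootR)// (posroot_root posR).
  have := congr1 (fun i => e i x) tij.
  rewrite (tauE (a, i) aR) (tauE (a, j) aR) /=.
  exact: (can_inj (reflectionK aa)).
Qed.

End weyl_orbits.

(** * Growth of the kernel and continuity in the second argument *)

Section kernel_estimates.
Context {R : realType} {N : nat}.
Local Notation V := 'rV[R]_N.
Local Notation C := R[i].
Local Notation VC := 'rV[C]_N.
Variables (Rt Rp : {fset V}) (k : V -> R) (E : VC -> VC -> C^o).
Hypothesis rootR : root_system Rt.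
Hypothesis posR : positive_subsystem Rt Rp.
Hypothesis multR : multiplicity_function Rt k.
Hypothesis kerE : is_dunkl_kernel Rp k E.
Local Notation rk := (real_kernel E).

(** Weyl elements are isometries, so Young's inequality bounds every [dot (w y) x] alike. The weight
    [e] stays free, so that growth in one argument can be made a small fraction of the Gaussian
    exponent. *)
Lemma real_kernel_growth : exists n : nat, forall (x y : V) (e : R), 0 < e ->
  rk x y ^+ 2 <= n%:R * expR (e * sqnorm y + sqnorm x / e).
Proof.
have [n [e [tau [eW [i0 e0] etau tau_inj]]]] := weyl_enum rootR posR.
exists n => x y c c0.
have yF : reflection_family Rp tau (fun i => e i y).
  by move=> a i aR; rewrite etau.
have := @family_bound _ _ _ _ _ _ rootR posR multR kerE _ _ tau_inj
  _ x ((c * sqnorm y + sqnorm x / c) / 2) yF.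
rewrite [2 * _]mulrC divfK// card_ord => h; apply: le_trans (h _) => [|i].
  rewrite (bigD1 i0)//= e0 lerDl sumr_ge0// => j _; exact: sqr_ge0.
rewrite ler_pdivlMr// mulrC; rewrite dotC.
by have := dot_young (e i y) x c0; rewrite {1}/sqnorm (weyl_isometry rootR y y (eW i)).
Qed.

(** Holomorphy is part of the definition for the first argument only. In the second, the families
    [w y] and [w lam] are compared: each [w] being a linear isometry, the forcing is at most a
    constant times [sqnorm x * sqnorm (y - lam)]. *)
Lemma cvg_real_kernelr (x lam : V) (T : Type) (F : set_system T)
    (FF : Filter F) (f : T -> V) :
  f t @[t --> F] --> lam -> rk x (f t) @[t --> F] --> rk x lam.
Proof.
move=> flam.
have [n [e [tau [eW [i0 e0] etau tau_inj]]]] := weyl_enum rootR posR.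
have [n' growth] := real_kernel_growth.
have eF y : reflection_family Rp tau (fun i => e i y).
  by move=> a i aR; rewrite etau.
pose B := n'%:R * expR (sqnorm lam + sqnorm x).
pose bnd y := expR (sqnorm y + sqnorm x + 1) *
  (n%:R * (sqnorm x * sqnorm (y - lam) * B)).
have le_bnd y : (rk x y - rk x lam) ^+ 2 <= bnd y.
  have sum_le := @family_diff _ _ _ _ _ _ rootR posR multR kerE _ _ tau_inj
    _ _ x ((sqnorm y + sqnorm x) / 2) (n%:R * (sqnorm x * sqnorm (y - lam) * B))
    (eF y) (eF lam).
  have B0 : 0 <= B by rewrite mulr_ge0 ?expR_ge0.
  rewrite [2 * _]mulrC divfK// in sum_le.
  apply: le_trans (sum_le _ _ _ _).
  - rewrite (bigD1 i0)//= e0 lerDl sumr_ge0// => j _; exact: sqr_ge0.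
  - by rewrite divr_ge0// addr_ge0// sqnorm_ge0.
  - by rewrite !mulr_ge0// sqnorm_ge0.
  - move=> i; rewrite ler_pdivlMr// mulrC dotC.
    have := dot_young (e i y) x ltr01.
    by rewrite mul1r divr1 {1}/sqnorm (weyl_isometry rootR).
  - move=> s /andP[s0 s1].
    have -> : n%:R * (sqnorm x * sqnorm (y - lam) * B) =
        \sum_(i < n) sqnorm x * sqnorm (y - lam) * B.
      by rewrite sumr_const card_ord mulr_natl.
    apply: ler_sum => i _; rewrite exprMn; apply: ler_pM; rewrite ?sqr_ge0//.
      apply: le_trans (dot_sqr_le _ _) _; rewrite -(weylB _ _ (eW i)).
      by rewrite {2}/sqnorm (weyl_isometry rootR _ _ (eW i)).
    apply: le_trans (growth _ _ _ ltr01) _.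
    rewrite mul1r divr1 ler_wpM2l// ler_expR sqnormZ.
    rewrite {1}/sqnorm (weyl_isometry rootR _ _ (eW i)) lerD2l.
    by rewrite ler_piMl ?sqnorm_ge0// expr_le1// ltW.
have bnd0 : bnd (f t) @[t --> F] --> 0.
  have -> : 0 = bnd lam.
    by rewrite /bnd subrr /sqnorm dot0l mulr0 mul0r mulr0 mulr0.
  apply: cvgM.
    apply: (cvg_comp _ expR); last exact: continuous_expR.
    apply: cvgD; last exact: cvg_cst.
    by apply: cvgD; [exact: cvg_dot|exact: cvg_cst].
  apply: cvgM; first exact: cvg_cst.
  apply: cvgM; last exact: cvg_cst.
  apply: cvgM; first exact: cvg_cst.
  by apply: cvg_dot; apply: cvgB => //; exact: cvg_cst.
apply/cvgrPdist_lt => d d0.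
have d20 : 0 < d ^+ 2 by rewrite exprn_gt0.
near=> t; rewrite -(@ltr_pXn2r _ 2)// ?nnegrE ?(ltW d0)//.
rewrite real_normK ?num_real// -sqrrN opprB.
apply: le_lt_trans (le_bnd _) _.
have : `|0 - bnd (f t)| < d ^+ 2.
  by near: t; move/cvgrPdist_lt : bnd0; exact.
by rewrite sub0r normrN => /(le_lt_trans (ler_norm _)).
Unshelve. all: by end_near. Qed.

End kernel_estimates.
(** * Asymptotics of the kernel along an orbit *)

Section orbit_asymptotics.
Context {R : realType} {N : nat}.
Local Notation V := 'rV[R]_N.
Local Notation C := R[i].
Local Notation VC := 'rV[C]_N.
Variables (Rt Rp : {fset V}) (k : V -> R) (E : VC -> VC -> C^o).
Hypothesis rootR : root_system Rt.
Hypothesis posR : positive_subsystem Rt Rp.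
Hypothesis multR : multiplicity_function Rt k.
Hypothesis kerE : is_dunkl_kernel Rp k E.
Local Notation rk := (real_kernel E).
Local Notation gam := (dunkl_gamma Rp k).
Variable O : {fset V}.
Hypothesis O_refl : forall a mu, a \in Rp -> mu \in O -> reflection a mu \in O.
Hypothesis O_reg : forall a mu, a \in Rp -> mu \in O -> dot a mu != 0.

(** By stability of [O], the default [i] can occur only for [a] outside [Rp]. *)
Let tau (a : V) (i : O) : O := insubd i (reflection a (val i)).

Let tauE a i : a \in Rp -> val (tau a i) = reflection a (val i).
Proof. by move=> aR; rewrite val_insubd O_refl//; exact: valP. Qed.

Let posroot_neq0 a : a \in Rp -> dot a a != 0.
Proof. by move=> aR; rewrite (root_dot_neq0 rootR)// (posroot_root posR). Qed.

Let tau_inj a : a \in Rp -> injective (tau a).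
Proof.
move=> aR i j /(congr1 val); rewrite !tauE// => ij; apply: val_inj.
exact: can_inj (reflectionK (posroot_neq0 aR)) _ _ ij.
Qed.

(** If the reflection fixed [o], isometry would give [dot a o = - dot a o], hence 0, against
    regularity. *)
Let tau_neq a (o : O) : a \in Rp -> tau a o != o.
Proof.
move=> aR; apply/negP => /eqP /(congr1 val); rewrite tauE// => h.
have := O_reg aR (valP o); apply/negP; rewrite negbK.
have aa := posroot_neq0 aR.
have := dot_reflection a (val o) aa.
rewrite h (reflection_self aa) dotNl => /eqP.
by rewrite -subr_eq0 -opprD oppr_eq0 -mulr2n mulrn_eq0.
Qed.

Lemma orbit_bound eta mu (c : R) : mu \in O ->
  (forall nu, nu \in O -> dot eta nu <= c) ->
  rk eta mu ^+ 2 <= #|{: O}|%:R * expR (2 * c).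
Proof.
move=> muO etac.
have OF : reflection_family Rp tau (fun i : O => val i) by move=> a i /tauE.
apply: le_trans (family_bound rootR posR multR kerE tau_inj OF (fun i => etac _ (valP i))).
by rewrite (bigD1 [` muO]%fset)//= lerDl sumr_ge0// => j _; exact: sqr_ge0.
Qed.

(** The power of [s] removes the diagonal part [- gam / s] of the reflection sum; the exponential
    shifts the rate [dot eta mu] to [- dot eta (o - mu)], which is 0 for [mu = o]. *)
Definition radial_ratio (o mu eta : V) (s : R) : R :=
  s `^ gam * expR (- dot eta o * s) * rk (s *: eta) mu.

Let d_radial_ratio (o i : O) eta (s : R) : 0 < s ->
  is_derive s 1 (radial_ratio (val o) (val i) eta)
    (- dot eta (val o - val i) * radial_ratio (val o) (val i) eta s + s^-1 *
     \sum_(a <- Rp) k a * radial_ratio (val o) (val (tau a i)) eta s).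
Proof.
move=> s0; have := is_derive_real_kernel rootR posR multR kerE eta (val i) s0.
move=> /(is_derive_mul (is_derive_mul (is_derive_powR gam s0)
  (is_derive_expR_scale (- dot eta (val o)) s))).
move=> h; apply: is_derive_eq h _; rewrite /radial_ratio.
set p := s `^ gam; set e := expR _.
have -> : \sum_(a <- Rp) k a * (rk (s *: eta) (val i) -
    rk (s *: eta) (reflection a (val i))) = gam * rk (s *: eta) (val i) -
    \sum_(a <- Rp) k a * rk (s *: eta) (val (tau a i)).
  rewrite mulr_suml -sumrB big_seq [RHS]big_seq; apply: eq_bigr => a aR.
  by rewrite tauE// mulrBr.
have -> : \sum_(a <- Rp) k a * (p * e * rk (s *: eta) (val (tau a i))) =
    p * e * \sum_(a <- Rp) k a * rk (s *: eta) (val (tau a i)).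
  by rewrite mulr_sumr; apply: eq_bigr => a _; ring.
rewrite dotBr; field; by rewrite gt_eqF.
Qed.

Lemma radial_asymptotics (o : V) (del : R) : o \in O -> 0 < del ->
  exists2 s0 : R, 1 <= s0 & exists2 M : R, 0 <= M &
  forall eta, (forall mu, mu \in O -> mu != o -> del <= dot eta (o - mu)) ->
  forall s, s0 <= s ->
  [/\ forall mu, mu \in O -> `|radial_ratio o mu eta s| <= M,
      forall mu, mu \in O -> mu != o -> `|radial_ratio o mu eta s| <= M / s
    & forall t, s <= t ->
        `|radial_ratio o o eta t - radial_ratio o o eta s| <= M / s].
Proof.
move=> oO del0; pose o' : O := [` oO]%fset.
have [s0 s01 asym] := damped_asymptotics (mult_ge0 posR multR) tau_inj
  (fun a aR => tau_neq o' aR) del0.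
exists s0 => //.
have s00 : 0 < s0 by rewrite (lt_le_trans ltr01).
(* As [o] is dominant at [eta], the orbit bound at time [s0] has rate [s0 * dot eta o] and cancels
   the exponential exactly; [D] is therefore the same for all admissible [eta]. *)
pose D := #|{: O}|%:R * (#|{: O}|%:R * (s0 `^ gam) ^+ 2).
have [M M0 HM] := asym D; exists M => // eta eta_del s s0s.
pose q (i : O) := radial_ratio o (val i) eta.
pose d (i : O) := dot eta (o - val i).
have d_off (i : O) : i != o' -> del <= d i.
  move=> io; apply: eta_del; first exact: valP.
  by apply: contra io => /eqP io; apply/eqP/val_inj.
have d_o : d o' = 0 by rewrite /d /= subrr dot0r.
have dq (i : O) (u : R) : 0 < u -> is_derive u 1 (q i)
    (- d i * q i u + u^-1 * \sum_(b <- Rp) k b * q (tau b i) u).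
  exact: (@d_radial_ratio o' i).
have qD : \sum_i q i s0 ^+ 2 <= D.
  rewrite /D mulr_natl -sumr_const; apply: ler_sum => i _.
  have B : rk (s0 *: eta) (val i) ^+ 2 <=
      #|{: O}|%:R * expR (2 * (s0 * dot eta o)).
    apply: orbit_bound => [|nu nuO]; first exact: valP.
    rewrite dotZl ler_pM2l//; have [->//|nuo] := eqVneq nu o.
    by have := eta_del _ nuO nuo; rewrite dotBr; lra.
  have e2 : expR (- dot eta o * s0) ^+ 2 * expR (2 * (s0 * dot eta o)) = 1.
    rewrite -expRM_natl -expRD (_ : _ + _ = 0) ?expR0//; ring.
  rewrite /q /radial_ratio !exprMn [leRHS]mulrC -mulrA.
  rewrite ler_wpM2l ?sqr_ge0//.
  apply: le_trans (ler_wpM2l (sqr_ge0 _) B) _.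
  by rewrite mulrCA e2 mulr1.
have [h1 h2 h3] := HM q d d_off d_o dq qD s s0s.
split=> [mu muO|mu muO muo|t st].
- exact: (h1 [` muO]%fset).
- apply: (h2 [` muO]%fset); apply: contra muo => /eqP /(congr1 val) /= ->.
  exact: eqxx.
- exact: h3.
Qed.

End orbit_asymptotics.
(** * Change of variables *)

Section densities.
Context {d : measure_display} {T : measurableType d} {R : realType}.
Local Open Scope ereal_scope.
Import HBNNSimple.

(** Simple functions and monotone convergence. Serves for the normal law over Lebesgue measure and
    for the law of [X t]. *)
Lemma ge0_integral_density (mu nu : {measure set T -> \bar R}) (g : T -> R)
    (f : T -> \bar R) :
  measurable_fun setT g -> (forall x, (0 <= g x)%R) ->
  (forall A, measurable A -> nu A = \int[mu]_(x in A) (g x)%:E) ->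
  measurable_fun setT f -> (forall x, 0 <= f x) ->
  \int[nu]_x f x = \int[mu]_x (f x * (g x)%:E).
Proof.
move=> mg g0 nuE mf f0.
pose f_ := nnsfun_approx measurableT mf.
have mg' : measurable_fun setT (EFin \o g) by exact/measurable_EFinP.
have mf_ n : measurable_fun setT (EFin \o f_ n) by exact/measurable_EFinP.
transitivity (limn (fun n => \int[nu]_x (f_ n x)%:E)).
  rewrite -monotone_convergence//.
  - by apply: eq_integral => x _; apply/esym/cvg_lim => //; apply: cvg_nnsfun_approx => // *; exact: f0.
  - by move=> n x _; rewrite lee_fin.
  - by move=> x _ m n mn; rewrite lee_fin; exact/lefP/nd_nnsfun_approx.
transitivity (limn (fun n => \int[mu]_x ((f_ n x)%:E * (g x)%:E))); last first.
  rewrite -monotone_convergence//.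
  - apply: eq_integral => x _; apply/cvg_lim => //.
    by apply: cvgeZr => //; apply: cvg_nnsfun_approx => // *; exact: f0.
  - by move=> n; exact: (emeasurable_funM (mf_ n) mg').
  - by move=> n x _; rewrite mule_ge0// lee_fin.
  - move=> x _ m n mn; rewrite lee_wpmul2r ?lee_fin//.
    exact/lefP/nd_nnsfun_approx.
congr (limn _); apply/funext => n.
transitivity (\sum_(k \in range (f_ n)) \int[mu]_x
    (k%:E * ((\1_(f_ n @^-1` [set k]) x)%:E * (g x)%:E))); last first.
  rewrite -ge0_integral_fsum//.
  - apply: eq_integral => x _; rewrite fimfunE -fsumEFin//.
    rewrite ge0_mule_fsuml => [|k]; last first.
      by rewrite EFinM nnfun_muleindic_ge0.
    by apply: eq_fsbigr => k _; rewrite EFinM muleA.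
  - move=> k; apply: emeasurable_funM => //; apply: emeasurable_funM => //.
    exact/measurable_EFinP.
  - by move=> k x _; rewrite muleA mule_ge0 ?nnfun_muleindic_ge0 ?lee_fin.
rewrite integralT_nnsfun sintegralE; apply: eq_fsbigr => k /[!inE] kf.
have k0 : (0 <= k)%R by case: kf => x _ <-.
rewrite ge0_integralZl//.
- rewrite nuE// integral_mkcond; congr (_ * _).
  apply: eq_integral => x _; rewrite patchE indicE.
  by case: ifP => _; rewrite ?mul1e ?mul0e.
- apply: emeasurable_funM => //; exact/measurable_EFinP.
- by move=> x _; rewrite mule_ge0// lee_fin.
Qed.

End densities.
Section change_of_variables.
Context {R : realType}.
Local Open Scope ereal_scope.

(** Covers substitutions, where [phi] is a Jacobian, as well as densities, where [h] is the
    identity. *)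
Definition change_variables {d1 d2 : measure_display} {T1 : measurableType d1}
    {T2 : measurableType d2} (mu1 : {measure set T1 -> \bar R})
    (mu2 : {measure set T2 -> \bar R}) (h : T2 -> T1) (phi : T2 -> R) :=
  forall f : T1 -> \bar R, measurable_fun setT f -> (forall x, 0 <= f x) ->
  \int[mu1]_x f x = \int[mu2]_x (f (h x) * (phi x)%:E).

Definition map_rV n (h : 'I_n -> R -> R) (v : 'rV[R]_n) : 'rV[R]_n :=
  \row_j h j (v 0%R j).

Lemma cons_rV0 n (p : measurableTypeR R * 'rV[R]_n) : cons_rV p 0%R ord0 = p.1.
Proof.
rewrite /cons_rV (_ : ord0 = lshift n (ord0 : 'I_1)); last exact: val_inj.
by apply: etrans (row_mxEl _ _ _ _) _; rewrite mxE eqxx.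
Qed.

Lemma cons_rV_lift n (p : measurableTypeR R * 'rV[R]_n) (j : 'I_n) :
  cons_rV p 0%R (lift ord0 j) = p.2 0%R j.
Proof.
rewrite /cons_rV (_ : lift ord0 j = rshift 1 j); last exact: val_inj.
exact: row_mxEr.
Qed.

Lemma map_cons_rV n (h : 'I_n.+1 -> R -> R) (x : R) (v : 'rV[R]_n) :
  map_rV h (cons_rV (x : measurableTypeR R, v)) =
  cons_rV (h ord0 x : measurableTypeR R, map_rV (fun j => h (lift ord0 j)) v).
Proof.
apply/rowP => j; rewrite mxE; case: (unliftP ord0 j) => [i|] ->.
  by rewrite !cons_rV_lift mxE.
by rewrite !cons_rV0.
Qed.

Lemma measurable_map_rV n (h : 'I_n -> R -> R) :
  (forall j, measurable_fun setT (h j)) -> measurable_fun setT (map_rV h).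
Proof.
move=> mh; apply: measurable_fun_rV => j; under eq_fun do rewrite mxE.
exact: (measurableT_comp (mh j) (measurable_coord j)).
Qed.

Lemma measurable_prod_coord n (phi : R -> R) : measurable_fun setT phi ->
  measurable_fun setT (fun v : 'rV[R]_n => (\prod_(j < n) phi (v 0 j))%R).
Proof.
move=> mphi; apply: measurable_prod => j _.
exact: (measurableT_comp mphi (measurable_coord j)).
Qed.

Lemma measurable_map_rV_density n (h : 'I_n -> R -> R) (phi : R -> R)
    (f : 'rV[R]_n -> \bar R) :
  (forall j, measurable_fun setT (h j)) -> measurable_fun setT phi ->
  measurable_fun setT f ->
  measurable_fun setT (fun v : 'rV[R]_n =>
    f (map_rV h v) * (\prod_(j < n) phi (v 0 j))%:E).
Proof.
move=> mh mphi mf; apply: emeasurable_funM.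
  exact: (measurableT_comp mf (measurable_map_rV mh)).
by apply/measurable_EFinP; exact: measurable_prod_coord.
Qed.

Section power.
Variables mu1 mu2 : {sigma_finite_measure set (measurableTypeR R) -> \bar R}.

Lemma integral_power_measureS (mu : {sigma_finite_measure set (measurableTypeR R) -> \bar R}) n
    (f : 'rV[R]_n.+1 -> \bar R) :
  measurable_fun setT f -> (forall v, 0 <= f v) ->
  \int[power_measure mu n.+1]_v f v =
  \int[mu]_x \int[power_measure mu n]_v f (cons_rV (x, v)).
Proof.
move=> mf f0 /=; rewrite /cons_measure.
rewrite (ge0_integral_pushforward (@measurable_cons_rV R n))//= preimage_setT.
rewrite fubini_tonelli1//; exact: measurableT_comp mf (@measurable_cons_rV R n).
Qed.

(** Induction on the dimension by Tonelli. The map may vary with the coordinate, as in a translation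
    by a vector, while [phi] is common to all. *)
Lemma change_variables_power n (h : 'I_n -> R -> R) (phi : R -> R) :
  (forall j, measurable_fun setT (h j)) ->
  measurable_fun setT phi -> (forall x, (0 <= phi x)%R) ->
  (forall j, change_variables mu1 mu2 (h j) phi) ->
  change_variables (power_measure mu1 n) (power_measure mu2 n) (map_rV h)
    (fun v => (\prod_(j < n) phi (v 0 j))%R).
Proof.
elim: n h => [|n IH] h mh mphi phi0 hP f mf f0.
  rewrite /= !integral_dirac//; last exact: measurable_map_rV_density.
  rewrite !diracT !mul1e big_ord0 mule1; congr f.
  by apply/rowP => -[].
pose h' (j : 'I_n) := h (lift ord0 j).
have mh' j : measurable_fun setT (h' j) by exact: mh.
have mF := measurable_map_rV_density mh mphi mf.
have F0 v : 0 <= f (map_rV h v) * (\prod_(j < n.+1) phi (v 0 j))%:E.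
  by rewrite mule_ge0// lee_fin prodr_ge0.
rewrite !integral_power_measureS//.
have mfc : measurable_fun setT (f \o @cons_rV R n).
  exact: measurableT_comp mf (@measurable_cons_rV R n).
have mG : measurable_fun setT (fun x : measurableTypeR R =>
    \int[power_measure mu1 n]_v f (cons_rV (x, v))).
  exact: (@measurable_fun_fubini_tonelli_F _ _ _ _ _ (power_measure mu1 n)
    (f \o @cons_rV R n) mfc (fun p => f0 _)).
have G0 (x : measurableTypeR R) : 0 <= \int[power_measure mu1 n]_v f (cons_rV (x, v)).
  by apply: integral_ge0.
rewrite (hP ord0 _ mG G0); apply: eq_integral => x _.
have pair_x : measurable_fun setT (fun v : 'rV[R]_n =>
    (h ord0 x : measurableTypeR R, v)) by exact: measurable_fun_pair.
have mfx : measurable_fun setT (fun v : 'rV[R]_n =>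
    f (cons_rV (h ord0 x : measurableTypeR R, v))).
  exact: (measurableT_comp mfc pair_x).
rewrite (IH _ mh' mphi phi0 (fun j => hP (lift ord0 j)) _ mfx)//.
rewrite -ge0_integralZr ?lee_fin//; last 2 first.
- exact: (measurable_map_rV_density mh' mphi mfx).
- by move=> v _; rewrite mule_ge0// lee_fin prodr_ge0.
apply: eq_integral => v _; rewrite map_cons_rV -muleA -EFinM.
congr (f _ * _%:E); rewrite big_ord_recl cons_rV0 mulrC; congr (_ * _)%R.
by apply: eq_bigr => j _; rewrite cons_rV_lift.
Qed.

End power.
End change_of_variables.

(** * Lebesgue and Gaussian measures on row vectors *)

Lemma continuous_measurable_rV (R : realType) (N : nat) (f : 'rV[R]_N -> R) :
  continuous f -> measurable_fun setT f.
Proof.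
move=> cf; apply: (measurability _ (RGenOInfty.measurableE R)) => //.
move=> _ [_ [x ->] <-]; rewrite setTI; apply: open_measurable_rV.
by apply: open_comp => [v _|]; [exact: cf|exact: interval_open].
Qed.

Lemma continuous_dotr (R : realType) (N : nat) (a : 'rV[R]_N) :
  continuous (fun y : 'rV[R]_N => dot a y).
Proof. 
move=> y; apply: (@cvg_dot _ _ _ _ (nbhs_filter y)); last exact: cvg_id.
exact: (@cvg_cst _ _ _ _ (nbhs_filter y)).
 Qed.

Lemma continuous_sqnorm (R : realType) (N : nat) : continuous (@sqnorm R N).
Proof. by move=> y; apply: (@cvg_dot _ _ _ _ (nbhs_filter y)); exact: cvg_id. Qed.

Section lebesgue_gauss.
Context {R : realType}.
Local Notation mu := (@lebesgue_measure R).

(** The image of Lebesgue measure under the affine map, rescaled by [c], gives half-open intervals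
    their length preimage-wise, so it is Lebesgue measure by uniqueness. *)
Lemma change_variables_lebesgue (a c : R) : 0 < c ->
  change_variables mu mu (fun x : R => a + c * x) (fun=> c).
Proof.
move=> c0 f mf f0; pose h (x : R) : measurableTypeR R := a + c * x.
have mh : measurable_fun setT h.
  by apply: measurable_funD => //; exact: measurable_funM.
pose m := mscale (NngNum (ltW c0))
  (measure_function_pushforward__canonical__measure_function_Measure mu mh).
have muE A : measurable A -> mu A = m A.
  apply: lebesgue_measure_unique => _ [[u v] _ <-] /=.
  rewrite /m /mscale /= /pushforward.
  have -> : h @^-1` `]u, v] = `](u - a) / c, (v - a) / c]%classic.
    apply/seteqP; split=> x; rewrite /= !in_itv /=;
      by rewrite ltr_pdivrMr// ler_pdivlMr// ltrBlDl lerBrDl (mulrC x).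
  rewrite !lebesgue_measure_itv /= !lte_fin.
  rewrite ltr_pM2r ?invr_gt0// ltrD2r; case: ifP => _; last by rewrite mule0.
  by rewrite -!EFinB -EFinM; congr EFin; field; rewrite gt_eqF.
rewrite (@eq_measure_integral _ _ _ _ m)//; last by move=> A mA _; exact: muE.
rewrite ge0_integral_mscale//= ge0_integral_pushforward//= preimage_setT.
rewrite ge0_integralZr//=.
- by rewrite muleC.
- exact: measurableT_comp mf mh.
- by rewrite lee_fin ltW.
Qed.

Lemma change_variables_normal (s : R) :
  change_variables (normal_prob 0 s) mu id (normal_pdf 0 s).
Proof.
move=> f mf f0; rewrite (@ge0_integral_density _ _ _ mu (normal_prob 0 s)
  (normal_pdf 0 s))//.
- exact: measurable_normal_pdf.
- by move=> x; exact: normal_pdf_ge0.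
Qed.

Section rV.
Variable N : nat.
Local Notation muN := (lebesgue_rV R N).

Lemma map_rV_id (v : 'rV[R]_N) : map_rV (fun=> id) v = v.
Proof. by apply/rowP => j; rewrite mxE. Qed.

Lemma prod_normal_pdf (s : R) (v : 'rV[R]_N) : s != 0 ->
  \prod_(j < N) normal_pdf 0 s (v 0 j) =
  normal_peak s ^+ N * expR (- sqnorm v / (s ^+ 2 *+ 2)).
Proof.
move=> s0; rewrite normal_pdfE//= big_split /= prodr_const card_ord.
congr (_ * _); rewrite /normal_fun -expR_sum; congr expR.
rewrite mulNr -mulNr /sqnorm /dot -sumrN mulr_suml; apply: eq_bigr => j _.
by rewrite subr0 expr2.
Qed.

Lemma change_variables_lebesgue_rV (a : 'rV[R]_N) (c : R) : 0 < c ->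
  change_variables muN muN (fun z : 'rV[R]_N => a + c *: z) (fun=> c ^+ N).
Proof.
move=> c0 f mf f0.
rewrite (@change_variables_power _ mu mu N (fun j x => a 0 j + c * x)
  (fun=> c) _ _ _ _ _ mf f0).
- apply: eq_integral => v _; rewrite prodr_const card_ord.
  by congr (f _ * _)%E; apply/rowP => j; rewrite !mxE.
- by move=> j; apply: measurable_funD => //; exact: measurable_funM.
- by [].
- by move=> _; exact: ltW.
- by move=> j; exact: change_variables_lebesgue.
Qed.

Lemma ge0_integral_power_normal (s : R) (f : 'rV[R]_N -> \bar R) : s != 0 ->
  measurable_fun setT f -> (forall v, 0 <= f v)%E ->
  (\int[power_measure (normal_prob 0 s) N]_v f v =
   \int[muN]_v (f v *
     (normal_peak s ^+ N * expR (- sqnorm v / (s ^+ 2 *+ 2)))%:E))%E.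
Proof.
move=> s0 mf f0.
rewrite (@change_variables_power _ (normal_prob 0 s) mu N (fun=> id)
  (normal_pdf 0 s) _ _ _ _ _ mf f0)//.
- by apply: eq_integral => v _; rewrite map_rV_id prod_normal_pdf.
- exact: measurable_normal_pdf.
- by move=> x; exact: normal_pdf_ge0.
- by move=> j; exact: change_variables_normal.
Qed.

End rV.

Lemma power_normal_setT (s : R) n :
  power_measure (normal_prob 0 s) n setT = 1%E.
Proof.
elim: n => [|n IH] /=; first by rewrite diracT.
rewrite /cons_measure /pushforward preimage_setT -setXTT.
rewrite product_measure1E// IH mule1.
exact: (probability_setT (normal_prob 0 s)).
Qed.

(** Up to its peak this is the density of independent centred normal variables of standard deviation
    2, as 8 is twice the square of 2; total mass 1 makes the integral finite. *)
Lemma integrable_gauss N : (lebesgue_rV R N).-integrable setT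
  (fun z => (expR (- sqnorm z / 8))%:E).
Proof.
have mg : measurable_fun setT (fun z : 'rV[R]_N => (expR (- sqnorm z / 8))%:E).
  apply/measurable_EFinP; apply: measurableT_comp => //.
  apply: measurable_funM => //; apply: measurableT_comp => //.
  by apply: continuous_measurable_rV; exact: continuous_sqnorm.
apply/integrableP; split=> //.
under eq_integral do rewrite gee0_abs ?lee_fin ?expR_ge0//.
have E : (1 = \int[lebesgue_rV R N]_v (1 * (normal_peak (2 : R) ^+ N *
    expR (- sqnorm v / (2 ^+ 2 *+ 2)))%:E))%E.
  rewrite -(@ge0_integral_power_normal N 2 (fun=> 1%E)) ?pnatr_eq0//.
  by rewrite integral_cst// mul1e; exact/esym/power_normal_setT.
have p0 : 0 < normal_peak (2 : R) ^+ N.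
  by rewrite exprn_gt0// normal_peak_gt0// pnatr_eq0.
have {}E : (\int[lebesgue_rV R N]_v ((normal_peak (2 : R) ^+ N)%:E *
    (expR (- sqnorm v / 8))%:E))%E = 1%E.
  rewrite [RHS]E; apply: eq_integral => v _.
  by rewrite mul1e -EFinM; congr (_ * expR (_ / _))%:E; ring.
move: E; rewrite ge0_integralZl//; last by rewrite lee_fin ltW.
case: (\int[_]_v _)%E => [r| |].
- by rewrite ltry.
- by rewrite gt0_muley ?lte_fin.
- by rewrite ltNye.
Qed.

End lebesgue_gauss.
(** * The rescaled density *)

Lemma powR_sqrtn (R : realType) (t : R) (n : nat) : 0 < t ->
  t `^ (n%:R / 2) = Num.sqrt t ^+ n.
Proof.
move=> t0; rewrite mulrC powRrM powR12_sqrt ?ltW// powR_mulrn//.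
Qed.

Lemma powR_sum (R : realType) (t : R) (I : Type) (r : seq I) (f : I -> R) :
  0 < t -> t `^ (\sum_(i <- r) f i) = \prod_(i <- r) t `^ f i.
Proof.
move=> t0; elim: r => [|i r IH]; first by rewrite !big_nil powRr0.
by rewrite !big_cons powRD ?IH// (gt_eqF t0) implybT.
Qed.

Section density.
Context {R : realType} {N : nat}.
Local Notation V := 'rV[R]_N.
Local Notation C := R[i].
Local Notation VC := 'rV[C]_N.
Variables (Rt Rp : {fset V}) (k : V -> R) (E : VC -> VC -> C^o).
Hypothesis rootR : root_system Rt.
Hypothesis posR : positive_subsystem Rt Rp.
Hypothesis multR : multiplicity_function Rt k.
Hypothesis kerE : is_dunkl_kernel Rp k E.
Local Notation rk := (real_kernel E).
Local Notation gam := (dunkl_gamma Rp k).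
Local Notation wgt := (dunkl_weight Rp k).
Variables (lam x : V).

Lemma dunkl_weightZ (t : R) (eta : V) : 0 < t ->
  wgt (t *: eta) = (t `^ gam) ^+ 2 * wgt eta.
Proof.
move=> t0; rewrite -powR_mulrn ?powR_ge0// -powRrM [gam * _]mulrC mulr_sumr.
rewrite (powR_sum _ _ t0) -big_split; apply: eq_bigr => a _ /=.
by rewrite dotZr normrM (gtr0_norm t0) (powRM _ (ltW t0) (normr_ge0 _)).
Qed.

Definition profile (t : R) (mu eta : V) : R :=
  dunkl_const Rp k / rk x lam * expR (- sqnorm x / (2 * t)) *
  (rk x eta * wgt eta) * radial_ratio Rp k E mu lam eta t.

(** Since [mu] and [lam] have equal norms, [- t |lam|^2 / 2 - t |eta|^2 / 2] equals
    [- t <eta, mu> - |z|^2 / 2]. The weight brings [t^(2 gam)] against [t^(- gam)] in the density,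
    which leaves the power in the ratio; [t^(N / 2)] is the Jacobian. *)
Lemma dunkl_density_profile (t : R) (mu z : V) : 0 < t ->
  sqnorm mu = sqnorm lam ->
  dunkl_density Rp k E lam t x (t *: mu + Num.sqrt t *: z) * Num.sqrt t ^+ N =
  profile t mu (mu + (Num.sqrt t)^-1 *: z) * expR (- sqnorm z / 2).
Proof.
move=> t0 mulam; set eta := mu + _.
have st0 : 0 < Num.sqrt t by rewrite sqrtr_gt0.
have tE : t = Num.sqrt t ^+ 2 by rewrite sqr_sqrtr// ltW.
have -> : t *: mu + Num.sqrt t *: z = t *: eta.
  rewrite /eta scalerDr scalerA (_ : t / Num.sqrt t = Num.sqrt t)//.
  by rewrite {1}tE expr2 mulfK// gt_eqF.
rewrite /dunkl_density /profile /radial_ratio (dunkl_weightZ _ t0).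
rewrite powRD ?(gt_eqF t0) ?implybT// powR_sqrtn// .
have -> : rk ((Num.sqrt t)^-1 *: x) ((Num.sqrt t)^-1 *: (t *: eta)) = rk x eta.
  rewrite (real_kernel_scale kerE) ?gt_eqF ?invr_gt0//; congr rk.
  by rewrite !scalerA -invfM -expr2 -tE mulVf ?scale1r// gt_eqF.
have e1 : expR (- (sqnorm lam * t) / 2) *
   expR (- (sqnorm x + sqnorm (t *: eta)) / (2 * t)) =
   expR (- sqnorm x / (2 * t)) * expR (- dot eta mu * t) * expR (- sqnorm z / 2).
  rewrite -!expRD; congr expR.
  have -> : sqnorm z = t * sqnorm (eta - mu).
    rewrite /eta addrC addKr sqnormZ exprVn -tE mulrA divff ?mul1r//.
    by rewrite gt_eqF.
  rewrite sqnormZ sqnormB mulam; field; by rewrite gt_eqF.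
have tg : t `^ gam != 0 by rewrite gt_eqF// powR_gt0.
have sN : Num.sqrt t ^+ N != 0 by rewrite expf_neq0// gt_eqF.
set A := dunkl_const _ _; set e := expR _ in e1 *; set e' := expR _ in e1 *.
set p := t `^ gam in tg *.
transitivity (A * (e * e') * p * rk x eta * rk (t *: eta) lam / rk x lam *
  wgt eta).
  set u := (rk x lam)^-1; field; rewrite sN tg //.
rewrite e1; ring.
Qed.

End density.

(** * Domination and limits of the profile *)

Lemma powR_le_expR (R : realType) (g c : R) : 0 <= g -> 0 < c ->
  exists2 K : R, 0 <= K & forall t, 0 < t -> t `^ g <= K * expR (c * t).
Proof.
move=> g0 c0; exists (((g + 1) / c) `^ g) => [|t t0]; first exact: powR_ge0.
have g1 : 0 < g + 1 by lra.
(* From [u <= expR u] at [u = c * t / (g + 1)]; the [+ 1] allows [g = 0]. *)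
have t_le : t <= (g + 1) / c * expR (c * t / (g + 1)).
  have := expR_ge1Dx (c * t / (g + 1)) => h.
  rewrite [leLHS](_ : t = (g + 1) / c * (c * t / (g + 1))); last first.
    by field; rewrite !gt_eqF.
  by rewrite ler_pM2l ?divr_gt0//; lra.
have gc0 : 0 <= (g + 1) / c by rewrite divr_ge0// ltW.
apply: le_trans (ge0_ler_powR g0 _ _ t_le) _; rewrite ?nnegrE ?(ltW t0)//.
  by rewrite mulr_ge0 ?expR_ge0.
rewrite powRM ?expR_ge0// ler_wpM2l ?powR_ge0// -expRM ler_expR.
rewrite (_ : _ * g = c * t * (g / (g + 1))); last by field; rewrite gt_eqF.
rewrite ler_piMr ?mulr_ge0 ?(ltW c0) ?(ltW t0)//.
by rewrite ler_pdivrMr// mul1r; lra.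
Qed.

(** Here [n.+1] is an upper bound for the square root of [n]. *)
Lemma norm_le_expR (R : realType) (n : nat) (r c : R) :
  r ^+ 2 <= n%:R * expR (2 * c) -> `|r| <= n.+1%:R * expR c.
Proof.
move=> h; have e0 := expR_gt0 c.
rewrite -(@ler_pXn2r _ 2) ?nnegrE ?mulr_ge0 ?(ltW e0)//.
rewrite real_normK ?num_real//; apply: le_trans h _.
rewrite expRM_natl exprMn ler_wpM2r ?sqr_ge0// -natrX ler_nat.
by rewrite (leq_trans (leqnSn n))// expnS expn1 leq_pmulr.
Qed.

Lemma pos_lower_bound (R : realType) (T : eqType) (s : seq T) (f : T -> R) :
  (forall x, x \in s -> 0 < f x) ->
  exists2 d : R, 0 < d & forall x, x \in s -> d <= f x.
Proof.
elim: s => [_|x s IH f0]; first by exists 1.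
have [y ys|d d0 dP] := IH; first by apply: f0; rewrite inE ys orbT.
exists (Num.min d (f x)); first by rewrite lt_min d0 f0// mem_head.
move=> y; rewrite inE => /predU1P[->|/dP dy]; first by rewrite ge_min lexx orbT.
by rewrite ge_min dy.
Qed.

Lemma norm_dot_young (R : realType) (N : nat) (u v : 'rV[R]_N) (e : R) : 0 < e ->
  2 * `|dot u v| <= e * sqnorm u + sqnorm v / e.
Proof.
move=> e0; have h1 := dot_young u v e0; have := dot_young u (- v) e0.
rewrite dotNr (_ : sqnorm (- v) = sqnorm v); last first.
  by rewrite /sqnorm dotNl dotNr opprK.
by case: (ger0P (dot u v)) => h; lra.
Qed.

Lemma continuous_Re_complexify (R : realType) (N : nat)
    (f : 'rV[R[i]]_N -> R[i]^o) : (forall z, differentiable f z) ->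
  continuous (fun y : 'rV[R]_N => complex.Re (f (complexify y))).
Proof.
move=> df y; apply: (@cvg_Re _ _ _ (nbhs_filter y)).
apply: (cvg_comp (@complexify R N) f); last first.
  exact: (differentiable_continuous (df (complexify y))).
move=> A /nbhs_ballP[[e ei] /= + eA]; rewrite ltcE /= => /andP[/eqP ei0 e0].
have : \forall z \near y, ball y e z by exact: nbhsx_ballx.
apply: filterS => z [_ yz]; apply: eA; split=> [|i j].
  by rewrite ei0 ltcE/= eqxx.
rewrite !mxE /ball /= -raddfB normc_def /= expr0n /= addr0 sqrtr_sqr ei0.
by rewrite -[ltRHS]/(real_complex R e) ltcR; exact: yz.
Qed.

Lemma cvg_real_kernell (R : realType) (N : nat) (k : 'rV[R]_N -> R) Rp E
    (w : 'rV[R]_N) (T : Type) (F : set_system T) (FF : Filter F)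
    (f : T -> 'rV[R]_N) (y : 'rV[R]_N) : is_dunkl_kernel Rp k E ->
  f t @[t --> F] --> y -> real_kernel E (f t) w @[t --> F] --> real_kernel E y w.
Proof.
move=> kerE fy; have [df _ _] := kernel_eigen kerE (complexify w).
exact: (cvg_comp f _ fy (@continuous_Re_complexify _ _ _ df y)).
Qed.

Lemma cvg_invsqrt (R : realType) : (Num.sqrt t)^-1 @[t --> +oo] --> (0 : R).
Proof.
apply/cvgrPdist_lt => e e0; near=> t.
have t0 : 0 < t by near: t; exact: nbhs_pinfty_gt.
rewrite sub0r normrN gtr0_norm ?invr_gt0 ?sqrtr_gt0//.
rewrite invf_plt ?posrE ?sqrtr_gt0//.
rewrite -[ltLHS](@gtr0_norm _ e^-1) ?invr_gt0// -sqrtr_sqr ltr_sqrt//.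
by near: t; apply: nbhs_pinfty_gt; rewrite num_real.
Unshelve. all: by end_near. Qed.
Section profile_estimates.
Context {R : realType} {N : nat}.
Local Notation V := 'rV[R]_N.
Local Notation C := R[i].
Local Notation VC := 'rV[C]_N.
Variables (Rt Rp : {fset V}) (k : V -> R) (E : VC -> VC -> C^o).
Hypothesis rootR : root_system Rt.
Hypothesis posR : positive_subsystem Rt Rp.
Hypothesis multR : multiplicity_function Rt k.
Hypothesis kerE : is_dunkl_kernel Rp k E.
Local Notation rk := (real_kernel E).
Local Notation gam := (dunkl_gamma Rp k).
Local Notation wgt := (dunkl_weight Rp k).
Variables (lam x : V) (O : {fset V}).
Hypothesis O_refl : forall a mu, a \in Rp -> mu \in O -> reflection a mu \in O.
Hypothesis O_reg : forall a mu, a \in Rp -> mu \in O -> dot a mu != 0.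
Hypothesis O_norm : forall mu, mu \in O -> sqnorm mu = sqnorm lam.
Hypothesis lamO : lam \in O.
Local Notation ratio := (radial_ratio Rp k E).
Local Notation prof := (profile Rp k E lam x).
Local Notation "mu '+[' t ']' z" := (mu + (Num.sqrt (t : R))^-1 *: z)
  (at level 50, t at level 200).

Let gam0 : 0 <= gam.
Proof. by rewrite /dunkl_gamma big_seq sumr_ge0// => a; exact: (mult_ge0 posR multR). Qed.

(** Applying [u <= expR u] to [u = |dot a eta|] and then Young's inequality makes the coefficient of
    [sqnorm eta] as small as desired, at the price of the constant [D]. *)
Lemma weight_bound (e : R) : 0 < e -> exists D : R, forall eta,
  0 <= wgt eta <= expR (gam * e * sqnorm eta + D).
Proof.
move=> e0; exists (\sum_(a <- Rp) k a * (sqnorm a / e)) => eta.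
apply/andP; split; first by apply: prodr_ge0 => a _; exact: powR_ge0.
rewrite /dunkl_gamma -mulrA mulr_suml -big_split /= expR_sum /dunkl_weight.
rewrite big_seq [leRHS]big_seq; apply: ler_prod => a aR.
have k0 := mult_ge0 posR multR aR; rewrite powR_ge0 /=.
set u := `|dot a eta|.
have ue : u <= expR u by have := expR_ge1Dx u; lra.
have k20 : 0 <= 2 * k a by rewrite mulr_ge0.
have u0 : 0 <= u by exact: normr_ge0.
apply: le_trans (ge0_ler_powR k20 _ _ ue) _; rewrite ?nnegrE ?expR_ge0//.
rewrite -expRM ler_expR mulrA [_ * k a]mulrC -mulrDr ler_wpM2l// mulrC.
by rewrite /u dotC; exact: norm_dot_young.
Qed.

(** For points of equal norm, [dot mu (mu - nu) = sqnorm (mu - nu) / 2], and the orbit is finite.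
    The factor 2 leaves a margin [del] for perturbing [mu]. *)
Lemma orbit_gap : exists2 del : R, 0 < del & forall mu nu, mu \in O -> nu \in O ->
  nu != mu -> 2 * del <= dot mu (mu - nu).
Proof.
pose s := [seq p <- [seq (mu, nu) | mu <- O, nu <- O] | p.2 != p.1].
pose f (p : V * V) := dot p.1 (p.1 - p.2) / 2.
have [p|d d0 dP] := @pos_lower_bound R _ s f.
  rewrite mem_filter => /andP[p21 /allpairsP[[mu nu] /= [muO nuO pE]]].
  rewrite pE /= in p21 *; rewrite /f /= divr_gt0//.
  have : 0 < sqnorm (mu - nu).
    by rewrite lt_neqAle sqnorm_ge0 eq_sym sqnorm_eq0 subr_eq0 eq_sym p21.
  rewrite sqnormB dotBr -/(sqnorm mu) (O_norm muO) (O_norm nuO); lra.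
exists d => // mu nu muO nuO numu.
have := dP (mu, nu); rewrite mem_filter numu /f /=.
have -> : (mu, nu) \in [seq (mu, nu) | mu <- O, nu <- O].
  by apply/allpairsP; exists (mu, nu).
by move=> /(_ isT); rewrite ler_pdivlMr// mulrC.
Qed.

Let rescale_norm (t : R) (z : V) : 0 < t ->
  sqnorm ((Num.sqrt t)^-1 *: z) = sqnorm z / t.
Proof. by move=> t0; rewrite sqnormZ exprVn sqr_sqrtr ?ltW// mulrC. Qed.

(* Outside the cone where [radial_asymptotics] applies, [|z|^2 / t] is bounded
   below, so that the factor [t `^ gam] is absorbed by [expR (|z|^2 / 4)]. *)
Lemma ratio_bound mu : mu \in O -> exists M : R, exists2 t0 : R, 1 <= t0 &
  forall (t : R) (z : V), t0 <= t ->
  (forall nu, nu \in O -> dot (mu +[t] z) nu <= dot (mu +[t] z) mu) ->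
  `|ratio mu lam (mu +[t] z) t| <= M * expR (sqnorm z / 4).
Proof.
move=> muO; have [del del0 gap] := orbit_gap.
have [s0 s01 [M M0 asym]] := radial_asymptotics rootR posR multR kerE
  O_refl O_reg muO del0.
(* [W] bounds [sqnorm (mu - nu)] on the orbit, the [+ 1] keeping it positive for [lam = 0]. With
   [c1] below, [del ^+ 2 <= W * sqnorm z / t] reads [t * c1 <= sqnorm z / 4]. *)
pose W := 4 * sqnorm lam + 1.
have W0 : 0 < W by rewrite /W; have := sqnorm_ge0 lam; lra.
pose c1 := del ^+ 2 / W / 4.
have c10 : 0 < c1 by rewrite !divr_gt0// exprn_gt0.
have [K K0 Kt] := powR_le_expR gam0 c10.
pose n := #|{: O}|.
exists (M + n.+1%:R * K), s0 => // t z st dom.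
have t0 : 0 < t by rewrite (lt_le_trans _ st)// (lt_le_trans ltr01).
set eta := mu +[t] z in dom *.
have e1 : 1 <= expR (sqnorm z / 4).
  by rewrite -[leLHS]expR0 ler_expR divr_ge0// sqnorm_ge0.
have [far|near] := pselect (exists2 nu, nu \in O &
    nu != mu /\ dot eta (mu - nu) < del); last first.
  have [h _ _] : [/\ forall nu, nu \in O -> `|ratio mu nu eta t| <= M,
      forall nu, nu \in O -> nu != mu -> `|ratio mu nu eta t| <= M / t
    & forall t', t <= t' -> `|ratio mu mu eta t' - ratio mu mu eta t| <= M / t].
    apply: asym st => nu nuO numu; rewrite leNgt; apply/negP => lt_del.
    by apply: near; exists nu.
  apply: le_trans (h lam lamO) _.
  rewrite mulrDl ler_wpDr ?mulr_ge0 ?expR_ge0//.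
  by rewrite ler_peMr.
have [nu nuO [numu lt_del]] := far.
have tz : t * c1 <= sqnorm z / 4.
  have := gap _ _ muO nuO numu => g.
  (* The gap at [mu] itself is [2 * del], so a value below [del] must come from the displacement by
     [z]. *)
  have d1 : del <= - dot ((Num.sqrt t)^-1 *: z) (mu - nu).
    by move: lt_del; rewrite /eta dotDl; lra.
  have d2 : del ^+ 2 <= sqnorm z / t * sqnorm (mu - nu).
    rewrite -(rescale_norm _ t0); apply: le_trans (dot_sqr_le _ _).
    by rewrite -[leRHS]sqrrN ler_pXn2r// nnegrE; lra.
  have d3 : sqnorm (mu - nu) <= W.
    have := sqnormD_le mu (- nu).
    rewrite [sqnorm (- nu)]/sqnorm dotNl dotNr opprK -/(sqnorm nu).
    by rewrite (O_norm muO) (O_norm nuO) /W; lra.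
  rewrite /c1 mulrA ler_pM2r// mulrA ler_pdivrMr// mulrC.
  rewrite -ler_pdivlMr// mulrAC; apply: le_trans d2 _.
  by rewrite ler_wpM2l// divr_ge0 ?sqnorm_ge0// ltW.
have B : `|rk (t *: eta) lam| <= n.+1%:R * expR (t * dot eta mu).
  apply: norm_le_expR.
  apply: (orbit_bound rootR posR multR kerE O_refl lamO) => nu' nu'O.
  by rewrite dotZl ler_pM2l// dom.
rewrite /radial_ratio normrM (ger0_norm (mulr_ge0 (powR_ge0 _ _) (expR_ge0 _))).
have p0 : 0 <= t `^ gam * expR (- dot eta mu * t).
  by rewrite mulr_ge0 ?powR_ge0 ?expR_ge0.
apply: le_trans (ler_wpM2l p0 B) _.
have -> : t `^ gam * expR (- dot eta mu * t) * (n.+1%:R * expR (t * dot eta mu)) =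
    n.+1%:R * t `^ gam * (expR (- dot eta mu * t) * expR (t * dot eta mu)) by ring.
rewrite -expRD (_ : _ + _ = 0) ?expR0 ?mulr1; last by ring.
rewrite mulrDl ler_wpDl ?mulr_ge0 ?expR_ge0// -mulrA ler_wpM2l//.
apply: le_trans (Kt t t0) _; rewrite ler_wpM2l// ler_expR.
by rewrite mulrC.
Qed.

(** Of the Gaussian exponent 1/2, the ratio consumes 1/4 and the kernel with the weight 1/8; the
    remaining 1/8 is integrable. *)
Lemma profile_bound mu : mu \in O -> exists M : R, exists2 t0 : R, 1 <= t0 &
  forall (t : R) (z : V), t0 <= t ->
  (forall nu, nu \in O -> dot (mu +[t] z) nu <= dot (mu +[t] z) mu) ->
  `|prof t mu (mu +[t] z) * expR (- sqnorm z / 2)| <= M * expR (- sqnorm z / 8).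
Proof.
move=> muO; have [M [t0 t01 HM]] := ratio_bound muO.
(* As [sqnorm eta <= 2 * sqnorm lam + 2 * sqnorm z], the kernel costs [e] and the weight
   [2 * gam * e] times [sqnorm z]; this [e] makes the sum 1/8. *)
pose e := (8 * (1 + 2 * gam))^-1.
have e0 : 0 < e by rewrite invr_gt0; have := gam0; lra.
have [D wD] := weight_bound e0.
have [n growth] := real_kernel_growth rootR posR multR kerE.
pose A := `|dunkl_const Rp k / rk x lam|.
pose B := expR ((e * (2 * sqnorm lam) + sqnorm x / e) / 2 +
  (gam * e * (2 * sqnorm lam) + D)).
exists (A * (n.+1%:R * B) * M), t0 => // t z tt dom.
have tp : 0 < t by rewrite (lt_le_trans _ tt)// (lt_le_trans ltr01).
have t1 : 1 <= t by rewrite (le_trans t01).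
set eta := mu +[t] z in dom *.
have := HM _ _ tt dom; rewrite -/eta => ratio_le.
have eta_le : sqnorm eta <= 2 * sqnorm lam + 2 * sqnorm z.
  apply: le_trans (sqnormD_le _ _) _; rewrite (O_norm muO) (rescale_norm _ tp).
  rewrite lerD2l ler_pM2l// ler_pdivrMr// ler_peMr// sqnorm_ge0//.
have e1 : expR (- sqnorm x / (2 * t)) <= 1.
  rewrite -[leRHS]expR0 ler_expR mulNr oppr_le0 divr_ge0 ?sqnorm_ge0//.
  by rewrite mulr_ge0// ltW.
have rk_le : `|rk x eta| <= n.+1%:R * expR ((e * sqnorm eta + sqnorm x / e) / 2).
  apply: norm_le_expR; rewrite [2 * _]mulrC divfK//; exact: growth.
have /andP[w0 w_le] := wD eta.
have rw_le : `|rk x eta * wgt eta| <= n.+1%:R * B * expR (sqnorm z / 8).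
  rewrite normrM (ger0_norm w0).
  apply: le_trans (ler_pM (normr_ge0 _) w0 rk_le w_le) _.
  rewrite -!mulrA ler_pM2l// -!expRD ler_expR.
  have ez : e * (1 + 2 * gam) = 8^-1.
    by rewrite /e; field; rewrite gt_eqF//; have := gam0; lra.
  have ge0 : 0 <= gam * e by rewrite mulr_ge0// ltW.
  have h1 := ler_wpM2l (ltW e0) eta_le; have h2 := ler_wpM2l ge0 eta_le.
  have h3 : sqnorm z * (e * (1 + 2 * gam)) = sqnorm z / 8 by rewrite ez.
  by lra.
rewrite (normrM (prof _ _ _)) [X in _ * X]ger0_norm ?expR_ge0// /profile.
rewrite (normrM _ (ratio _ _ _ _)) (normrM _ (rk x eta * _)).
rewrite (normrM (_ / _)) -/A (ger0_norm (expR_ge0 (_ / _))).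
have -> : A * (n.+1%:R * B) * M * expR (- sqnorm z / 8) =
   A * 1 * (n.+1%:R * B * expR (sqnorm z / 8)) * (M * expR (sqnorm z / 4)) *
   expR (- sqnorm z / 2).
  have : expR (- sqnorm z / 8) =
    expR (sqnorm z / 8) * expR (sqnorm z / 4) * expR (- sqnorm z / 2).
    by rewrite -!expRD; congr expR; field.
  by move=> ->; ring.
have A0 : 0 <= A by exact: normr_ge0.
rewrite ler_wpM2r ?expR_ge0//; set ex := expR (_ / (2 * t)) in e1 *.
have ex0 : 0 <= A * ex by rewrite mulr_ge0// expR_ge0.
have h1 := ler_pM ex0 (normr_ge0 _) (ler_wpM2l A0 e1) rw_le.
exact: ler_pM (mulr_ge0 ex0 (normr_ge0 _)) (normr_ge0 _) h1 ratio_le.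
Qed.

Lemma cvg_rescaled (mu z : V) : mu +[t] z @[t --> +oo] --> mu.
Proof.
rewrite -[X in _ --> X]addr0 -(scale0r z); apply: cvgD; first exact: cvg_cst.
by apply: cvgZr_tmp; exact: cvg_invsqrt.
Qed.

(** The displacement of [mu] has squared norm [sqnorm z / t], so by Cauchy-Schwarz it eventually
    consumes at most half of the gap. *)
Lemma rescaled_in_cone (del : R) (mu z : V) : 0 < del ->
  (forall nu, nu \in O -> nu != mu -> 2 * del <= dot mu (mu - nu)) ->
  mu \in O ->
  \forall t \near +oo, forall nu, nu \in O -> nu != mu ->
    del <= dot (mu +[t] z) (mu - nu).
Proof.
move=> del0 gap muO; pose W := 4 * sqnorm lam.
near=> t => nu nuO numu.
have t0 : 0 < t by near: t; exact: nbhs_pinfty_gt.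
have W_le : sqnorm (mu - nu) <= W.
  have := sqnormD_le mu (- nu).
  rewrite [sqnorm (- nu)]/sqnorm dotNl dotNr opprK -/(sqnorm nu).
  by rewrite (O_norm muO) (O_norm nuO) /W; lra.
have tz : sqnorm z * W / del ^+ 2 <= t.
  by near: t; apply: nbhs_pinfty_ge; rewrite num_real.
have d2 : dot ((Num.sqrt t)^-1 *: z) (mu - nu) ^+ 2 <= del ^+ 2.
  apply: le_trans (dot_sqr_le _ _) _; rewrite (rescale_norm _ t0).
  rewrite mulrAC ler_pdivrMr// mulrC.
  rewrite ler_pdivrMr ?exprn_gt0// in tz; rewrite mulrC [leRHS]mulrC.
  by apply: le_trans tz; rewrite ler_wpM2l// sqnorm_ge0.
have : `|dot ((Num.sqrt t)^-1 *: z) (mu - nu)| <= del.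
  by rewrite -(@ler_pXn2r _ 2) ?nnegrE ?(ltW del0)// real_normK ?num_real.
rewrite ler_norml dotDl => /andP[h _].
by have := gap _ nuO numu; lra.
Unshelve. all: by end_near. Qed.

Lemma ratio_cvg0 mu z : mu \in O -> mu != lam ->
  ratio mu lam (mu +[t] z) t @[t --> +oo] --> 0.
Proof.
move=> muO mulam; have [del del0 gap] := orbit_gap.
have [s0 s01 [M M0 asym]] := radial_asymptotics rootR posR multR kerE
  O_refl O_reg muO del0.
apply/cvgrPdist_lt => e e0; near=> t; rewrite sub0r normrN.
have t0 : 0 < t by near: t; exact: nbhs_pinfty_gt.
have st : s0 <= t by near: t; apply: nbhs_pinfty_ge; rewrite num_real.
have cone : forall nu, nu \in O -> nu != mu -> del <= dot (mu +[t] z) (mu - nu).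
  by near: t; apply: rescaled_in_cone => // nu nuO; exact: gap.
have [_ h _] := asym _ cone t st.
apply: le_lt_trans (h lam lamO _) _; first by rewrite eq_sym.
rewrite ltr_pdivrMr// mulrC -ltr_pdivrMr//.
by near: t; apply: nbhs_pinfty_gt; rewrite num_real.
Unshelve. all: by end_near. Qed.

Let cvg_ratio_fixed (s : R) (T : Type) (F : set_system T) (FF : Filter F) (f : T -> V) :
  f t @[t --> F] --> lam ->
  ratio lam lam (f t) s @[t --> F] --> ratio lam lam lam s.
Proof.
move=> flam; apply: cvgM.
  apply: cvgM; first exact: cvg_cst.
  apply: (cvg_comp _ expR); last exact: continuous_expR.
  apply: cvgM; last exact: cvg_cst.
  apply: cvgN; apply: cvg_dot => //; exact: cvg_cst.
apply: (@cvg_real_kernell _ _ k Rp E lam _ _ FF (fun t => s *: f t)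
  (s *: lam) kerE).
by apply: cvgZ => //; exact: cvg_cst.
Qed.

(** Time and direction move together. Along the fixed ray through [lam] the tail bound is a Cauchy
    condition. For the moving direction the same bound, uniform in the direction, brings the time
    back to a fixed [s], where continuity in the direction suffices; hence the limit does not depend
    on [z]. *)
Lemma ratio_cvg : exists l : R, forall z,
  ratio lam lam (lam +[t] z) t @[t --> +oo] --> l.
Proof.
have [del del0 gap] := orbit_gap.
have [s0 s01 [M M0 asym]] := radial_asymptotics rootR posR multR kerE
  O_refl O_reg lamO del0.
have cone0 nu : nu \in O -> nu != lam -> del <= dot lam (lam - nu).
  by move=> nuO nulam; have := gap _ _ lamO nuO nulam; lra.
have tail (s t : R) : s0 <= s -> s <= t ->
    `|ratio lam lam lam t - ratio lam lam lam s| <= M / s.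
  by move=> ss st; have [_ _ h] := asym _ cone0 s ss; exact: h.
have small (e : R) : 0 < e -> exists2 s, s0 <= s & M / s < e.
  move=> e0; exists (s0 + M / e) => //.
    by rewrite lerDl divr_ge0// ltW.
  have Me : 0 <= M / e by rewrite divr_ge0// ltW.
  have s00 : 0 < s0 by rewrite (lt_le_trans ltr01).
  rewrite ltr_pdivrMr ?ltr_wpDr// mulrDr mulrCA divff ?gt_eqF// mulr1.
  by rewrite ltrDr mulr_gt0.
have /cvg_ex[l hl] : cvg (ratio lam lam lam t @[t --> +oo]).
  apply/cauchy_cvgP/cauchy_exP => e e0; have [s ss Ms] := small _ e0.
  exists (ratio lam lam lam s).
  suff : \forall t \near +oo, ball (ratio lam lam lam s) e (ratio lam lam lam t) by [].
  apply: (filterS _ (nbhs_pinfty_ge (num_real s))) => t st.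
  by rewrite /ball /= distrC; apply: le_lt_trans Ms; exact: tail.
exists l => z; apply/cvgrPdist_lt => e e0.
have e40 : 0 < e / 4 by rewrite divr_gt0.
have [s ss Ms] := small _ e40.
have tail_l : `|l - ratio lam lam lam s| <= e / 2.
  move/cvgrPdist_lt : hl => /(_ _ e40) hl.
  have [t [st tl]] : exists t, s <= t /\ `|l - ratio lam lam lam t| < e / 4.
    near (pinfty_nbhs R) => t; exists t; split.
      by near: t; apply: nbhs_pinfty_ge; rewrite num_real.
    by near: t.
  rewrite -(subrK (ratio lam lam lam t) l) -addrA.
  apply: le_trans (ler_normD _ _) _.
  by have := tail _ _ ss st; lra.
have cvg_z : ratio lam lam (lam +[t] z) s @[t --> +oo] --> ratio lam lam lam s.
  exact: cvg_ratio_fixed (@cvg_rescaled lam z).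
near=> t.
have st : s <= t by near: t; apply: nbhs_pinfty_ge; rewrite num_real.
have cone : forall nu, nu \in O -> nu != lam -> del <= dot (lam +[t] z) (lam - nu).
  by near: t; apply: rescaled_in_cone => // nu nuO; exact: gap.
have [_ _ /(_ t st) h1] := asym _ cone s ss.
have h2 : `|ratio lam lam lam s - ratio lam lam (lam +[t] z) s| < e / 4.
  by near: t; move/cvgrPdist_lt : (cvg_z) => /(_ _ e40).
set a := ratio _ _ _ t in h1 *; set b := ratio _ _ (_ +[t] _) s in h1 h2.
set c := ratio _ _ _ s in h2 tail_l.
have -> : l - a = (l - c) + (c - b) - (a - b) by ring.
apply: le_lt_trans (ler_normB _ _) _.
have := ler_normD (l - c) (c - b).
lra.
Unshelve. all: by end_near. Qed.

(** Regularity keeps every base [|dot a mu|] positive, where real powers are differentiable. *)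
Lemma cvg_weight mu (T : Type) (F : set_system T) (FF : Filter F) (f : T -> V) :
  mu \in O -> f t @[t --> F] --> mu -> wgt (f t) @[t --> F] --> wgt mu.
Proof.
move=> muO fmu; rewrite /dunkl_weight !big_seq.
under eq_fun do rewrite big_seq.
apply: (@cvg_big _ _ _ _ _ _ _ _ _ (fun a t => `|dot a (f t)| `^ (2 * k a))
  (fun a => `|dot a mu| `^ (2 * k a))) => [|a aR]; first exact: mul_continuous.
have amu : 0 < `|dot a mu| by rewrite normr_gt0 O_reg.
have fa : `|dot a (f t)| @[t --> F] --> `|dot a mu|.
  by apply: cvg_norm; apply: cvg_dot => //; exact: cvg_cst.
apply: (cvg_comp _ (fun s : R => s `^ (2 * k a)) fa).
have [/derivable1_diffP/differentiable_continuous + _] :=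
  is_derive_powR (2 * k a) amu.
exact.
Qed.

Lemma cvg_profile_factors mu z : mu \in O ->
  dunkl_const Rp k / rk x lam * expR (- sqnorm x / (2 * t)) *
    (rk x (mu +[t] z) * wgt (mu +[t] z)) @[t --> +oo] -->
  dunkl_const Rp k / rk x lam * (rk x mu * wgt mu).
Proof.
move=> muO; have eta_mu := @cvg_rescaled mu z.
rewrite [X in _ --> X](_ : _ = dunkl_const Rp k / rk x lam * 1 *
  (rk x mu * wgt mu)); last by rewrite mulr1.
apply: cvgM; last first.
  apply: cvgM; last exact: cvg_weight.
  exact: (cvg_real_kernelr rootR posR multR kerE).
apply: cvgM; first exact: cvg_cst.
rewrite -[X in _ --> X]expR0.
apply: (cvg_comp _ expR); last exact: continuous_expR.
have -> : 0 = - sqnorm x / 2 * (0 * 0) :> R by rewrite !mulr0.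
have : - sqnorm x / 2 * ((Num.sqrt t)^-1 * (Num.sqrt t)^-1) @[t --> +oo] -->
    - sqnorm x / 2 * (0 * 0 : R).
  by apply: cvgM; [exact: cvg_cst|apply: cvgM; exact: cvg_invsqrt].
apply: cvg_trans; apply: near_eq_cvg; near=> t.
have t0 : 0 < t by near: t; exact: nbhs_pinfty_gt.
by rewrite -invfM -expr2 sqr_sqrtr ?ltW// -mulrA -invfM.
Unshelve. all: by end_near. Qed.

Lemma profile_cvg : exists l : R, forall z,
  prof t lam (lam +[t] z) @[t --> +oo] --> l.
Proof.
have [l hl] := ratio_cvg.
exists (dunkl_const Rp k / rk x lam * (rk x lam * wgt lam) * l) => z.
by apply: cvgM (hl z); exact: cvg_profile_factors.
Qed.

Lemma profile_cvg0 mu z : mu \in O -> mu != lam ->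
  prof t mu (mu +[t] z) @[t --> +oo] --> 0.
Proof.
move=> muO mulam.
rewrite -(mulr0 (dunkl_const Rp k / rk x lam * (rk x mu * wgt mu))).
by apply: cvgM; [exact: cvg_profile_factors|exact: ratio_cvg0].
Qed.

Lemma rescaled_dominant (z : V) : \forall t \near +oo, forall nu, nu \in O ->
  dot (lam +[t] z) nu <= dot (lam +[t] z) lam.
Proof.
have [del del0 gap] := orbit_gap.
have : \forall t \near +oo, forall nu, nu \in O -> nu != lam ->
    del <= dot (lam +[t] z) (lam - nu).
  by apply: rescaled_in_cone => // nu nuO; exact: gap.
apply: filterS => t cone nu nuO; have [->//|nulam] := eqVneq nu lam.
by have := cone nu nuO nulam; rewrite dotBr; lra.
Qed.

End profile_estimates.
(** * The law of the process and its limit *)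

Section law.
Context {R : realType} {N : nat}.
Local Notation V := 'rV[R]_N.
Local Notation C := R[i].
Local Notation VC := 'rV[C]_N.
Variables (Rt Rp : {fset V}) (k : V -> R) (E : VC -> VC -> C^o).
Hypothesis rootR : root_system Rt.
Hypothesis posR : positive_subsystem Rt Rp.
Hypothesis multR : multiplicity_function Rt k.
Hypothesis kerE : is_dunkl_kernel Rp k E.
Local Notation rk := (real_kernel E).
Local Notation mu := (lebesgue_rV R N).
Variables (lam x : V).
Local Notation dens t := (dunkl_density Rp k E lam t x).

Let measurable_rkl y : measurable_fun setT (fun v : V => rk v y).
Proof.
apply: continuous_measurable_rV => v.
exact: (@cvg_real_kernell _ _ k Rp E y _ _ (nbhs_filter v) id v kerE).
Qed.

Let measurable_rkr y c : measurable_fun setT (fun v : V => rk y (c *: v)).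
Proof.
apply: continuous_measurable_rV => v.
apply: (@cvg_real_kernelr _ _ _ _ _ _ rootR posR multR kerE y (c *: v) _ _
  (nbhs_filter v)).
by apply: (@cvgZ _ _ _ _ (nbhs_filter v)); [exact: (@cvg_cst _ _ _ _ (nbhs_filter v))|exact: cvg_id].
Qed.

Lemma measurable_dunkl_density (t : R) : measurable_fun setT (dens t).
Proof.
have mw : measurable_fun setT (dunkl_weight Rp k).
  apply: measurable_prod => a _.
  apply: (measurableT_comp (measurable_powR (2 * k a))).
  apply: measurableT_comp => //; apply: continuous_measurable_rV.
  exact: continuous_dotr.
apply: measurable_funM => //; apply: measurable_funM.
  apply: measurable_funM => //; apply: measurableT_comp => //.
  apply: measurable_funM => //; apply: measurableT_comp => //.
  apply: measurable_funD => //; apply: continuous_measurable_rV.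
  exact: continuous_sqnorm.
apply: measurable_funM => //; apply: measurable_funM; last exact: measurable_rkl.
exact: measurable_rkr.
Qed.

Definition pos_density (t : R) (y : V) : R := Num.max (dens t y) 0.

Lemma pos_density_ge0 t y : 0 <= pos_density t y.
Proof. by rewrite le_max lexx orbT. Qed.

Lemma measurable_pos_density t : measurable_fun setT (pos_density t).
Proof.
by apply: measurable_maxr => //; exact: measurable_dunkl_density.
Qed.

Context {d : measure_display} {T : measurableType d}.
Variables (P : probability T R) (X : R -> T -> V).
Hypothesis procX : dunkl_process Rp k E lam x P X.

(** The Markov property is applied at time 0 to the event [X 0 = x], which has probability 1 and on
    which the transition probability is constant. *)
Lemma dunkl_process_law (t : R) A : 0 < t -> measurable A ->
  P (X t @^-1` A) = dunkl_transition Rp k E lam t x A.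
Proof.
move=> t0 mA; pose B := X 0 @^-1` [set x].
have mx : measurable [set x].
  have m0 : measurable_fun setT (fun v : V => sqnorm (v - x)).
    apply: continuous_measurable_rV => v.
    have : v - x @[v --> v] --> v - x.
      apply: (@cvgB _ _ _ _ (nbhs_filter v)); first exact: cvg_id.
      exact: (@cvg_cst _ _ _ _ (nbhs_filter v)).
    move=> h; exact: (@cvg_dot _ _ _ _ (nbhs_filter v) _ _ _ _ h h).
  have := m0 measurableT _ (measurable_set1 0); rewrite setTI.
  congr measurable; apply/seteqP; split=> v /=.
    by move=> /eqP; rewrite sqnorm_eq0 subr_eq0 => /eqP.
  by move=> ->; rewrite subrr /sqnorm dot0l.
have mX s : 0 <= s -> measurable_fun setT (X s) by exact: (dunkl_measurable procX).
have mB : measurable B by rewrite -[B]setTI; apply: mX.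
have mXA : measurable (X t @^-1` A).
  by rewrite -[X in measurable X]setTI; apply: mX => //; exact: ltW.
have PBC : P (~` B) = 0%E.
  by apply/negligibleP; [exact: measurableC|exact: (dunkl_start procX)].
have PB : P B = 1%E.
  by rewrite -[B]setCK probability_setC ?PBC ?sube0//; exact: measurableC.
have FB : natural_filtration X 0 B.
  by apply: sub_sigma_algebra; exists 0, [set x]; rewrite lexx.
have := dunkl_markov procX (lexx 0) t0 mA FB; rewrite add0r.
have -> : P (B `&` X t @^-1` A) = P (X t @^-1` A).
  rewrite [in LHS]setIC [RHS](measureDI P mXA mB).
  rewrite [X in (X + _)%E](_ : _ = 0%E) ?add0e//.
  apply: (@subset_measure0 _ _ _ P _ (~` B)) => //.
  - exact: measurableD.
  - exact: measurableC.
move=> ->; transitivity (\int[P]_(w in B) dunkl_transition Rp k E lam t x A)%E.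
  by apply: eq_integral => w /set_mem /= ->.
by rewrite integral_cst// [X in (_ * X)%E](_ : _ = 1%E) ?mule1.
Qed.

(* The kernel [E] need not be shown nonnegative: the integral of the density
   over the set where it is negative is a probability, hence zero. *)
Lemma pos_density_law (t : R) A : 0 < t -> measurable A ->
  P (X t @^-1` A) = (\int[mu]_(y in A) (pos_density t y)%:E)%E.
Proof.
move=> t0 mA; have md := measurable_dunkl_density t.
have mX : measurable_fun setT (X t) by exact: (dunkl_measurable procX (ltW t0)).
pose D := [set y | dens t y < 0].
have mD : measurable D.
  have := md measurableT _ (measurable_itv `]-oo, 0[); rewrite setTI.
  by congr measurable; apply/seteqP; split=> y /=; rewrite in_itv.
have mXp B : measurable B -> measurable (X t @^-1` B).
  by move=> mB; rewrite -[X in measurable X]setTI; exact: mX.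
have PD0 : P (X t @^-1` D) = 0%E.
  apply/eqP; rewrite eq_le measure_ge0 andbT dunkl_process_law//.
  rewrite /dunkl_transition integralE [X in (X - _)%E]integral0_eq.
    by rewrite sub0e oppe_le0 integral_ge0.
  move=> y Dy; rewrite funeposE; apply/max_idPr.
  by rewrite lee_fin ltW.
rewrite (measureDI P (mXp _ mA) (mXp _ mD)).
rewrite [X in (_ + X)%E](_ : _ = 0%E); last first.
  apply: (@subset_measure0 _ _ _ P _ (X t @^-1` D)) => //.
  - by apply: measurableI; exact: mXp.
  - exact: mXp.
transitivity (P (X t @^-1` (A `\` D))); first by rewrite adde0.
rewrite dunkl_process_law//; last exact: measurableD.
rewrite /dunkl_transition integral_mkcond [RHS]integral_mkcond.
apply: eq_integral => y _; rewrite !patchE /pos_density.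
case: ifPn => [/set_mem[Ay nDy]|yAD].
  rewrite mem_set//; congr EFin; apply/esym/max_idPl.
  by rewrite leNgt; apply/negP.
case: ifPn => // yA; congr EFin; apply/esym/max_idPr.
case: (leP (dens t y) 0) => // dy; case/negP: yAD; apply/mem_set; split.
  exact: set_mem.
by rewrite /D /= => /lt_trans /(_ dy); rewrite ltxx.
Qed.

Lemma integral_dunkl_process (t : R) (g : V -> \bar R) : 0 < t ->
  measurable_fun setT g -> (forall y, 0 <= g y)%E ->
  (\int[P]_w g (X t w) = \int[mu]_y (g y * (pos_density t y)%:E))%E.
Proof.
move=> t0 mg g0.
have mX : measurable_fun setT (X t) by exact: (dunkl_measurable procX (ltW t0)).
pose nu := measure_function_pushforward__canonical__measure_function_Measure P mX.
rewrite -(@ge0_integral_density _ _ _ mu nu (pos_density t))//.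
- by rewrite ge0_integral_pushforward//= preimage_setT.
- exact: measurable_pos_density.
- exact: pos_density_ge0.
- by move=> A mA; exact: pos_density_law.
Qed.

End law.

(** * Integrals over the cones of dominance *)

Section slices.
Context {R : realType} {N : nat}.
Local Notation V := 'rV[R]_N.
Local Notation C := R[i].
Local Notation VC := 'rV[C]_N.
Variables (Rt Rp : {fset V}) (k : V -> R) (E : VC -> VC -> C^o).
Hypothesis rootR : root_system Rt.
Hypothesis posR : positive_subsystem Rt Rp.
Hypothesis multR : multiplicity_function Rt k.
Hypothesis kerE : is_dunkl_kernel Rp k E.
Local Notation muN := (lebesgue_rV R N).
Variables (lam x : V) (O : {fset V}).
Hypothesis O_refl : forall a mu, a \in Rp -> mu \in O -> reflection a mu \in O.
Hypothesis O_reg : forall a mu, a \in Rp -> mu \in O -> dot a mu != 0.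
Hypothesis O_norm : forall mu, mu \in O -> sqnorm mu = sqnorm lam.
Hypothesis lamO : lam \in O.
Local Notation prof := (profile Rp k E lam x).
Local Notation "mu '+[' t ']' z" := (mu + (Num.sqrt (t : R))^-1 *: z)
  (at level 50, t at level 200).
Local Notation fp t := (pos_density Rp k E lam x t).

(** Nonstrict inequalities make the cones cover the space. Overlaps are harmless: the cones other
    than that of [lam] serve only to bound its complement from above. *)
Definition dominant_cone (mu : V) : set V :=
  [set y | forall nu, nu \in O -> dot y nu <= dot y mu].

Lemma measurable_dominant_cone mu : measurable (dominant_cone mu).
Proof.
have -> : dominant_cone mu = \bigcap_(nu in [set` O]) [set y | dot (nu - mu) y <= 0].
  apply/seteqP; split=> y h nu /= nuO; last first.
    by have := h nu nuO; rewrite /= dotC dotBr subr_le0.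
  by rewrite dotC dotBr subr_le0; exact: h.
apply: fin_bigcap_measurable => // nu _.
have := continuous_measurable_rV (@continuous_dotr R N (nu - mu)).
move=> /(_ measurableT _ (measurable_itv `]-oo, 0])); rewrite setTI.
by congr measurable; apply/seteqP; split=> y /=; rewrite in_itv.
Qed.

Lemma dominant_coneZ (t : R) mu eta : 0 < t ->
  dominant_cone mu (t *: eta) <-> dominant_cone mu eta.
Proof.
move=> t0; split=> h nu nuO; have := h nu nuO; rewrite !dotZl ler_pM2l//.
Qed.

Lemma dominant_cone_cover y : exists2 mu, mu \in O & dominant_cone mu y.
Proof.
have argmax (s : seq V) : s != [::] ->
    exists2 mu, mu \in s & forall nu, nu \in s -> dot y nu <= dot y mu.
  elim: s => // a s IH _; have [->|/IH[m ms hm]] := eqVneq s [::].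
    by exists a; rewrite ?mem_head// => nu; rewrite mem_seq1 => /eqP ->.
  have [am|ma] := leP (dot y a) (dot y m).
    by exists m; rewrite ?inE ?ms ?orbT// => nu; rewrite inE => /predU1P[->|/hm].
  exists a; rewrite ?mem_head// => nu; rewrite inE => /predU1P[->//|/hm num].
  exact: le_trans (ltW ma).
have [|mu muO h] := argmax (O : seq V); last by exists mu.
by apply: contraTneq lamO; rewrite -[lam \in O]/(lam \in (O : seq V)) => ->.
Qed.

Lemma rescaleE (t : R) (mu z : V) : 0 < t ->
  t *: mu + Num.sqrt t *: z = t *: (mu +[t] z).
Proof.
move=> t0; rewrite scalerDr scalerA; congr (_ + _ *: _).
by rewrite -[X in X / _](sqr_sqrtr (ltW t0)) expr2 mulfK// gt_eqF// sqrtr_gt0.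
Qed.

(* Dominated convergence in the chart [y = t mu + sqrt t z], restricted to the
   cone where [mu] is the dominant point of the orbit. *)
Lemma slice_cvg mu (h : R -> V -> R) (M : R) (G : V -> R) : mu \in O ->
  (forall t y, 0 <= h t y <= M) ->
  (forall t, 0 < t -> measurable_fun setT (h t)) -> measurable_fun setT G ->
  (forall z, h t (t *: mu + Num.sqrt t *: z) *
     \1_(dominant_cone mu) (t *: mu + Num.sqrt t *: z) *
     Num.max (prof t mu (mu +[t] z)) 0 @[t --> +oo] --> G z) ->
  \int[muN]_y (h t y * \1_(dominant_cone mu) y * fp t y) @[t --> +oo] -->
  \int[muN]_z (G z * expR (- sqnorm z / 2)).
Proof.
move=> muO h0M mh mG hG.
have [K' [t0 t01 HK']] := profile_bound rootR posR multR kerE x O_refl O_reg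
  O_norm lamO muO.
pose K := Num.max K' 0.
have HK (t : R) z : t0 <= t ->
    (forall nu, nu \in O -> dot (mu +[t] z) nu <= dot (mu +[t] z) mu) ->
    `|prof t mu (mu +[t] z) * expR (- sqnorm z / 2)| <= K * expR (- sqnorm z / 8).
  move=> tt dom; apply: le_trans (HK' t z tt dom) _.
  by rewrite ler_wpM2r ?expR_ge0// le_max lexx.
pose F (t : R) (z : V) : R := h t (t *: mu + Num.sqrt t *: z) *
  \1_(dominant_cone mu) (t *: mu + Num.sqrt t *: z) *
  Num.max (prof t mu (mu +[t] z)) 0 * expR (- sqnorm z / 2).
pose H (t : R) (y : V) := h t y * \1_(dominant_cone mu) y * fp t y.
have mcone := measurable_dominant_cone mu.
have mH (t : R) : 0 < t -> measurable_fun setT (H t).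
  move=> tp; apply: measurable_funM; last first.
    exact: (measurable_pos_density rootR posR multR kerE).
  by apply: measurable_funM; [exact: mh|exact: measurable_indic].
have maff (t : R) : measurable_fun setT (fun z : V => t *: mu + Num.sqrt t *: z).
  apply: measurable_fun_rV => j; under eq_fun do rewrite !mxE.
  by apply: measurable_funD => //; apply: measurable_funM => //; exact: measurable_coord.
have FE (t : R) z : 0 < t ->
    F t z = H t (t *: mu + Num.sqrt t *: z) * Num.sqrt t ^+ N.
  move=> tp; rewrite /F /H -mulrA -[RHS]mulrA; congr (_ * _).
  have s0 : 0 <= Num.sqrt t ^+ N by rewrite exprn_ge0.
  rewrite /pos_density [RHS]maxr_pMl// mul0r (dunkl_density_profile kerE _ _ tp).
    by rewrite maxr_pMl ?expR_ge0// mul0r.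
  exact: O_norm.
have mF (t : R) : 0 < t -> measurable_fun setT (F t).
  move=> tp; rewrite (_ : F t = fun z =>
      H t (t *: mu + Num.sqrt t *: z) * Num.sqrt t ^+ N); last first.
    by apply/funext => z; exact: FE.
  apply: measurable_funM => //.
  exact: (measurableT_comp (mH t tp) (maff t)).
have intF (t : R) : 0 < t -> \int[muN]_y H t y = \int[muN]_z F t z.
  move=> tp; rewrite /Rintegral; congr fine.
  have st : 0 < Num.sqrt t by rewrite sqrtr_gt0.
  rewrite (@change_variables_lebesgue_rV R N (t *: mu) _ st).
  - by apply: eq_integral => z _; rewrite -EFinM FE.
  - by apply/measurable_EFinP; exact: mH.
  - move=> y; rewrite lee_fin /H mulr_ge0 ?pos_density_ge0//.
    by rewrite mulr_ge0//; have /andP[] := h0M t y.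
have M0 : 0 <= M by have /andP[h0 hM] := h0M 0 0; exact: le_trans hM.
have Fbound (t : R) z : t0 <= t -> `|F t z| <= M * K * expR (- sqnorm z / 8).
  move=> tt; have tp : 0 < t by rewrite (lt_le_trans _ tt)// (lt_le_trans ltr01).
  have K0 : 0 <= K * expR (- sqnorm z / 8).
    by rewrite mulr_ge0 ?expR_ge0// le_max lexx orbT.
  rewrite /F indicE; have [/set_mem hcone|ncone] := boolP (_ \in _); last first.
    by rewrite mulr0 !mul0r normr0 -mulrA mulr_ge0.
  rewrite rescaleE// in hcone; move/(dominant_coneZ _ _ tp) : hcone => dom.
  have := HK t z tt dom; rewrite normrM => HKz.
  rewrite mulr1 -!mulrA normrM; apply: ler_pM => //.
    by have /andP[? ?] := h0M t (t *: mu + Num.sqrt t *: z); rewrite ger0_norm.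
  apply: le_trans HKz; rewrite normrM ler_wpM2r//.
  case: (leP (prof t mu (mu +[t] z)) 0) => hp; rewrite ?normr0//.
(* A sequence tending to infinity may start below [t0], outside the range of the domination;
   truncating the time from below changes nothing for large [t]. *)
suff : \int[muN]_z F (Num.max t t0) z @[t --> +oo] -->
    \int[muN]_z (G z * expR (- sqnorm z / 2)).
  apply: cvg_trans; apply: near_eq_cvg; near=> t.
  have tt : t0 <= t by near: t; apply: nbhs_pinfty_ge; rewrite num_real.
  have tp : 0 < t by rewrite (lt_le_trans _ tt)// (lt_le_trans ltr01).
  by rewrite (max_idPl tt) intF.
apply/cvg_pinftyP => u uy.
pose v n := Num.max (u n) t0.
have vt n : t0 <= v n by rewrite le_max lexx orbT.
have v0 n : 0 < v n by rewrite (lt_le_trans _ (vt n))// (lt_le_trans ltr01).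
have vy : v n @[n --> \oo] --> +oo.
  apply/cvgryPge => A; have /cvgryPge /(_ A) := uy.
  by apply: filterS => n An; rewrite le_max An.
have [] := @dominated_convergence _ _ R muN setT measurableT
  (fun n z => (F (v n) z)%:E) (fun z => (G z * expR (- sqnorm z / 2))%:E)
  (fun z => (M * K * expR (- sqnorm z / 8))%:E).
- by move=> n; apply/measurable_EFinP; exact: mF.
- apply/measurable_EFinP; apply: measurable_funM => //.
  apply: measurableT_comp => //; apply: measurable_funM => //.
  apply: measurableT_comp => //; apply: continuous_measurable_rV.
  exact: continuous_sqnorm.
- apply: aeW => z _ /=; apply: cvg_EFin; first by near=> n.
  apply: cvgM; last exact: cvg_cst.
  exact: (cvg_comp v _ vy (hG z)).
- have := integrableZl measurableT (M * K) (@integrable_gauss R N).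
  by apply: eq_integrable => // z _; rewrite -EFinM.
- by apply: aeW => z n _ /=; rewrite lee_fin Fbound.
move=> iG _ cv.
have fG : (\int[muN]_z (G z * expR (- sqnorm z / 2))%:E)%E \is a fin_num.
  exact: integrable_fin_num.
have := cv; rewrite -(fineK fG) => /fine_cvg; exact.
Unshelve. all: by end_near. Qed.
End slices.

(** * Limits of expectations *)

Lemma maxr0E (R : realType) (u : R) : Num.max u 0 = (u + `|u|) / 2.
Proof. by case: (ger0P u) => h; lra. Qed.

Section limit_law.
Context {R : realType} {N : nat}.
Local Notation V := 'rV[R]_N.
Local Notation C := R[i].
Local Notation VC := 'rV[C]_N.
Variables (Rt Rp : {fset V}) (k : V -> R) (E : VC -> VC -> C^o).
Hypothesis rootR : root_system Rt.
Hypothesis posR : positive_subsystem Rt Rp.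
Hypothesis multR : multiplicity_function Rt k.
Hypothesis kerE : is_dunkl_kernel Rp k E.
Local Notation muN := (lebesgue_rV R N).
Local Notation nuN := (std_normal_rV R N).
Variables (lam x : V) (O : {fset V}).
Hypothesis O_refl : forall a mu, a \in Rp -> mu \in O -> reflection a mu \in O.
Hypothesis O_reg : forall a mu, a \in Rp -> mu \in O -> dot a mu != 0.
Hypothesis O_norm : forall mu, mu \in O -> sqnorm mu = sqnorm lam.
Hypothesis lamO : lam \in O.
Context {d : measure_display} {T : measurableType d}.
Variables (P : probability T R) (X : R -> T -> V).
Hypothesis procX : dunkl_process Rp k E lam x P X.
Local Notation fp t := (pos_density Rp k E lam x t).
Local Notation cone mu := (dominant_cone O mu).
Local Notation Y := (fun (t : R) w => (Num.sqrt t)^-1 *: (X t w - t *: lam)).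
Local Notation recenter := (fun (t : R) (y : V) => (Num.sqrt t)^-1 *: (y - t *: lam)).

Lemma measurable_recenter (t : R) : measurable_fun setT (recenter t).
Proof.
apply: measurable_fun_rV => j; under eq_fun do rewrite !mxE.
apply: measurable_funM => //; apply: measurable_funB => //.
exact: measurable_coord.
Qed.

Let mfp (t : R) : measurable_fun setT (fp t).
Proof. exact: (measurable_pos_density rootR posR multR kerE). Qed.

Let ifp (t : R) : 0 < t -> muN.-integrable setT (EFin \o fp t).
Proof.
move=> t0; apply/integrableP; split; first by apply/measurable_EFinP.
under eq_integral do rewrite gee0_abs ?lee_fin ?pos_density_ge0//.
rewrite -(pos_density_law rootR posR multR kerE procX t0 measurableT).
by rewrite preimage_setT probability_setT ltry.
Qed.

Let ifpM (t M : R) (h : V -> R) : 0 < t -> measurable_fun setT h ->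
  (forall y, 0 <= h y <= M) ->
  muN.-integrable setT (EFin \o (fun y => h y * fp t y)).
Proof.
move=> t0 mh hM.
apply: (le_integrable measurableT _ _ (integrableZl measurableT M (ifp t0))).
  by apply/measurable_EFinP; exact: measurable_funM.
move=> y _ /=; rewrite lee_fin normrM [leRHS]normrM.
rewrite ler_wpM2r//; have /andP[h0 h1] := hM y.
by rewrite !ger0_norm// (le_trans h0).
Qed.

Lemma RintegralY (g : V -> R) (t : R) : 0 < t -> measurable_fun setT g ->
  (forall y, 0 <= g y) ->
  \int[P]_w g (Y t w) = \int[muN]_y (g (recenter t y) * fp t y).
Proof.
move=> t0 mg g0; rewrite /Rintegral; congr fine.
have mh : measurable_fun setT (fun y => (g (recenter t y))%:E).
  by apply/measurable_EFinP; exact: (measurableT_comp mg (measurable_recenter t)).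
rewrite (integral_dunkl_process rootR posR multR kerE procX t0 mh)//.
by move=> y; rewrite lee_fin.
Qed.

Let off_cone mu : mu \in O -> mu != lam ->
  \int[muN]_y (1 * \1_(cone mu) y * fp t y) @[t --> +oo] --> 0.
Proof.
move=> muO mulam.
have := @slice_cvg _ _ _ _ _ _ rootR posR multR kerE lam x O O_refl O_reg O_norm
  lamO mu (fun _ _ => 1) 1 (fun=> 0) muO.
rewrite [X in _ -> _ -> _ -> _ -> _ --> X](_ : _ = 0); last first.
  under eq_Rintegral do rewrite mul0r.
  by rewrite Rintegral_cst// mul0r.
apply => //; first by move=> t y; rewrite ler01 lexx.
move=> z; have /cvgrPdist_lt h0 := profile_cvg0 rootR posR multR kerE x O_refl
  O_reg O_norm lamO z muO mulam.
apply/cvgrPdist_lt => e e0; near=> t.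
have : `|0 - profile Rp k E lam x t mu (mu + (Num.sqrt t)^-1 *: z)| < e.
  by near: t; exact: h0.
rewrite !sub0r !normrN mul1r; apply: le_lt_trans.
rewrite indicE normrM; case: (_ \in _); last by rewrite normr0 mul0r.
rewrite normr1 mul1r; case: (leP (profile Rp k E lam x t mu _) 0) => // _.
by rewrite normr0.
Unshelve. all: by end_near. Qed.

(** The constant is quantified before [g]: being common to all test functions, it can later be read
    off from [g = 1]. *)
Lemma expectation_cvg : exists c : R, forall (g : V -> R) (M : R),
  continuous g -> (forall y, 0 <= g y <= M) ->
  \int[P]_w g (Y t w) @[t --> +oo] --> c * \int[nuN]_y g y.
Proof.
have [l hl] := profile_cvg rootR posR multR kerE x O_refl O_reg O_norm lamO.
(* [Num.max l 0] is the limit of the truncated profile; dividing by the peak converts the plain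
   Gaussian integral into one against the normal law. *)
exists (Num.max l 0 / normal_peak (1 : R) ^+ N) => g M cg gM.
have mg : measurable_fun setT g by exact: continuous_measurable_rV.
have M0 : 0 <= M by have /andP[h0 hM] := gM 0; exact: le_trans hM.
have g0 y : 0 <= g y by have /andP[] := gM y.
have mrec t : measurable_fun setT (fun y => g (recenter t y)).
  exact: (measurableT_comp mg (measurable_recenter t)).
have mcone mu : measurable (cone mu) by exact: measurable_dominant_cone.
pose a t := \int[muN]_y (g (recenter t y) * \1_(cone lam) y * fp t y).
pose b t := \int[muN]_y (g (recenter t y) * \1_(~` cone lam) y * fp t y).
have iM t (h : V -> R) : 0 < t -> measurable_fun setT h ->
    (forall y, 0 <= h y <= M) ->
    muN.-integrable setT (EFin \o (fun y => h y * fp t y)).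
  by move=> t0; exact: ifpM.
have ind_le (A : set V) t y : 0 <= g (recenter t y) * \1_A y <= M.
  rewrite mulr_ge0//=; have /andP[_] := gM (recenter t y).
  apply: le_trans; rewrite ler_piMr// indicE; by case: (_ \in _).
have split_ab : \forall t \near +oo, \int[P]_w g (Y t w) = a t + b t.
  near=> t; have t0 : 0 < t by near: t; exact: nbhs_pinfty_gt.
  rewrite RintegralY// /a /b -RintegralD//; last 2 first.
  - by apply: iM => //; apply: measurable_funM => //; exact: measurable_indic.
  - apply: iM => //; apply: measurable_funM => //; apply: measurable_indic.
    exact: measurableC.
  apply: eq_Rintegral => y _; rewrite -mulrDl -mulrDr; congr (_ * _).
  rewrite !indicE in_setC; case: (_ \in _); by rewrite /= ?addr0 ?add0r mulr1.
have cvg_a : a t @[t --> +oo] -->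
    Num.max l 0 / normal_peak (1 : R) ^+ N * \int[nuN]_y g y.
  have p0 : normal_peak (1 : R) ^+ N != 0.
    by rewrite expf_neq0// gt_eqF// normal_peak_gt0// oner_eq0.
  have h0M t y : 0 <= g (recenter t y) <= M by exact: gM.
  have mG : measurable_fun setT (fun z => g z * Num.max l 0).
    exact: measurable_funM.
  have -> : Num.max l 0 / normal_peak (1 : R) ^+ N * \int[nuN]_y g y =
      \int[muN]_z (g z * Num.max l 0 * expR (- sqnorm z / 2)).
    have mgE : measurable_fun setT (fun y => (g y)%:E) by exact/measurable_EFinP.
    have gE0 y : (0 <= (g y)%:E)%E by rewrite lee_fin.
    rewrite [\int[nuN]_y g y]/Rintegral.
    rewrite (@ge0_integral_power_normal R N 1 _ (oner_neq0 _) mgE gE0).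
    rewrite -[fine _]/(\int[muN]_y (g y * (normal_peak 1 ^+ N *
      expR (- sqnorm y / (1 ^+ 2 *+ 2))))) -RintegralZl//.
      apply: eq_Rintegral => z _; rewrite expr1n.
      by set e := expR _; field.
    have mexp (c : R) : measurable_fun setT (fun v : V => expR (- sqnorm v / c)).
      apply: measurableT_comp => //; apply: measurable_funM => //.
      apply: measurableT_comp => //; apply: continuous_measurable_rV.
      exact: continuous_sqnorm.
    apply: (le_integrable measurableT _ _ (integrableZl measurableT
      (M * normal_peak (1 : R) ^+ N) (@integrable_gauss R N))).
      apply/measurable_EFinP; apply: measurable_funM => //.
      exact: measurable_funM.
    move=> v _ /=; rewrite lee_fin mulrA.
    have pN0 : 0 <= normal_peak (1 : R) ^+ N by rewrite exprn_ge0// normal_peak_ge0.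
    rewrite !ger0_norm ?mulr_ge0 ?expR_ge0//.
    apply: ler_pM; rewrite ?mulr_ge0 ?expR_ge0//.
      by rewrite ler_wpM2r//; have /andP[] := gM v.
    rewrite ler_expR expr1n !mulNr lerN2.
    by have := sqnorm_ge0 v; lra.
  apply: (@slice_cvg _ _ _ _ _ _ rootR posR multR kerE lam x O O_refl O_reg
    O_norm lamO lam (fun t y => g (recenter t y)) M _ lamO h0M
    (fun t _ => mrec t) mG) => z.
  have : g z * 1 * Num.max (profile Rp k E lam x t lam (lam + (Num.sqrt t)^-1 *: z)) 0
      @[t --> +oo] --> g z * 1 * Num.max l 0.
    apply: cvgM; first exact: cvg_cst.
    rewrite maxr0E; under eq_fun do rewrite maxr0E.
    apply: cvgM; last exact: cvg_cst.
    by apply: cvgD; [exact: hl|apply: cvg_norm; exact: hl].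
  rewrite mulr1; apply: cvg_trans; apply: near_eq_cvg.
  near=> t; have t0 : 0 < t by near: t; exact: nbhs_pinfty_gt.
  (* For fixed [z] the point of the chart eventually lies in the cone of [lam], so the indicator is
     1, and recentring undoes the chart. *)
  rewrite indicE mem_set; last first.
    rewrite rescaleE//; apply/dominant_coneZ => //.
    near: t; exact: (rescaled_dominant O_norm lamO).
  rewrite /= [t *: lam + _]addrC addrK scalerA mulVf ?scale1r ?mulr1//.
  by rewrite gt_eqF// sqrtr_gt0.
have cvg_b : b t @[t --> +oo] --> 0.
  pose j mu (t : R) := \int[muN]_y (1 * \1_(cone mu) y * fp t y).
  pose O' := [seq mu <- O | mu != lam].
  have O'P mu : mu \in O' -> mu \in O /\ mu != lam.
    by rewrite mem_filter => /andP[].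
  have js : M * \sum_(mu <- O') j mu t @[t --> +oo] --> 0.
    rewrite -[X in _ --> X](mulr0 M); apply: cvgM; first exact: cvg_cst.
    elim: O' O'P => [_|mu s IH sP].
      by under eq_fun do rewrite big_nil; exact: cvg_cst.
    have [muO mulam] := sP mu (mem_head _ _).
    have sP' nu : nu \in s -> nu \in O /\ nu != lam.
      by move=> nus; apply: sP; rewrite inE nus orbT.
    have js : j mu t + \sum_(nu <- s) j nu t @[t --> +oo] --> (0 + 0 : R).
      by apply: cvgD; [exact: off_cone|exact: IH].
    by rewrite addr0 in js; under eq_fun do rewrite big_cons; exact: js.
  have ij mu t : 0 < t -> muN.-integrable setT
      (EFin \o (fun y => 1 * \1_(cone mu) y * fp t y)).
    move=> t0; apply: (@ifpM t 1 (fun y => 1 * \1_(cone mu) y)) => //.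
      by apply: measurable_funM => //; exact: measurable_indic.
    by move=> y; rewrite mul1r indicE; case: (_ \in _); rewrite /= ?lexx ?ler01.
  have sum_j t (s : seq V) : 0 < t ->
      muN.-integrable setT (EFin \o (fun y =>
        \sum_(mu <- s) (1 * \1_(cone mu) y * fp t y))) /\
      \int[muN]_y (\sum_(mu <- s) (1 * \1_(cone mu) y * fp t y)) =
      \sum_(mu <- s) j mu t.
    move=> t0; elim: s => [|mu s [IH1 IH2]].
      split; first by apply: eq_integrable (integrable0 _ _) => // y _;
        rewrite /= big_nil.
      by under eq_Rintegral do rewrite big_nil; rewrite Rintegral_cst// mul0r big_nil.
    split; first by apply: eq_integrable (integrableD measurableT (ij mu t t0) IH1)
      => // y _; rewrite /= big_cons EFinD.
    under eq_Rintegral do rewrite big_cons.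
    by rewrite RintegralD ?IH2 ?big_cons//; exact: ij.
  (* Off the cone of [lam] every point lies in another cone, so [b t] is at most [M] times the
     summed masses of those cones. *)
  apply: (squeeze_cvgr _ (cvg_cst 0) js); near=> t.
  have t0 : 0 < t by near: t; exact: nbhs_pinfty_gt.
  apply/andP; split.
    apply: Rintegral_ge0 => y _; rewrite mulr_ge0 ?pos_density_ge0//.
    by have /andP[] := ind_le (~` cone lam) t y.
  have [iS <-] := sum_j t O' t0; rewrite -RintegralZl//; apply: le_Rintegral => //.
  - apply: iM => //; apply: measurable_funM => //; apply: measurable_indic.
    exact: measurableC.
  - by apply: eq_integrable (integrableZl measurableT M iS) => // y _; rewrite /= EFinM.
  - move=> y _; rewrite -mulr_suml mulrA ler_wpM2r ?pos_density_ge0//.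
    have ind0 mu : 0 <= 1 * \1_(cone mu) y :> R.
      by rewrite mul1r indicE; case: (_ \in _).
    rewrite indicE in_setC.
    have [ylam|ylam] := boolP (y \in cone lam).
      by rewrite mulr0 mulr_ge0// sumr_ge0.
    have [mu muO ymu] := dominant_cone_cover lamO y.
    have muO' : mu \in O'.
      rewrite mem_filter muO andbT; apply: contraNneq ylam => <-.
      exact: mem_set.
    rewrite mulr1; apply: le_trans (_ : M <= _).
      by have /andP[] := gM (recenter t y).
    rewrite ler_peMr//; apply: le_trans (_ : 1 * \1_(cone mu) y <= _).
      by rewrite mul1r indicE mem_set.
    by rewrite (big_rem mu muO') /= lerDl sumr_ge0.
rewrite -[X in _ --> X]addr0; apply: cvg_trans (cvgD cvg_a cvg_b).
by apply: near_eq_cvg; apply: filterS split_ab => t ->.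
Unshelve. all: by end_near. Qed.

End limit_law.

(** * Normalisation and passage to signed test functions *)

Lemma Rintegral_shift {d : measure_display} {T : measurableType d}
    {R : realType} (m : {measure set T -> \bar R}) (g : T -> R) (M : R) :
  m setT = 1%E -> measurable_fun setT g -> (forall y, `|g y| <= M) ->
  \int[m]_y (g y + M) = \int[m]_y g y + M.
Proof.
move=> m1 mg gM.
have icst (r : R) : m.-integrable setT (EFin \o (fun=> r)).
  apply/integrableP; split; first exact/measurable_EFinP.
  by rewrite /= integral_cst// m1 mule1 ltry.
have ig : m.-integrable setT (EFin \o g).
  apply: (le_integrable measurableT _ _ (icst M)); first exact/measurable_EFinP.
  move=> y _ /=; rewrite lee_fin; apply: le_trans (gM y) _; exact: ler_norm.
by rewrite RintegralD// Rintegral_cst// m1 mulr1.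
Qed.

Lemma Rintegral1 {d : measure_display} {T : measurableType d}
    {R : realType} (m : {measure set T -> \bar R}) :
  m setT = 1%E -> \int[m]_y 1 = 1.
Proof. by move=> m1; rewrite Rintegral_cst// m1 mulr1. Qed.

Theorem theorem1p3 (R : realType) (N : nat) (Rt Rp : {fset 'rV[R]_N})
    (k : 'rV[R]_N -> R) (E : 'rV[R[i]]_N -> 'rV[R[i]]_N -> R[i]^o)
    (lam x : 'rV[R]_N) (d : measure_display) (T : measurableType d)
    (P : probability T R) (X : R -> T -> 'rV[R]_N) :
  (0 < N)%N ->
  root_system Rt ->
  positive_subsystem Rt Rp ->
  multiplicity_function Rt k ->
  is_dunkl_kernel Rp k E ->
  regular Rt lam ->
  dunkl_process Rp k E lam x P X ->
  cvg_in_distribution P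
    (fun t w => (Num.sqrt t)^-1 *: (X t w - t *: lam))
    (std_normal_rV R N).
Proof.
move=> _ rootR posR multR kerE reg procX.
have [n [e [tau [eW [i0 e0] etau _]]]] := weyl_enum rootR posR.
pose O := [fset e i lam | i : 'I_n]%fset.
have O_refl a mu : a \in Rp -> mu \in O -> reflection a mu \in O.
  move=> aR /imfsetP[i _ ->]; apply/imfsetP; exists (tau a i) => //.
  by rewrite etau.
have O_reg a mu : a \in Rp -> mu \in O -> dot a mu != 0.
  move=> aR /imfsetP[i _ ->]; apply: (weyl_regular rootR reg (eW i)).
  exact: (posroot_root posR).
have O_norm mu : mu \in O -> sqnorm mu = sqnorm lam.
  by move=> /imfsetP[i _ ->]; rewrite /sqnorm (weyl_isometry rootR).
have lamO : lam \in O by apply/imfsetP; exists i0; rewrite ?e0.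
have [c hc] := expectation_cvg rootR posR multR kerE O_refl O_reg O_norm lamO procX.
have nu1 : std_normal_rV R N setT = 1%E by exact: power_normal_setT.
(* Test with [g = 1]: the expectations and the limiting integral are all 1. *)
have c1 : c = 1.
  have one1 (y : 'rV[R]_N) : 0 <= (1 : R) <= 1 by rewrite ler01 lexx.
  have cst1 : continuous (fun _ : 'rV[R]_N => (1 : R)).
    by move=> y; exact: (@cvg_cst _ _ _ _ (nbhs_filter y)).
  have := hc _ _ cst1 one1.
  rewrite (Rintegral1 nu1) (Rintegral1 (probability_setT P)) mulr1 => h.
  have h1 : (fun _ : R => (1 : R)) @ pinfty_nbhs R --> (1 : R).
    exact: cvg_cst.
  by rewrite -(cvg_lim _ h)// (cvg_lim _ h1).
move=> g cg [M gM].
have mg : measurable_fun setT g by exact: continuous_measurable_rV.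
(* Adding [M] makes the test function nonnegative; both measures have mass 1, so the shift cancels
   at the end. *)
have gM2 y : 0 <= g y + M <= M + M.
  by have := gM y; rewrite ler_norml => /andP[]; lra.
have cgM : continuous (fun y => g y + M).
  move=> y; apply: (@cvgD _ _ _ _ (nbhs_filter y)); first exact: (cg y).
  exact: (@cvg_cst _ _ _ _ (nbhs_filter y)).
have := hc _ _ cgM gM2; rewrite c1 mul1r Rintegral_shift// => h.
have {}h : \int[P]_w (g ((Num.sqrt t)^-1 *: (X t w - t *: lam)) + M) - M
    @[t --> +oo] --> \int[std_normal_rV R N]_y g y + M - M.
  by apply: cvgB => //; exact: cvg_cst.
rewrite addrK in h.
apply: cvg_trans h; apply: near_eq_cvg; near=> t.
have t0 : 0 < t by near: t; exact: nbhs_pinfty_gt.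
have mX : measurable_fun setT (X t) by exact: (dunkl_measurable procX (ltW t0)).
have mgY : measurable_fun setT
    (fun w => g ((Num.sqrt t)^-1 *: (X t w - t *: lam))).
  exact: (measurableT_comp mg (measurableT_comp (measurable_recenter lam t) mX)).
by rewrite (Rintegral_shift (probability_setT P) mgY (fun w => gM _)) addrK.
Unshelve. all: by end_near. Qed.
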